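(* Let $n\ge 2$, let $U\subset\mathbb R^n$ be an open neighborhood of the origin, and let $u$ solve $$\Delta u=\chi_{\{|\nabla u|>0\}}\quad\text{a.e. in }U .$$ Assume that $0\in\Gamma(u):=\partial\{|\nabla u|>0\}$ is a singular point of the free boundary. Then there exists a unique symmetric matrix $A_0\in\mathbb R^{n\times n}$ with $\operatorname{tr}A_0=1$ such that $$\frac{u(rx)-u(0)}{r^2}\longrightarrow \frac12\,x\cdot A_0x\qquad\text{as } r\downarrow 0,\quad\text{in } C^{1,\alpha}_{\rm loc}(\mathbb R^n)$$ for every $0<\alpha<1$. In particular, the quadratic blow-up of $u$ at the origin is unique.
   Context: $\chi_E$ is the characteristic function of $E$. Solutions $u$ are of class $C^{1,1}_{\rm loc}(U)$ (this is known for this equation and may be taken as part of the notion of solution), so $\nabla u$ is continuous and $\{|\nabla u|>0\}$ is an open subset of $U$; $\partial\{|\nabla u|>0\}$ is its boundary in $U$. Let $Q$ be the set of homogeneous quadratic polynomials $q(x)=\frac12 x\cdot Ax$ with $A\in\mathbb R^{n\times n}$ symmetric and $\operatorname{tr}A=1$ (equivalently $\Delta q=1$). A free boundary point $x_0$ is called a singular point if there exist $r_k\downarrow0$ and $q\in Q$ such that $$\frac{u(x_0+r_kx)-u(x_0)}{r_k^2}\to q\quad\text{in }C^{1,\alpha}_{\rm loc}(\mathbb R^n),$$ for $0<\alpha<1$. For each $R<\infty$, the rescaling $x\mapsto (u(rx)-u(0))/r^2$ is defined on the ball $B_R$ for all sufficiently small $r>0$; convergence in $C^{1,\alpha}_{\rm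 loc}(\mathbb R^n)$ means convergence in $C^{1,\alpha}(B_R)$ for every $R<\infty$. A quadratic blow-up of $u$ at the origin is any limit of these rescalings along a sequence $r_j\downarrow 0$. *)

(* Defs.v *)
From HB Require Import structures.
From mathcomp Require Export all_boot all_order all_algebra.
From mathcomp Require Export all_classical all_reals all_analysis.

Set Implicit Arguments.
Unset Strict Implicit.
Unset Printing Implicit Defensive.

Export Order.TTheory GRing.Theory Num.Theory.
Export numFieldNormedType.Exports.

Local Open Scope classical_set_scope.
Local Open Scope ring_scope.

(* The library norm on 'rV[R]_n is the sup norm, hence a separate Euclidean
   norm. Open sets, differentiability and local Lipschitz continuity do not
   depend on this choice, so for them the library notions are used. *)
Definition enorm (R : realType) (n : nat) (x : 'rV[R]_n) : R :=
  Num.sqrt (\sum_(i < n) x 0 i ^+ 2).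

Definition eball (R : realType) (n : nat) (rho : R) : set 'rV[R]_n :=
  [set x | enorm x < rho].

Definition partial (R : realType) (n : nat) (i : 'I_n) (f : 'rV[R]_n -> R)
  (x : 'rV[R]_n) : R := 'D_(delta_mx 0 i) f x.

Definition grad (R : realType) (n : nat) (f : 'rV[R]_n -> R)
  (x : 'rV[R]_n) : 'rV[R]_n := \row_(i < n) partial i f x.

Definition laplacian (R : realType) (n : nat) (f : 'rV[R]_n -> R)
  (x : 'rV[R]_n) : R := \sum_(i < n) partial i (partial i f) x.

(* n-dimensional Lebesgue measure is not in the library: null sets are
   defined by countable covers by boxes of arbitrarily small total volume. *)
Definition lebesgue_null (R : realType) (n : nat) (N : set 'rV[R]_n) : Prop :=
  forall e : R, 0 < e ->
  exists a b : nat -> 'rV[R]_n,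
    [/\ forall k i, a k 0 i <= b k 0 i,
        N `<=` \bigcup_k [set x | forall i, a k 0 i <= x 0 i <= b k 0 i]
      & (\sum_(0 <= k <oo) (\prod_(i < n) (b k 0 i - a k 0 i))%:E <= e%:E)%E].

Definition ae_in (R : realType) (n : nat) (U : set 'rV[R]_n)
  (P : 'rV[R]_n -> Prop) : Prop := lebesgue_null (U `&` [set x | ~ P x]).

Definition C11_loc (R : realType) (n : nat) (U : set 'rV[R]_n)
    (u : 'rV[R]_n -> R) : Prop :=
  (forall x, U x -> differentiable u x) /\
  (forall x, U x -> exists2 V : set 'rV[R]_n,
     nbhs x V /\ V `<=` U & [lipschitz grad u y | y in V]).

Definition noncritical (R : realType) (n : nat) (U : set 'rV[R]_n)
  (u : 'rV[R]_n -> R) : set 'rV[R]_n := [set x | U x /\ 0 < enorm (grad u x)].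

(* Functions on U are total functions, only their values on U matter. As 'D is
   a total operator (junk-valued where there is no derivative), the existence
   of the pure second derivatives is part of the a.e. equation. *)
Definition solution (R : realType) (n : nat) (U : set 'rV[R]_n)
    (u : 'rV[R]_n -> R) : Prop :=
  C11_loc U u /\
  ae_in U (fun x =>
    (forall i : 'I_n, derivable (partial i u) x (delta_mx 0 i)) /\
    laplacian u x = \1_(noncritical U u) x).

(* Boundary relative to the open set U. *)
Definition free_boundary (R : realType) (n : nat) (U : set 'rV[R]_n)
    (u : 'rV[R]_n -> R) : set 'rV[R]_n :=
  U `&` (closure (noncritical U u) `\` interior (noncritical U u)).

Definition C1a_norm (R : realType) (n : nat) (alpha rho : R)
    (f : 'rV[R]_n -> R) : \bar R :=
  (ereal_sup [set `|f x|%:E | x in eball rho] +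
   ereal_sup [set (enorm (grad f x))%:E | x in eball rho] +
   ereal_sup [set (enorm (grad f z.1 - grad f z.2) /
                   enorm (z.1 - z.2) `^ alpha)%:E
             | z in [set z : 'rV[R]_n * 'rV[R]_n |
                     [/\ eball rho z.1, eball rho z.2 & z.1 != z.2]]])%E.

Definition C1a (R : realType) (n : nat) (alpha rho : R)
    (f : 'rV[R]_n -> R) : Prop :=
  (forall x, eball rho x -> differentiable f x) /\
  (C1a_norm alpha rho f < +oo)%E.

(* f_t --> g in C^{1,alpha}(B_rho) for every rho, along the filter F. The f_t
   are only required to lie in C^{1,alpha}(B_rho) eventually. *)
Definition cvg_C1a_loc (R : realType) (n : nat) (T : Type) (alpha : R)
    (F : set_system T) (f : T -> 'rV[R]_n -> R) (g : 'rV[R]_n -> R) : Prop :=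
  forall rho : R, 0 < rho ->
  [/\ \forall t \near F, C1a alpha rho (f t),
      C1a alpha rho g
    & C1a_norm alpha rho (fun x => f t x - g x) @[t --> F] --> 0%E].

Definition rescale (R : realType) (n : nat) (u : 'rV[R]_n -> R)
  (x0 : 'rV[R]_n) (r : R) (x : 'rV[R]_n) : R :=
  (u (x0 + r *: x) - u x0) / r ^+ 2.

Definition quad (R : realType) (n : nat) (A : 'M[R]_n) (x : 'rV[R]_n) : R :=
  2^-1 * (x *m A *m x^T) 0 0.

Definition Q (R : realType) (n : nat) : set ('rV[R]_n -> R) :=
  [set q | exists2 A : 'M[R]_n, A^T = A /\ \tr A = 1 & q = quad A].

Definition decreases_to_0 (R : realType) (r : nat -> R) : Prop :=
  (forall k, 0 < r k) /\ r k @[k --> \oo] --> 0.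

Definition singular_point (R : realType) (n : nat) (U : set 'rV[R]_n)
    (u : 'rV[R]_n -> R) (x0 : 'rV[R]_n) : Prop :=
  free_boundary U u x0 /\
  exists (r : nat -> R) (q : 'rV[R]_n -> R),
    [/\ decreases_to_0 r, Q q
      & forall alpha : R, 0 < alpha < 1 ->
        cvg_C1a_loc alpha \oo (fun k => rescale u x0 (r k)) q].

Definition quadratic_blowup (R : realType) (n : nat) (alpha : R)
    (u : 'rV[R]_n -> R) (x0 : 'rV[R]_n) (p : 'rV[R]_n -> R) : Prop :=
  exists2 r : nat -> R, decreases_to_0 r
    & cvg_C1a_loc alpha \oo (fun k => rescale u x0 (r k)) p.

(* Main.v *)
From HB Require Import structures.
Require Import Defs.
From mathcomp Require Import measurable_realfun.
From mathcomp Require Import ring lra.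

Set Implicit Arguments.
Unset Strict Implicit.
Unset Printing Implicit Defensive.

Local Open Scope classical_set_scope.
Local Open Scope ring_scope.

(** The proof is a monotonicity argument along dilations. Normalise u(0) = 0, put
    u_t(x) = e^(-2t) u(e^t x) and V_t = grad u_t, and let t tend to -oo. Then
    Delta u_t = 1 - 1_(V_t = 0), and d/dt u_t is P_t = x . V_t - 2 u_t (the
    [generator]). Weights are built from p(x) = max(0, 1 - |x|^2), for which
    grad(p^3/6) = - p^2 x; testing the equation with p^2 g (lemma [green]) thus
    produces integrals of x . V_t. Two quantities matter:

      c(s,t) = int p^2 V_s . V_t,    lambda(t) = int (p^3/6) 1_(V_t = 0) >= 0.

    Green's formula computes the derivative of c in one variable, and as c is
    symmetric it may be applied to either one. When s increases and t decreases at
    the same speed, almost everything cancels ([symmetric_step]):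

      d/dh c(t+h, t-h) = lambda(t+h) - lambda(t-h) + E(t+h, t-h) - E(t-h, t+h),

    where E(s,r) = int p^2 1_(V_r = 0) x . V_s. Where the integrand of E(s,r) does
    not vanish, V_s is non-zero but of size O(|s - r|), so that E(s,r) = o(|s - r|)
    ([err_small]). With 2 c(s,r) <= c(s,s) + c(r,r) this says that

      N(t) = c(t,t)/2 - (primitive of lambda)(t)

    has second differences bounded below by - o(h^2), hence is convex ([N_convex]).
    Near the times given by the blow-up sequence, on intervals of any fixed length,
    u_t is close to a fixed quadratic polynomial, so there the increments of N are
    small. A convex function with this property near -oo is nondecreasing
    ([N_nondec]). As c(t,t) >= 0 is bounded, lambda is integrable near -oo.

    Let W(x) = x A be the gradient of the limit, and B(t) = int p^2 V_t . W. The same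
    Green formulas give |B'(t)| <= lambda(t) + C lambda(t + ln 2) ([B_incr]), so B
    converges at -oo. Since int p^2 |V_t - W|^2 = c(t,t) - 2 B(t) + const and c(t,t)
    does not increase towards -oo, smallness of this distance at one time of the
    blow-up sequence persists at all earlier times ([mean_square_cvg0]).

    The V_t are Lipschitz with one constant, so mean-square convergence is uniform,
    which means |grad u(y) - y A| = o(|y|) at the origin ([gradient_expansion]).
    Interpolating between this and the Lipschitz bound yields convergence of the
    rescalings in every C^(1,alpha), alpha < 1 ([cvg_rescale]). Uniqueness holds
    because such limits are pointwise limits and a symmetric matrix is determined by
    its quadratic form.

    Vector fields are carried along as separate data (V instead of grad u), because
    they are globally defined and Lipschitz after truncation, whereas u solves its
    equation near the origin only. *)

(** * Lebesgue measure in dimension n *)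

Section sigma_finite_copy.
Context d (T : measurableType d) (R : realType).
Variables (mu : {measure set T -> \bar R}) (sf : sigma_finite setT mu).

(** Product measures read sigma-finiteness off the structure carried by a
    measure. The copy makes a measure eligible once a proof is available. *)
Definition sfcopy of sigma_finite setT mu : set T -> \bar R := mu.

HB.instance Definition _ := Measure.copy (sfcopy sf) mu.
HB.instance Definition _ := Measure_isSigmaFinite.Build _ _ _ (sfcopy sf) sf.

Definition sigma_finite_of : {sigma_finite_measure set T -> \bar R} := sfcopy sf.
End sigma_finite_copy.

Section lebn.
Variable R : realType.
Local Notation mR := (measurableTypeR R).
Local Notation leb := (@lebesgue_measure R).

Definition pushm d1 d2 (T1 : measurableType d1) (T2 : measurableType d2)
  (m : {measure set T1 -> \bar R}) (f : T1 -> T2)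
  (mf : measurable_fun setT f) : {measure set T2 -> \bar R} :=
  measure_function_pushforward__canonical__measure_function_Measure m mf.

Definition aff1 (c a : R) (x : mR) : mR := c * x + a.

Lemma measurable_aff1 c a : measurable_fun setT (aff1 c a).
Proof.
by apply: measurable_funD => //; apply: measurable_funM => //.
Qed.

Lemma aff1_itv c a (x y : R) : 0 < c -> aff1 c a @^-1` `]x, y] = `](x - a) / c, (y - a) / c]%classic.
Proof.
move=> c0; apply/seteqP; split => z /=; rewrite !in_itv/= /aff1 ltr_pdivrMr// ler_pdivlMr// mulrC => /andP[h1 h2]; apply/andP; split; lra.
Qed.

(** Both sides, multiplied by c, are measures in A that agree on intervals, hence
    they agree by uniqueness of Lebesgue measure. *)
Lemma leb_aff1 c a (A : set mR) : 0 < c -> measurable A ->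
  leb (aff1 c a @^-1` A) = (c^-1%:E * leb A)%E.
Proof.
move=> c0 mA.
have mpf := measurable_aff1 c a.
pose m' : {measure set mR -> \bar R} := mscale (NngNum (ltW c0)) (pushm leb mpf).
rewrite (@lebesgue_measure_unique R m' _ A mA).
  by rewrite /m' /mscale/= muleA -EFinM mulVf ?gt_eqF// mul1e//.
move=> _ [[x y]] _ <-.
rewrite -[m' _]/(c%:E * leb (aff1 c a @^-1` `]x, y]%classic))%E.
rewrite [X in leb X]/= aff1_itv// !lebesgue_measure_itv/= !lte_fin.
rewrite ltr_pM2r ?invr_gt0// ltrBlDr subrK; case: ifP => _; last by rewrite mule0.
rewrite -!EFinD -EFinM; congr (_ %:E); field; exact: lt0r_neq0.
Qed.

Definition affn n (c : R) (a : n.-tuple R) (x : n.-tuple mR) : n.-tuple mR :=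
  [tuple (c * tnth x i + tnth a i : mR) | i < n].

Lemma measurable_affn n c a : measurable_fun setT (@affn n c a).
Proof.
apply/measurable_fun_tnthP => i.
rewrite (_ : _ \o _ = fun x => aff1 c (tnth a i) (tnth x i)); last first.
  by apply/funext => x /=; rewrite tnth_mktuple.
apply: (measurableT_comp (measurable_aff1 _ _)); exact: measurable_tnth.
Qed.

Definition consm n (x : mR * n.-tuple mR) : n.+1.-tuple mR := [the n.+1.-tuple mR of x.1 :: x.2].

Lemma measurable_consm n : measurable_fun setT (@consm n).
Proof. exact: measurable_cons. Qed.

(** Measurability is a matter of tuples and topology a matter of row vectors, so sets
    are measured on the tuple side. *)
Definition boxn n (a b : 'I_n -> R) : set (n.-tuple mR) :=
  [set x | forall i, a i <= tnth x i <= b i].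

Lemma measurable_boxn n (a b : 'I_n -> R) : measurable (boxn a b).
Proof.
rewrite (_ : boxn a b = \bigcap_(i in [set: 'I_n]) ((@tnth _ mR) ^~ i @^-1` `[a i, b i])).
  apply: fin_bigcap_measurable => // i _.
  rewrite -[X in measurable X]setTI; exact: measurable_tnth.
apply/seteqP; split => x /= h i; first by move=> _ /=; rewrite in_itv/=; exact: h.
by have := h i I; rewrite /= in_itv.
Qed.

Lemma bigcup_boxn n : \bigcup_k (@boxn n (fun=> - k%:R) (fun=> k%:R)) = setT.
Proof.
apply/seteqP; split => // x _.
pose M := \sum_(i < n) `|tnth x i|.
exists (Num.truncn M).+1 => // i /=.
rewrite -ler_norml; apply: ltW.
apply: le_lt_trans (truncnS_gt M).
rewrite /M (bigD1 i)//= lerDl; exact: sumr_ge0.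
Qed.

Lemma sigma_finite_boxn n (mu : {measure set (n.-tuple mR) -> \bar R}) :
  (forall a b, (forall i, a i <= b i) -> mu (boxn a b) = (\prod_(i < n) (b i - a i))%:E) ->
  sigma_finite setT mu.
Proof.
move=> mubox; exists (fun k => boxn (fun=> - k%:R) (fun=> k%:R)).
  by rewrite bigcup_boxn.
move=> k; split; first exact: measurable_boxn.
rewrite mubox; first exact: ltry.
by move=> i; rewrite (@le_trans _ _ 0)// oppr_le0.
Qed.

(** Induction on n: the product of the one-dimensional measure with the measure in
    dimension n, transported along [consm]. The volumes of boxes make each measure
    sigma-finite, which the next product requires. The law for dilations and
    translations follows from uniqueness of product measures. These two properties
    are all that is used of Lebesgue measure. *)
Lemma lebn_exists n : exists mu : {sigma_finite_measure set (n.-tuple mR) -> \bar R},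
 (forall a b, (forall i, a i <= b i) -> mu (boxn a b) = (\prod_(i < n) (b i - a i))%:E) /\
 (forall (c : R) a A, 0 < c -> measurable A -> mu (affn c a @^-1` A) = ((c ^- n)%:E * mu A)%E).
Proof.
suff [mu [hb ha]] : exists mu : {measure set (n.-tuple mR) -> \bar R},
   (forall a b, (forall i, a i <= b i) -> mu (boxn a b) = (\prod_(i < n) (b i - a i))%:E) /\
 (forall (c : R) a A, 0 < c -> measurable A -> mu (affn c a @^-1` A) = ((c ^- n)%:E * mu A)%E).
  have sf := sigma_finite_boxn hb.
  pose mu' : {sigma_finite_measure set (n.-tuple mR) -> \bar R} := sigma_finite_of sf.
  by exists mu'.
elim: n => [|n [mu [hb ha]]].
  exists (\d_([tuple] : 0.-tuple mR)); split => [a b _|c a A c0 mA].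
    rewrite big_ord0 /= /dirac indicE mem_set//.
    by case.
  rewrite expr0 invr1 mul1e.
  suff -> : affn c a @^-1` A = A by [].
  by apply/seteqP; split => x /=; rewrite (tuple0 x) (tuple0 (affn _ _ _)).
have sf := sigma_finite_boxn hb.
pose mu' : {sigma_finite_measure set (n.-tuple mR) -> \bar R} := sigma_finite_of sf.
pose nu := (leb \x mu')%E.
exists (pushm nu (@measurable_consm n)); split => [a b ab|c a A c0 mA].
  rewrite /pushm/= /pushforward/=.
  rewrite (_ : _ @^-1` _ = `[a ord0, b ord0]%classic `*` boxn (fun i => a (lift ord0 i)) (fun i => b (lift ord0 i))); last first.
    apply/seteqP; split => -[x y]/=.
      move=> h; split; first by have := h ord0; rewrite in_itv/= .
      by move=> i/=; have := h (lift ord0 i); rewrite /consm/= tnthS.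
    rewrite in_itv/= => -[h1 h2] i.
    have [->|] := eqVneq i ord0; first by rewrite /consm/= tnth0.
    rewrite eq_sym => /unlift_some[j -> _].
    by rewrite /consm/= tnthS.
  rewrite /nu [LHS]product_measure1E//; last exact: measurable_boxn.
  rewrite -[LHS]/(leb `[a ord0, b ord0]%classic * mu (boxn (fun i => a (lift ord0 i)) (fun i => b (lift ord0 i))))%E.
  rewrite lebesgue_measure_itv/= hb// big_ord_recl EFinM; congr (_ * _)%E.
  case: ifPn => //; rewrite lte_fin -leNgt => h.
  by rewrite (_ : b ord0 = a ord0) ?subrr//; apply/eqP; rewrite eq_le h ab.
rewrite -[LHS]/(nu (@consm n @^-1` (affn c a @^-1` A))) -[X in _ = (_ * X)%E]/(nu (@consm n @^-1` A)).
have mA' : measurable (@consm n @^-1` A) by rewrite -[X in measurable X]setTI; exact: measurable_consm.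
pose a' : n.-tuple R := [tuple of behead a].
pose ff (x : mR * n.-tuple mR) := (aff1 c (thead a) x.1, affn c a' x.2).
have mff : measurable_fun setT ff.
  apply: measurable_fun_pair; apply: measurableT_comp => //.
    exact: measurable_aff1.
  exact: measurable_affn.
have -> : @consm n @^-1` (affn c a @^-1` A) = ff @^-1` (@consm n @^-1` A).
  apply/seteqP.
  have H z : affn c a (consm z) = consm (ff z).
    apply: eq_from_tnth => i; rewrite tnth_mktuple.
    have [->|] := eqVneq i ord0; first by rewrite /consm/= !tnth0.
    rewrite eq_sym => /unlift_some[j -> _].
    rewrite /consm/= !tnthS tnth_mktuple tnth_behead; congr (_ + tnth _ _).
    by apply/val_inj; rewrite /= inordK// ltnS ltn_ord.
  by split => z /=; rewrite H.
pose m' : {measure set (mR * n.-tuple mR) -> \bar R} := mscale (NngNum (exprn_ge0 n.+1 (ltW c0))) (pushm nu mff).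
have -> : nu (@consm n @^-1` A) = m' (@consm n @^-1` A).
  apply: product_measure_unique => // B C mB mC.
  rewrite -[LHS]/((c ^+ n.+1)%:E * nu (ff @^-1` (B `*` C)))%E.
  rewrite (_ : ff @^-1` _ = (aff1 c (thead a) @^-1` B) `*` (affn c a' @^-1` C))//.
  rewrite [nu _]product_measure1E//; last 2 first.
    by rewrite -[X in measurable X]setTI; exact: measurable_aff1.
    by rewrite -[X in measurable X]setTI; exact: measurable_affn.
  rewrite -[X in (_ * X)%E]/(leb (aff1 c (thead a) @^-1` B) * mu (affn c a' @^-1` C))%E -[X in _ = (_ * X)%E]/(mu C) leb_aff1// ha// muleACA !muleA -!EFinM exprSr.
  by rewrite mulfK ?gt_eqF// mulfV ?mul1e// gt_eqF// exprn_gt0.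
rewrite -[m' _]/((c ^+ n.+1)%:E * nu (ff @^-1` (@consm n @^-1` A)))%E.
rewrite muleA -EFinM mulVf ?mul1e// gt_eqF//; exact: exprn_gt0.
Qed.
End lebn.

(** * Integrals of bounded functions with bounded support *)

Section Integral.
Variables (R : realType) (n : nat).
Local Notation mR := (measurableTypeR R).
Local Notation E := 'rV[R]_n.
Implicit Types (f g : E -> R) (x y : E).

Lemma coord_le_norm x i : `|x 0 i| <= `|x|.
Proof.
rewrite [X in _ <= X]mx_normrE.
exact: (le_bigmax _ (fun ij => `|x ij.1 ij.2|) (0, i)).
Qed.

Lemma norm_le_coord x C : 0 <= C -> (forall i, `|x 0 i| <= C) -> `|x| <= C.
Proof.
move=> C0 h; rewrite [X in X <= _]mx_normrE.
by apply: bigmax_le => // -[i j] _ /=; rewrite ord1.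
Qed.

Definition row_of_tuple (t : n.-tuple mR) : E := \row_i tnth t i.
Definition tuple_of_row x : n.-tuple mR := [tuple (x 0 i : mR) | i < n].

Definition lebn : {sigma_finite_measure set (n.-tuple mR) -> \bar R} :=
  projT1 (cid (lebn_exists R n)).

Lemma lebn_box a b : (forall i, a i <= b i) ->
  lebn (boxn a b) = (\prod_(i < n) (b i - a i))%:E.
Proof. by move=> ab; rewrite /lebn; case: cid => mu /= -[+ _]; exact. Qed.

Lemma lebn_aff (c : R) a A : 0 < c -> measurable A ->
  lebn (affn c a @^-1` A) = ((c ^- n)%:E * lebn A)%E.
Proof. by move=> c0 mA; rewrite /lebn; case: cid => mu /= -[_]; exact. Qed.

Definition meas f := measurable_fun setT (f \o row_of_tuple).

Definition cube (C : R) : set (n.-tuple mR) := boxn (fun=> - C) (fun=> C).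

Lemma cubeE C t : 0 <= C -> cube C t <-> `|row_of_tuple t| <= C.
Proof.
move=> C0; split => [h|h i].
  by apply: norm_le_coord => // i; rewrite mxE ler_norml.
by have := coord_le_norm (row_of_tuple t) i; rewrite mxE -ler_norml => /le_trans; exact.
Qed.

Lemma row_of_tuple_coord i : measurable_fun setT (fun t => row_of_tuple t 0 i).
Proof.
rewrite (_ : (fun _ => _) = fun t => tnth t i); first exact: measurable_tnth.
by apply/funext => t; rewrite mxE.
Qed.

(** The Borel structure on tuples is a product. An open set is the union of the
    rational boxes it contains, and these are countably many. *)
Lemma meas_open (O : set E) : open O -> measurable (row_of_tuple @^-1` O).
Proof.
move=> oO.
pose B (q : n.-tuple rat * nat) : set (n.-tuple mR) :=
  \bigcap_(i in [set: 'I_n]) ((fun t => row_of_tuple t 0 i) @^-1` `]ratr (tnth q.1 i) - q.2.+1%:R^-1, ratr (tnth q.1 i) + q.2.+1%:R^-1[).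
pose good : set (n.-tuple rat * nat) := [set q | B q `<=` row_of_tuple @^-1` O].
have mB q : measurable (B q).
  apply: fin_bigcap_measurable => // i _.
  rewrite -[X in measurable X]setTI; exact: row_of_tuple_coord.
pose F q := if `[< good q >] then B q else set0.
rewrite (_ : _ @^-1` _ = \bigcup_q F q).
  apply: countable_bigcupT_measurable; first exact: countableP.
  by move=> q; rewrite /F; case: ifP.
apply/seteqP; split => t /=; last first.
  by move=> [q _]; rewrite /F; case: asboolP => // Jq /Jq.
move=> Ot.
have /nbhs_ballP[e /= e0 eO] : nbhs (row_of_tuple t) O by exact: open_nbhs_nbhs.
have [k ke] : exists k : nat, 2 * k.+1%:R^-1 < e.
  have e2 : 0 < e / 2 by rewrite divr_gt0.
  have [k] := @ltr_add_invr R 0 (e / 2) e2; rewrite add0r => h; exists k.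
  by rewrite mulrC -ltr_pdivlMr.
have kp : 0 < k.+1%:R^-1 :> R by rewrite invr_gt0.
have /choice[q hq] : forall i : 'I_n, exists q : rat, tnth t i - k.+1%:R^-1 < ratr q < (tnth t i : R).
  move=> i; have /= := @rat_in_itvoo R (tnth t i - k.+1%:R^-1) (tnth t i).
  rewrite ltrBlDr ltrDl => /(_ kp) [q]; rewrite in_itv/= => h; by exists q.
(* the box of half-width 1/(k+1) around q contains t and has diameter less than e *)
exists ([tuple q i | i < n], k) => //.
rewrite /F; case: asboolP.
  move=> _ i _ /=; rewrite !tnth_mktuple in_itv/= mxE.
  have H (x y z : R) : y - z < x < y -> 0 < z -> (x - z < y) && (y < x + z) by move=> /andP[h1 h2] z0; apply/andP; split; lra.
  exact: H (hq i) kp.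
case=> s /= hs; apply: eO; rewrite mx_norm_ball /ball_/=.
apply: le_lt_trans ke; apply: norm_le_coord; first by rewrite mulr_ge0// ltW.
move=> i; have := hs i I; rewrite /= tnth_mktuple in_itv/= !mxE.
have H (x y z w : R) : y - z < x < y -> x - z < w < x + z -> `|y - w| <= 2 * z.
  by move=> /andP[h1 h2] /andP[h3 h4]; rewrite ler_norml; apply/andP; split; lra.
exact: H (hq i).
Qed.

Lemma meas_continuous f : continuous f -> meas f.
Proof.
move=> /continuousP cf; apply: (measurability _ (RGenOpens.measurableE R)) => //.
move=> _ [_ [a [b ->] <-]]; rewrite setTI comp_preimage.
by apply: meas_open; apply: cf; exact: interval_open.
Qed.

Lemma meas_lim (F : nat -> E -> R) f : (forall k, meas (F k)) ->
  (forall x, F k x @[k --> \oo] --> f x) -> meas f.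
Proof.
move=> mF Ff; apply: (@measurable_fun_cvg _ _ _ _ (fun k => F k \o row_of_tuple)) => //.
by move=> t _; exact: Ff.
Qed.

Lemma measD f g : meas f -> meas g -> meas (fun x => f x + g x).
Proof. exact: measurable_funD. Qed.
Lemma measM f g : meas f -> meas g -> meas (fun x => f x * g x).
Proof. exact: measurable_funM. Qed.
Lemma measB f g : meas f -> meas g -> meas (fun x => f x - g x).
Proof. exact: measurable_funB. Qed.
Lemma meas_cst c : meas (fun=> c).
Proof. exact: measurable_cst. Qed.
Lemma meas_norm f : meas f -> meas (fun x => `|f x|).
Proof. by move=> mf; apply: (@measurableT_comp _ _ _ _ _ _ (@Num.norm R R)) => //; exact: measurable_normr. Qed.
Lemma meas_sum (T : Type) (s : seq T) (F : T -> E -> R) : (forall i, meas (F i)) ->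
  meas (fun x => \sum_(i <- s) F i x).
Proof.
by move=> h; apply: measurable_sum => i; exact: h.
Qed.

Lemma row_of_affn (c : R) (a : E) t :
  row_of_tuple (affn c (tuple_of_row a) t) = c *: row_of_tuple t + a.
Proof. by apply/rowP => i; rewrite !mxE !tnth_mktuple. Qed.

Lemma meas_aff f (c : R) a : meas f -> meas (fun x => f (c *: x + a)).
Proof.
move=> mf; rewrite /meas.
rewrite (_ : _ \o _ = (f \o row_of_tuple) \o affn c (tuple_of_row a)).
  by apply: measurableT_comp => //; exact: measurable_affn.
by apply/funext => t /=; rewrite row_of_affn.
Qed.

(** One constant bounds both the values and the support, so that a single number
    yields an integrable majorant. *)
Definition bddsupp f C := forall x, `|f x| <= C /\ (C < `|x| -> f x = 0).
Definition adm f := meas f /\ exists C, bddsupp f C.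

Definition Int f : R := (\int[lebn]_t f (row_of_tuple t))%R.

Lemma bddsupp_ge0 f C : bddsupp f C -> 0 <= C.
Proof. by move=> /(_ 0)[h _]; exact: le_trans h. Qed.

Lemma measurable_cube C : measurable (cube C).
Proof. exact: measurable_boxn. Qed.

Lemma lebn_cube C : 0 <= C -> (lebn (cube C) < +oo)%E.
Proof. by move=> C0; rewrite lebn_box ?ltry// => i; rewrite ge0_cp. Qed.

Lemma indic_integrable A : measurable A -> (lebn A < +oo)%E ->
  lebn.-integrable setT (EFin \o \1_A).
Proof.
move=> mA lA; apply/integrableP; split.
  by apply/measurable_EFinP; exact: measurable_indic.
rewrite (eq_integral (fun t => (\1_A t)%:E)); last by move=> t _ /=; rewrite ger0_norm.
by rewrite integral_indic// setIT.
Qed.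

Lemma dom_integrable C : 0 <= C ->
  lebn.-integrable setT (fun t => (C * \1_(cube C) t)%:E).
Proof.
move=> C0.
have := integrableZl measurableT C (indic_integrable (measurable_cube C) (lebn_cube C0)).
by apply: eq_integrable => // t _; rewrite /= EFinM.
Qed.

Lemma bddsupp_dom f C t : bddsupp f C ->
  `|f (row_of_tuple t)| <= C * \1_(cube C) t.
Proof.
move=> h; have C0 := bddsupp_ge0 h.
have [h1 h2] := h (row_of_tuple t).
have [hC|/h2 ->] := leP `|row_of_tuple t| C.
  by rewrite indicE mem_set ?mulr1//; apply/cubeE.
by rewrite normr0 mulr_ge0.
Qed.

Lemma adm_integrable f : adm f -> lebn.-integrable setT (EFin \o (f \o row_of_tuple)).
Proof.
move=> [mf [C bf]]; have C0 := bddsupp_ge0 bf.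
apply: (le_integrable _ _ _ (dom_integrable C0)) => //.
  exact/measurable_EFinP.
move=> t _ /=; rewrite lee_fin [X in _ <= X]ger0_norm ?mulr_ge0//.
exact: bddsupp_dom.
Qed.

Lemma admD f g : adm f -> adm g -> adm (fun x => f x + g x).
Proof.
move=> [mf [C bf]] [mg [D bg]]; split; first exact: measD.
have C0 := bddsupp_ge0 bf; have D0 := bddsupp_ge0 bg.
exists (C + D) => x; have [h1 h2] := bf x; have [h3 h4] := bg x; split.
  by apply: le_trans (ler_normD _ _) _; exact: lerD.
by move=> h; rewrite h2 ?h4 ?addr0//; apply: le_lt_trans h; rewrite ?lerDl ?lerDr.
Qed.

Lemma admZ c f : adm f -> adm (fun x => c * f x).
Proof.
move=> [mf [C bf]]; split; first exact: (measM (meas_cst c)).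
have C0 := bddsupp_ge0 bf.
exists ((`|c| + 1) * C) => x; have [h1 h2] := bf x; split.
  by rewrite normrM ler_pM// lerDl.
move=> h; rewrite h2 ?mulr0//; apply: le_lt_trans h.
by rewrite ler_peMl// lerDr.
Qed.

Lemma admB f g : adm f -> adm g -> adm (fun x => f x - g x).
Proof.
move=> af ag; have := admD af (admZ (-1) ag).
by congr adm; apply/funext => x; rewrite mulN1r.
Qed.

Lemma adm_norm f : adm f -> adm (fun x => `|f x|).
Proof.
move=> [mf [C bf]]; split; first exact: meas_norm.
exists C => x; have [h1 h2] := bf x; rewrite normr_id; split=> // /h2 ->.
by rewrite normr0.
Qed.

Lemma eq_Int f g : f =1 g -> Int f = Int g.
Proof. by move=> /funext ->. Qed.

Lemma IntD f g : adm f -> adm g -> Int (fun x => f x + g x) = Int f + Int g.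
Proof. by move=> af ag; apply: RintegralD => //; exact: adm_integrable. Qed.

Lemma IntB f g : adm f -> adm g -> Int (fun x => f x - g x) = Int f - Int g.
Proof. by move=> af ag; apply: RintegralB => //; exact: adm_integrable. Qed.

Lemma IntZ c f : adm f -> Int (fun x => c * f x) = c * Int f.
Proof. by move=> af; apply: RintegralZl => //; exact: adm_integrable. Qed.

Lemma Int_le f g : adm f -> adm g -> (forall x, f x <= g x) -> Int f <= Int g.
Proof. by move=> af ag fg; apply: le_Rintegral => //; exact: adm_integrable. Qed.

Lemma Int_ge0 f : (forall x, 0 <= f x) -> 0 <= Int f.
Proof. by move=> f0; apply: Rintegral_ge0. Qed.

Lemma Int0 : Int (fun=> 0) = 0.
Proof. by rewrite /Int Rintegral_cst// mul0r. Qed.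

(** The change of variables formula for pushforwards is available for nonnegative
    integrands; the general case is the difference of |f| and |f| - f. *)
Lemma Int_aff f (c : R) a : 0 < c -> adm f -> Int (fun x => f (c *: x + a)) = c ^- n * Int f.
Proof.
move=> c0.
have H (g : E -> R) : adm g -> (forall x, 0 <= g x) ->
    Int (fun x => g (c *: x + a)) = c ^- n * Int g.
  move=> ag g0; have [mg _] := ag.
  have mf : measurable_fun setT (affn c (tuple_of_row a)) := @measurable_affn _ _ _ _.
  have cn0 : 0 <= c ^- n by rewrite invr_ge0 exprn_ge0// ltW.
  have E1 : (\int[lebn]_t (g (c *: row_of_tuple t + a))%:E =
      \int[pushm lebn mf]_t (g (row_of_tuple t))%:E)%E.
    have := @ge0_integral_pushforward _ _ _ _ R _ mf lebn setT (fun t => (g (row_of_tuple t))%:E) measurableT.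
    rewrite preimage_setT => -> //; last first.
    - by move=> t _; rewrite lee_fin.
    - exact/measurable_EFinP.
    by apply: eq_integral => t _ /=; rewrite row_of_affn.
  pose m2 : {measure set _ -> \bar R} := mscale (NngNum cn0) lebn.
  have E2 : (\int[pushm lebn mf]_t (g (row_of_tuple t))%:E = \int[m2]_t (g (row_of_tuple t))%:E)%E.
    apply: eq_measure_integral => A mA _.
    by rewrite -[LHS]/(lebn (affn c (tuple_of_row a) @^-1` A)) lebn_aff.
  rewrite /Int /Rintegral E1 E2 ge0_integral_mscale//; last first.
  - by move=> t _; rewrite lee_fin.
  - exact/measurable_EFinP.
  rewrite fineM//; apply: integrable_fin_num => //; exact: adm_integrable.
move=> af.
have a1 : adm (fun x => `|f x|) by exact: adm_norm.
have a2 : adm (fun x => `|f x| - f x) by exact: admB.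
have aaff (g : E -> R) : adm g -> adm (fun x => g (c *: x + a)).
  move=> [mg [C bg]]; split; first exact: meas_aff.
  have C0 := bddsupp_ge0 bg.
  exists (C + c^-1 * (C + `|a|)) => x; have [h1 h2] := bg (c *: x + a); split.
    by apply: le_trans h1 _; rewrite lerDl mulr_ge0 ?invr_ge0 ?addr_ge0// ltW.
  move=> h; apply: h2.
  have : C + `|a| < `|c *: x|.
    rewrite normrZ gtr0_norm// mulrC -ltr_pdivrMr// mulrC.
    by apply: le_lt_trans h; rewrite lerDr.
  have := ler_normB (c *: x + a) a; rewrite addrK => h3 h4.
  by rewrite -(ltrD2r `|a|); apply: lt_le_trans h4 h3.
have e1 : Int (fun x => f (c *: x + a)) = Int (fun x => `|f (c *: x + a)|) - Int (fun x => `|f (c *: x + a)| - f (c *: x + a)).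
  rewrite -IntB; [|exact: (aaff _ a1)|exact: (aaff _ a2)].
  by apply: eq_Int => x; rewrite subKr.
have e2 : Int f = Int (fun x => `|f x|) - Int (fun x => `|f x| - f x).
  rewrite -IntB//; by apply: eq_Int => x; rewrite subKr.
rewrite e1 e2 (H _ a1)// (H _ a2) ?mulrBr// => x.
by rewrite subr_ge0 ler_norm.
Qed.

(** The intersection over k of box covers of volume at most 1/(k+1) is a measurable
    null set containing N. *)
Lemma lebesgue_null_negligible (N : set E) : lebesgue_null N ->
  lebn.-negligible (row_of_tuple @^-1` N).
Proof.
move=> nN.
have H (k : nat) : exists A : set (n.-tuple mR), [/\ measurable A, row_of_tuple @^-1` N `<=` A & (lebn A <= k.+1%:R^-1%:E)%E].
  have k0 : 0 < k.+1%:R^-1 :> R by rewrite invr_gt0.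
  have [a [b [ab Nab le]]] := nN _ k0.
  pose F j := boxn (fun i => a j 0 i) (fun i => b j 0 i) : set (n.-tuple mR).
  have mF j : measurable (F j) by exact: measurable_boxn.
  exists (\bigcup_j F j); split; first exact: bigcup_measurable.
    by move=> t /Nab[j _ h]; exists j => // i; have := h i; rewrite mxE.
  apply: le_trans le; apply: le_trans (measure_sigma_subadditive lebn _ _ (@subset_refl _ _)) _ => //.
    exact: bigcup_measurable.
  have hF j : lebn (F j) = (\prod_(i < n) (b j 0 i - a j 0 i))%:E by exact: lebn_box.
  by apply: lee_nneseries => // j _; rewrite [X in (X <= _)%E]hF.
have [A hA] := choice H.
exists (\bigcap_k A k); split.
- by apply: bigcapT_measurable => k; have [] := hA k.
- apply/eqP; rewrite eq_le measure_ge0 andbT.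
  apply/lee_addgt0Pr => e e0; rewrite add0e.
  have [k] := @ltr_add_invr R 0 e e0; rewrite add0r => ke.
  have [mA _ le] := hA k.
  apply: le_trans (le_trans _ le) _; last by rewrite lee_fin ltW.
  apply: le_measure; rewrite ?inE//.
    by apply: bigcapT_measurable => j; have [] := hA j.
  by move=> t; exact.
- by move=> t Nt k _; have [_ + _] := hA k; exact.
Qed.

Lemma Int_cvg_ae (F : nat -> E -> R) f C (N : set E) : (forall k, meas (F k)) -> meas f ->
  (forall k, bddsupp (F k) C) -> lebn.-negligible (row_of_tuple @^-1` N) ->
  (forall x, ~ N x -> F k x @[k --> \oo] --> f x) ->
  Int (F k) @[k --> \oo] --> Int f.
Proof.
move=> mF mf bF nN Ff.
have C0 := bddsupp_ge0 (bF 0%N).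
have := @dominated_convergence _ _ _ lebn setT measurableT
  (fun k t => (F k (row_of_tuple t))%:E) (fun t => (f (row_of_tuple t))%:E)
  (fun t => (C * \1_(cube C) t)%:E).
case.
- by move=> k; apply/measurable_EFinP; exact: mF.
- exact/measurable_EFinP.
- apply: negligibleS nN => t /= h.
  apply: contrapT => nNt; apply: h => _; apply: cvg_EFin; last exact: Ff.
  by apply: nearW => k.
- exact: dom_integrable.
- by apply: nearW => t k _; rewrite lee_fin bddsupp_dom.
move=> intf _ cv.
have -> : Int f = fine (\int[lebn]_t (f (row_of_tuple t))%:E)%E by [].
apply: fine_cvg; rewrite fineK//; exact: integrable_fin_num.
Qed.

Lemma Int_cvg (F : nat -> E -> R) f C : (forall k, meas (F k)) -> meas f ->
  (forall k, bddsupp (F k) C) -> (forall x, F k x @[k --> \oo] --> f x) ->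
  Int (F k) @[k --> \oo] --> Int f.
Proof.
move=> mF mf bF Ff; apply: (@Int_cvg_ae _ _ C set0) => //.
by rewrite preimage_set0; exact: negligible_set0.
Qed.
Lemma Int_box_ge f x0 (c m : R) : 0 <= c -> 0 <= m -> adm f -> (forall x, 0 <= f x) ->
  (forall x, `|x - x0| <= c -> m <= f x) -> m * (2 * c) ^+ n <= Int f.
Proof.
move=> c0 m0 af f0 fm.
pose a i := x0 0 i - c; pose b i := x0 0 i + c.
have ab i : a i <= b i by rewrite /a /b lerBlDr -addrA lerDl addr_ge0.
have mB := measurable_boxn a b.
have lB : (lebn (boxn a b) < +oo)%E by rewrite lebn_box// ltry.
have ib := indic_integrable mB lB.
have imb : (lebn).-integrable setT (fun t => (m * \1_(boxn a b) t)%:E).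
  have := integrableZl measurableT m ib.
  by apply: eq_integrable => // t _; rewrite /= EFinM.
have -> : m * (2 * c) ^+ n = (\int[lebn]_t (m * \1_(boxn a b) t))%R.
  rewrite RintegralZl//; congr (_ * _).
  rewrite /Rintegral integral_indic; [|exact: measurableT|exact: mB].
  rewrite setIT; transitivity (\prod_(i < n) (b i - a i)).
    rewrite -[X in _ ^+ X]card_ord -prodr_const; apply: eq_bigr => i _.
    by rewrite /a /b; ring.
  by rewrite -[LHS]/(fine (_%:E)); congr fine; apply/esym; exact: lebn_box.
apply: le_Rintegral => //; first exact: adm_integrable.
move=> t _; rewrite indicE; case: (boolP (t \in _)) => [/set_mem h|_]; last by rewrite mulr0 f0.
rewrite mulr1; apply: fm; apply: norm_le_coord => // i.
have := h i; rewrite !mxE ler_norml /a /b => /andP[h1 h2].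
by apply/andP; split; lra.
Qed.
End Integral.

(** * Weak form of an equation that holds almost everywhere *)

Section Calculus.
Variables (R : realType) (n : nat).
Local Notation E := 'rV[R]_n.
Implicit Types (f g : E -> R) (x y v : E).
Local Notation e_ i := (delta_mx 0 i : E).

Lemma is_derive_line f x v d (t : R) : is_derive (x + t *: v) v f d ->
  is_derive t 1 (fun s => f (x + s *: v)) d.
Proof.
move=> [df vf].
have H : (fun h : R => h^-1 *: ((f \o shift (x + t *: v)) (h *: v) - f (x + t *: v))) =
  (fun h : R => h^-1 *: (((fun s => f (x + s *: v)) \o shift t) (h *: 1) - f (x + t *: v))).
  apply/funext => h /=; congr (_ *: (f _ - _)).
  by rewrite [h *: 1]mulr1 scalerDl addrCA.
split; first by move: df; rewrite /derivable H.
by rewrite -vf /derive H.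
Qed.

Lemma is_derive_seq f x v d (h : nat -> R) : is_derive x v f d ->
  h k @[k --> \oo] --> 0 -> (forall k, h k != 0) ->
  (h k)^-1 * (f (x + h k *: v) - f x) @[k --> \oo] --> d.
Proof.
move=> [df vf] h0 hn0.
have := df; rewrite /derivable => /cvg_ex [l hl].
have : d = l by rewrite -vf; apply: cvg_lim.
move=> ->.
have -> : (fun k => (h k)^-1 * (f (x + h k *: v) - f x)) =
  (fun s : R => s^-1 *: ((f \o shift x) (s *: v) - f x)) \o h.
  by apply/funext => k /=; rewrite [x + _]addrC.
apply: cvg_comp hl.
move=> A [e /= e0 hA]; have hB : \forall k \near \oo, ball (0 : R) e (h k) by exact: (h0 _ (nbhsx_ballx 0 e e0)).
have H k : ball (0 : R) e (h k) -> (h @^-1` A) k.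
  move=> hk; apply: hA; last exact: hn0.
  by rewrite -ball_normE in hk.
exact: filterS H hB.
Qed.

Lemma mvt_le f x v (F : E -> R) (a b C : R) : a <= b ->
  (forall t, a <= t <= b -> is_derive (x + t *: v) v f (F (x + t *: v))) ->
  (forall t, a <= t <= b -> `|F (x + t *: v)| <= C) ->
  `|f (x + b *: v) - f (x + a *: v)| <= C * (b - a).
Proof.
move=> ab df FC.
have dl t : a <= t <= b -> is_derive t 1 (fun s => f (x + s *: v)) (F (x + t *: v)).
  by move=> /df; exact: is_derive_line.
have [||c] := @MVT_segment R (fun s => f (x + s *: v)) (fun t => F (x + t *: v)) a b ab.
- by move=> t; rewrite in_itv/= => /andP[h1 h2]; apply: dl; rewrite !ltW.
- apply: derivable_within_continuous => t; rewrite in_itv/= => h.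
  by have [] := dl _ h.
rewrite in_itv/= => hc ->.
by rewrite normrM (ger0_norm (x := b - a)) ?subr_ge0// ler_wpM2r ?subr_ge0// FC.
Qed.

Lemma continuous_bounded f C : continuous f -> exists2 D : R, 0 <= D & forall x, `|x| <= C -> `|f x| <= D.
Proof.
move=> cf.
have cB : compact [set x : E | `|x| <= C].
  apply: bounded_closed_compact.
    by exists C; split; [exact: num_real|move=> D CD x /= h; rewrite (le_trans h)// ltW].
  rewrite (_ : [set x : E | `|x| <= C] = (fun x : E => `|x|) @^-1` [set y | y <= C])//.
  by apply: closed_comp; [move=> x _; exact: norm_continuous|exact: closed_le].
have /compact_bounded : compact (f @` [set x : E | `|x| <= C]).
  by apply: continuous_compact => //; exact: continuous_subspaceT.
move=> [D [_ hD]]; exists (`|D| + 1); first exact: addr_ge0.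
move=> x hx; apply: hD => /=; last by exists x.
by rewrite (le_lt_trans (ler_norm D))// ltrDl.
Qed.

Lemma contM f g : continuous f -> continuous g -> continuous (fun x => f x * g x).
Proof. by move=> cf cg x; apply: continuousM; [exact: cf|exact: cg]. Qed.
Lemma contD f g : continuous f -> continuous g -> continuous (fun x => f x + g x).
Proof. by move=> cf cg x; apply: continuousD; [exact: cf|exact: cg]. Qed.
Lemma contB f g : continuous f -> continuous g -> continuous (fun x => f x - g x).
Proof. by move=> cf cg x; apply: continuousB; [exact: cf|exact: cg]. Qed.
Lemma cont_cst (c : R) : continuous (fun _ : E => c).
Proof. by move=> x; exact: cst_continuous. Qed.
Lemma cont_sum (T : Type) (s : seq T) (F : T -> E -> R) : (forall j, continuous (F j)) ->
  continuous (fun x => \sum_(j <- s) F j x).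
Proof.
move=> cF; elim: s => [|j s IH].
  by under eq_fun do rewrite big_nil; exact: cont_cst.
by under eq_fun do rewrite big_cons; exact: contD.
Qed.
Lemma cont_coord i : continuous (fun x : E => x 0 i).
Proof. exact: coord_continuous. Qed.
Lemma cont_aff f (c : R) a : continuous f -> continuous (fun x => f (c *: x + a)).
Proof.
move=> cf x; apply: (@continuous_comp _ _ _ (fun x : E => c *: x + a) f); last exact: cf.
by apply: continuousD; [exact: continuousZr|exact: cst_continuous].
Qed.
Lemma cont_shift f a : continuous f -> continuous (fun x => f (x + a)).
Proof. by move=> /(@cont_aff f 1 a); under eq_fun do rewrite scale1r. Qed.

Lemma seq_cvg_sum (T : Type) (s : seq T) (F : T -> nat -> R) (l : T -> R) :
  (forall j, F j k @[k --> \oo] --> l j) ->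
  \sum_(j <- s) F j k @[k --> \oo] --> \sum_(j <- s) l j.
Proof.
move=> Fl; elim: s => [|j s IH].
  by under eq_fun do rewrite big_nil; rewrite big_nil; exact: cvg_cst.
by under eq_fun do rewrite big_cons; rewrite big_cons; exact: cvgD.
Qed.

Lemma lip_continuous f (K : R) : (forall x y, `|f x - f y| <= K * `|x - y|) -> continuous f.
Proof.
move=> fK x A /nbhs_ballP[e /= e0 eA].
have K0 : 0 < `|K| + 1 by rewrite ltr_pwDr.
apply/nbhs_ballP; exists (e / (`|K| + 1)); first by rewrite /= divr_gt0.
move=> y; rewrite mx_norm_ball /ball_/= => h; apply: eA.
rewrite -ball_normE /ball_/=; apply: le_lt_trans (fK _ _) _.
apply: (@le_lt_trans _ _ ((`|K| + 1) * `|x - y|)).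
  by rewrite ler_wpM2r// (le_trans (ler_norm K))// lerDl.
by rewrite mulrC -ltr_pdivlMr.
Qed.

Lemma adm0 : adm (fun _ : E => 0 : R).
Proof.
split; first exact: meas_cst.
by exists 0 => x; rewrite normr0.
Qed.

Lemma Int_sum (T : finType) (F : T -> E -> R) : (forall j, adm (F j)) ->
  Int (fun x => \sum_j F j x) = \sum_j Int (F j).
Proof.
move=> aF; rewrite /index_enum; elim: (Finite.enum T) => [|j s IH].
  by rewrite big_nil -[RHS](@Int0 R n); apply: eq_Int => x; rewrite big_nil.
have as_ : adm (fun x => \sum_(i <- s) F i x).
  elim: s {IH} => [|i s IH].
    by have := adm0; congr adm; apply/funext => x; rewrite big_nil.
  by have := admD (aF i) IH; congr adm; apply/funext => x; rewrite big_cons.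
rewrite big_cons -IH -IntD//.
by apply: eq_Int => x; rewrite big_cons.
Qed.

Lemma adm_continuous f C : continuous f -> (forall x, C < `|x| -> f x = 0) -> adm f.
Proof.
move=> cf hC; split; first exact: meas_continuous.
have [D D0 hD] := continuous_bounded `|C| cf.
exists (D + `|C|) => x; split.
  have [/hD h|h] := leP `|x| `|C|; first by rewrite (le_trans h)// lerDl.
  rewrite hC ?normr0 ?addr_ge0//; apply: le_lt_trans h; exact: ler_norm.
move=> h; apply: hC; apply: le_lt_trans h; apply: le_trans (ler_norm C) _.
by rewrite lerDr.
Qed.

Lemma harmonic_seq : (k.+1%:R^-1 : R) @[k --> \oo] --> 0.
Proof. exact: (@cvg_harmonic R). Qed.

Lemma norm_delta i : `|e_ i| = 1 :> R.
Proof.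
apply/eqP; rewrite eq_le; apply/andP; split.
  by apply: norm_le_coord => // j; rewrite mxE eqxx /=; case: (_ == _); rewrite ?normr1 ?normr0.
by have := coord_le_norm (e_ i) i; rewrite mxE !eqxx normr1.
Qed.

(** The gradient is part of the data: its continuity can then be stated coordinate
    by coordinate. *)
Record test (C : R) (eta : E -> R) (deta : E -> E) : Prop := {
  test_cont : continuous eta ;
  test_dcont : forall i, continuous (fun x => deta x 0 i) ;
  test_derive : forall x i, is_derive x (e_ i) eta (deta x 0 i) ;
  test_supp : forall x, C < `|x| -> eta x = 0 ;
  test_dsupp : forall x, C < `|x| -> deta x = 0 }.

Lemma test_lip C eta deta i : test C eta deta -> exists2 D : R, 0 <= D &
  forall x (h : R), `|eta (x + h *: e_ i) - eta x| <= D * `|h|.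
Proof.
move=> [ce cd de se sd].
have [D D0 hD] := continuous_bounded C (cd i).
have hD' x : `|deta x 0 i| <= D.
  by have [/hD//|/sd ->] := leP `|x| C; rewrite mxE normr0.
exists D => // x h.
have [h0|h0] := leP 0 h.
  have := @mvt_le eta x (e_ i) (fun y => deta y 0 i) 0 h D h0.
  by move=> /(_ (fun t _ => de _ i) (fun t _ => hD' _)); rewrite scale0r addr0 subr0 (ger0_norm h0).
have := @mvt_le eta x (e_ i) (fun y => deta y 0 i) h 0 D (ltW h0).
by move=> /(_ (fun t _ => de _ i) (fun t _ => hD' _)); rewrite scale0r addr0 sub0r distrC (ltr0_norm h0).
Qed.

(** V is only Lipschitz, so integration by parts is carried out on difference
    quotients, where it is translation invariance of the integral. Quotients of V are
    bounded by the Lipschitz constant and converge off N, those of eta converge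
    everywhere; bounded convergence passes to the limit on both sides. *)
Lemma weak_divergence (C rho K : R) eta deta (V : E -> E) f (N : set E) :
  test C eta deta -> C < rho ->
  (forall x y, `|V x - V y| <= K * `|x - y|) ->
  meas f -> (forall x, `|f x| <= 1) -> (lebn R n).-negligible (@row_of_tuple R n @^-1` N) ->
  (forall x, `|x| < rho -> ~ N x -> exists2 l : 'I_n -> R,
     forall i, is_derive x (e_ i) (fun y => V y 0 i) (l i) & \sum_i l i = f x) ->
  Int (fun x => \sum_i deta x 0 i * V x 0 i) = - Int (fun x => eta x * f x).
Proof.
move=> T Crho VK mf f1 nN hd.
have [ce cd de se sd] := T.
pose h k : R := k.+1%:R^-1.
have h0 k : 0 < h k by rewrite /h invr_gt0.
have hn0 k : h k != 0 by rewrite gt_eqF.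
have h1 k : h k <= 1 by rewrite /h invf_le1 ?ler1n.
have V_ x y i : `|V x 0 i - V y 0 i| <= K * `|x - y|.
  by apply: le_trans (VK x y); have := coord_le_norm (V x - V y) i; rewrite !mxE.
have cV i : continuous (fun x => V x 0 i) by apply: (@lip_continuous _ K).
have V0 i : exists2 D : R, 0 <= D & forall x, `|x| <= C + 1 -> `|V x 0 i| <= D by apply: continuous_bounded.
(* forward quotients for V, backward ones for eta, as the translation moves over *)
pose q k i x := (h k)^-1 * (V (x + h k *: e_ i) 0 i - V x 0 i).
pose d k i x := (- h k)^-1 * (eta (x + (- h k) *: e_ i) - eta x).
have xh k x i : C + 1 < `|x| -> C < `|x + h k *: e_ i| /\ C < `|x + (- h k) *: e_ i|.
  move=> hx; have H (s : R) : `|s| <= 1 -> C < `|x + s *: e_ i|.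
    move=> s1; rewrite -(ltrD2r 1); apply: lt_le_trans hx _.
    have := ler_normB (x + s *: e_ i) (s *: e_ i); rewrite addrK => /le_trans; apply.
    by rewrite lerD2l normrZ norm_delta mulr1.
  by split; apply: H; rewrite ?normrN (ger0_norm (ltW (h0 k))).
have mq k i : meas (q k i).
  apply: measM; first exact: meas_cst.
  apply: measB; last exact: meas_continuous.
  have := meas_aff 1 (h k *: e_ i) (meas_continuous (cV i)).
  by congr meas; apply/funext => x; rewrite scale1r.
have md k i : meas (d k i).
  apply: measM; first exact: meas_cst.
  apply: measB; last exact: meas_continuous.
  have := meas_aff 1 (- h k *: e_ i) (meas_continuous ce).
  by congr meas; apply/funext => x; rewrite scale1r.
have qK k i x : `|q k i x| <= `|K|.
  rewrite /q normrM normfV (ger0_norm (ltW (h0 k))) mulrC ler_pdivrMr//.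
  apply: le_trans (V_ _ _ _) _; rewrite addrAC subrr add0r normrZ norm_delta mulr1.
  by rewrite ger0_norm ?(ltW (h0 k))// ler_wpM2r ?ler_norm// ltW.
have parts k i : [/\ adm (fun x => d k i x * V x 0 i), adm (fun x => eta x * q k i x) & Int (fun x => d k i x * V x 0 i) = - Int (fun x => eta x * q k i x)].
  have aV (g : E -> R) C' : continuous g -> (forall x, C' < `|x| -> g x = 0) -> adm (fun x => g x * V x 0 i).
    move=> cg hg; apply: (@adm_continuous _ C') => [|x /hg ->]; last by rewrite mul0r.
    exact: contM.
  have a1 : adm (fun x => eta (x + - h k *: e_ i) * V x 0 i).
    apply: (aV (fun x => eta (x + - h k *: e_ i)) (C + 1)) => [|x /(xh k x i)[_]]; last exact: se.
    exact: cont_shift.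
  have a2 : adm (fun x => eta x * V x 0 i) by apply: (aV _ C).
  have a3 : adm (fun x => eta x * V (x + h k *: e_ i) 0 i).
    apply: (@adm_continuous _ C) => [|x /se ->]; last by rewrite mul0r.
    apply: contM; first exact: ce.
    exact: (@cont_shift (fun x => V x 0 i)).
  have e1 : Int (fun x => eta (x + - h k *: e_ i) * V x 0 i) = Int (fun x => eta x * V (x + h k *: e_ i) 0 i).
    have := Int_aff (- h k *: e_ i) ltr01 a3.
    rewrite expr1n invr1 mul1r => <-; apply: eq_Int => x.
    by rewrite scale1r -addrA -scalerDl addNr scale0r addr0.
  have e2 x : d k i x * V x 0 i = - (h k)^-1 * (eta (x + - h k *: e_ i) * V x 0 i - eta x * V x 0 i).
    by rewrite /d invrN -mulrA mulrBl.
  have e3 x : eta x * q k i x = (h k)^-1 * (eta x * V (x + h k *: e_ i) 0 i - eta x * V x 0 i).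
    by rewrite /q -mulrBr mulrCA.
  split.
  - by have := admZ (- (h k)^-1) (admB a1 a2); congr adm; apply/funext.
  - by have := admZ (h k)^-1 (admB a3 a2); congr adm; apply/funext.
  rewrite (eq_Int e2) (eq_Int e3) !IntZ ?IntB ?e1 ?mulNr//; exact: admB.
have cvg1 : Int (fun x => \sum_i d k i x * V x 0 i) @[k --> \oo] --> Int (fun x => \sum_i deta x 0 i * V x 0 i).
  have /choice[D hD] : forall i, exists D : R, 0 <= D /\ forall k x, `|x| <= C + 1 -> `|d k i x * V x 0 i| <= D.
    move=> i; have [D1 D10 hD1] := test_lip i T; have [D2 D20 hD2] := V0 i.
    exists (D1 * D2); split; first exact: mulr_ge0.
    move=> k x hx; rewrite normrM ler_pM//; last exact: hD2.
    rewrite /d normrM normfV normrN (ger0_norm (ltW (h0 k))) mulrC ler_pdivrMr//.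
    by apply: le_trans (hD1 _ _) _; rewrite normrN (ger0_norm (ltW (h0 k))).
  apply: (@Int_cvg _ _ _ _ (\sum_i D i + `|C + 1|)).
  - by move=> k; apply: meas_sum => i; apply: measM; [exact: md|exact: meas_continuous].
  - by apply: meas_sum => i; apply: measM; exact: meas_continuous.
  - move=> k x.
    have hz : C + 1 < `|x| -> \sum_i d k i x * V x 0 i = 0.
      move=> hx; apply: big1 => i _; have [_ h2] := xh k x i hx.
      rewrite /d (se _ h2) se ?subrr ?mulr0 ?mul0r//.
      by apply: le_lt_trans hx; rewrite lerDl.
    have sD : 0 <= \sum_i D i by apply: sumr_ge0 => i _; have [] := hD i.
    split; last first.
      move=> hx; apply: hz; apply: le_lt_trans hx; apply: le_trans (ler_norm _) _.
      by rewrite lerDr.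
    have [hx|/hz ->] := leP `|x| (C + 1); last by rewrite normr0 addr_ge0.
    apply: le_trans (ler_norm_sum _ _ _) _.
    rewrite -[X in X <= _]addr0 lerD//; apply: ler_sum => i _.
    by have [_] := hD i; apply.
  - move=> x; apply: seq_cvg_sum => i; apply: cvgM; last exact: cvg_cst.
    apply: is_derive_seq => //; last by move=> k; rewrite oppr_eq0.
    by rewrite -oppr0; apply: cvgN; exact: harmonic_seq.
have cvg2 : Int (fun x => eta x * \sum_i q k i x) @[k --> \oo] --> Int (fun x => eta x * f x).
  have [D D0 hD] := continuous_bounded C ce.
  have hD' x : `|eta x| <= D by have [/hD//|/se ->] := leP `|x| C; rewrite normr0.
  apply: (@Int_cvg_ae _ _ _ _ (D * (`|K| *+ n) + `|C|) N) => //.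
  - by move=> k; apply: measM; [exact: meas_continuous|apply: meas_sum => i; exact: mq].
  - by apply: measM => //; exact: meas_continuous.
  - move=> k x; split; last first.
      move=> hx; rewrite se ?mul0r//; apply: le_lt_trans hx; apply: le_trans (ler_norm _) _.
      by rewrite lerDr mulr_ge0// mulrn_wge0.
    apply: (@le_trans _ _ (D * (`|K| *+ n))); last by rewrite lerDl.
    rewrite normrM ler_pM//; apply: le_trans (ler_norm_sum _ _ _) _.
    apply: le_trans (ler_sum _ (fun i _ => qK k i x)) _.
    by rewrite sumr_const card_ord.
  - move=> x nNx; have [hx|hx] := ltP `|x| rho; last first.
      rewrite (_ : (fun k => _) = fun=> eta x * f x); first exact: cvg_cst.
      by apply/funext => k; rewrite se ?mul0r//; exact: lt_le_trans hx.
    have [l dl <-] := hd x hx nNx.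
    apply: cvgM; first exact: cvg_cst.
    apply: seq_cvg_sum => i; apply: (@is_derive_seq (fun y => V y 0 i)) => //.
    exact: harmonic_seq.
have cvg3 : Int (fun x => \sum_i d k i x * V x 0 i) @[k --> \oo] --> - Int (fun x => eta x * f x).
  rewrite (_ : (fun k => Int _) = fun k => - Int (fun x => eta x * \sum_i q k i x)); first exact: cvgN.
  apply/funext => k.
  rewrite Int_sum; last by move=> i; have [] := parts k i.
  rewrite (eq_bigr (fun i => - Int (fun x => eta x * q k i x))); last by move=> i _; have [] := parts k i.
  rewrite sumrN; congr (- _).
  rewrite -Int_sum; last by move=> i; have [] := parts k i.
  by apply: eq_Int => x; rewrite mulr_sumr.
exact: cvg_unique cvg1 cvg3.
Qed.
End Calculus.

(** * The weight p *)

Section Weight.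
Variables (R : realType) (n : nat).
Local Notation E := 'rV[R]_n.
Implicit Types (f g h : E -> R) (x y v : E).
Local Notation e_ i := (delta_mx 0 i : E).

Definition dot x y : R := \sum_i x 0 i * y 0 i.

Lemma dotC x y : dot x y = dot y x.
Proof. by apply: eq_bigr => i _; rewrite mulrC. Qed.
Lemma dotDl x y v : dot (x + y) v = dot x v + dot y v.
Proof. by rewrite -big_split; apply: eq_bigr => i _; rewrite mxE mulrDl. Qed.
Lemma dotDr x y v : dot v (x + y) = dot v x + dot v y.
Proof. by rewrite !(dotC v) dotDl. Qed.
Lemma dotZl (c : R) x y : dot (c *: x) y = c * dot x y.
Proof. by rewrite mulr_sumr; apply: eq_bigr => i _; rewrite mxE mulrA. Qed.
Lemma dotZr (c : R) x y : dot y (c *: x) = c * dot y x.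
Proof. by rewrite !(dotC y) dotZl. Qed.
Lemma dotNl x y : dot (- x) y = - dot x y.
Proof. by rewrite -scaleN1r dotZl mulN1r. Qed.
Lemma dotBl x y v : dot (x - y) v = dot x v - dot y v.
Proof. by rewrite dotDl dotNl. Qed.
Lemma dotBr x y v : dot v (x - y) = dot v x - dot v y.
Proof. by rewrite !(dotC v) dotBl. Qed.
Lemma dot0l y : dot 0 y = 0.
Proof. by rewrite /dot big1// => i _; rewrite mxE mul0r. Qed.
Lemma dot_delta x i : dot x (e_ i) = x 0 i.
Proof.
rewrite /dot (bigD1 i)//= mxE !eqxx mulr1 big1 ?addr0// => j ji.
by rewrite mxE eqxx (negbTE ji) mulr0.
Qed.
Lemma dot_ge0 x : 0 <= dot x x.
Proof. by apply: sumr_ge0 => i _; exact: sqr_ge0. Qed.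
Lemma coord_sq_le x i : x 0 i ^+ 2 <= dot x x.
Proof. by rewrite /dot (bigD1 i)//= expr2 lerDl; apply: sumr_ge0 => j _; exact: sqr_ge0. Qed.
Lemma dot_le x y (a b : R) : (forall i, `|x 0 i| <= a) -> (forall i, `|y 0 i| <= b) -> `|dot x y| <= a * b *+ n.
Proof.
move=> xa yb; apply: le_trans (ler_norm_sum _ _ _) _.
rewrite -[X in _ *+ X]card_ord -sumr_const; apply: ler_sum => i _.
by rewrite normrM ler_pM.
Qed.
Lemma norm_lt1_of_dot x : dot x x < 1 -> `|x| <= 1.
Proof.
move=> h; apply: norm_le_coord => // i.
have := le_lt_trans (coord_sq_le x i) h; rewrite -real_normK ?num_real// => h1.
by rewrite leNgt; apply/negP => h2; move: h1; rewrite ltNge -{1}(expr1n _ 2) ler_pXn2r ?nnegrE// ltW.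
Qed.

Lemma cont_dot (F G : E -> E) : (forall i, continuous (fun x => F x 0 i)) ->
  (forall i, continuous (fun x => G x 0 i)) -> continuous (fun x => dot (F x) (G x)).
Proof. by move=> cF cG; apply: cont_sum => i; apply: contM. Qed.

Lemma cont_sq : continuous (fun x : E => dot x x).
Proof. by apply: cont_dot => i; exact: cont_coord. Qed.

(** Gradients of powers of this weight are multiples of x: the gradient of p^(k+1)
    is - 2 (k+1) p^k x. Integrals of x . V thus come from integration by parts. *)
Definition bump x : R := Num.max 0 (1 - dot x x).
Local Notation p := bump.

Lemma bump_ge0 x : 0 <= p x. Proof. by rewrite /bump le_max lexx. Qed.
Lemma bump_le1 x : p x <= 1.
Proof. by rewrite /bump ge_max ler01 gerBl dot_ge0. Qed.
Lemma bump_in x : dot x x < 1 -> p x = 1 - dot x x.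
Proof. by move=> h; rewrite /bump max_r// subr_ge0 ltW. Qed.
Lemma bump_out x : 1 <= dot x x -> p x = 0.
Proof. by move=> h; rewrite /bump max_l// subr_le0. Qed.
Lemma bump_out_norm x : 1 < `|x| -> p x = 0.
Proof.
move=> h; apply: bump_out; rewrite leNgt; apply/negP => /norm_lt1_of_dot.
by rewrite leNgt h.
Qed.
Lemma cont_bump : continuous p.
Proof.
rewrite (_ : p = fun x => 2^-1 * ((1 - dot x x) + `|1 - dot x x|)).
  apply: contM; first exact: cont_cst.
  have c1 : continuous (fun x : E => 1 - dot x x) by apply: contB; [exact: cont_cst|exact: cont_sq].
  apply: contD => // x.
  by apply: (@continuous_comp _ _ _ (fun x : E => 1 - dot x x) (fun y : R => `|y|)); [exact: c1|exact: norm_continuous].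
apply/funext => x; rewrite /bump; have [h|h] := leP 0 (1 - dot x x).
  by rewrite ger0_norm//; lra.
by rewrite ltr0_norm//; lra.
Qed.

(** Derivatives along v only see the line through x, which gives access to the
    one-variable calculus. *)
Lemma is_derive_of_line f x v (d : R) :
  is_derive (0 : R) 1 (fun s : R => f (x + s *: v)) d -> is_derive x v f d.
Proof.
move=> [df vf].
have H : (fun h : R => h^-1 *: ((f \o shift x) (h *: v) - f x)) =
  (fun h : R => h^-1 *: (((fun s => f (x + s *: v)) \o shift 0) (h *: 1) - f (x + 0 *: v))).
  apply/funext => h /=; congr (_ *: (f _ - f _)); last by rewrite scale0r addr0.
  by rewrite [h *: 1]mulr1 addr0 addrC.
split; first by rewrite /derivable H; exact: df.
by rewrite -vf /derive H.
Qed.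

Lemma is_derive_quadratic_error f x v (d C : R) :
  (forall h : R, `|h| <= 1 -> `|f (x + h *: v) - f x - d * h| <= C * h ^+ 2) ->
  is_derive x v f d.
Proof.
move=> H.
have C0 : 0 <= C by have := H 1; rewrite normr1 expr1n !mulr1 => /(_ (lexx _)) /(le_trans (normr_ge0 _)).
have cv : h^-1 *: ((f \o shift x) (h *: v) - f x) @[h --> 0^'] --> d.
  apply/cvgrPdist_le => e e0; near=> h.
  have h0 : h != 0 by near: h; exact: nbhs_dnbhs_neq.
  have h1 : `|h| <= 1 by near: h; apply: dnbhs0_le.
  have h2 : `|h| <= e / (C + 1) by near: h; apply: dnbhs0_le; rewrite divr_gt0// ltr_pwDr.
  have -> : d - h^-1 *: ((f \o shift x) (h *: v) - f x) = - (h^-1 * (f (x + h *: v) - f x - d * h)).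
    by rewrite /= [h *: v + x]addrC [_ *: _]mulrBr -[d in LHS](mulKf h0) /GRing.scale/=; field.
  rewrite normrN normrM normfV mulrC ler_pdivrMr ?normr_gt0//.
  apply: le_trans (H _ h1) _; rewrite -real_normK ?num_real// expr2 mulrA ler_wpM2r//.
  apply: (@le_trans _ _ ((C + 1) * `|h|)); first by rewrite ler_wpM2r// lerDl.
  by rewrite mulrC -ler_pdivlMr// ltr_pwDr.
split; last exact: cvg_lim.
by apply/cvg_ex; exists d.
Unshelve. all: by end_near.
Qed.

Lemma is_derive_sq x v : is_derive x v (fun y => dot y y) (2 * dot x v).
Proof.
apply: (@is_derive_quadratic_error _ _ _ _ (dot v v)) => h _.
have -> : dot (x + h *: v) (x + h *: v) - dot x x - 2 * dot x v * h = dot v v * h ^+ 2.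
  by rewrite !(dotDl, dotDr, dotZl, dotZr) (dotC v x); ring.
by rewrite ger0_norm// mulr_ge0 ?dot_ge0 ?sqr_ge0.
Qed.

(** The square of the positive part is differentiable, with derivative twice the
    positive part, even where the positive part is not. *)
Lemma max2_expansion (a b : R) :
  `|Num.max 0 a ^+ 2 - Num.max 0 b ^+ 2 - 2 * Num.max 0 b * (a - b)| <= (a - b) ^+ 2.
Proof.
have aa := sqr_ge0 a; have bb := sqr_ge0 b.
rewrite ler_norml; have [ha|ha] := leP 0 a; have [hb|hb] := leP 0 b; apply/andP.
- have := sqr_ge0 (a - b); split; nra.
- have : 0 <= a * - b by rewrite mulr_ge0// oppr_ge0 ltW.
  split; nra.
- have : 0 <= - a * b by rewrite mulr_ge0// oppr_ge0 ltW.
  split; nra.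
- have := sqr_ge0 (a - b); split; nra.
Qed.

Lemma dot_step x v (h : R) : `|h| <= 1 ->
  ((1 - dot (x + h *: v) (x + h *: v)) - (1 - dot x x)) ^+ 2 <= (2 * `|dot x v| + dot v v) ^+ 2 * h ^+ 2.
Proof.
move=> h1.
have -> : (1 - dot (x + h *: v) (x + h *: v)) - (1 - dot x x) = - h * (2 * dot x v + h * dot v v).
  by rewrite !(dotDl, dotDr, dotZl, dotZr) (dotC v x); ring.
rewrite exprMn sqrrN mulrC ler_wpM2r ?sqr_ge0//.
rewrite -real_normK ?num_real// lerXn2r ?nnegrE ?addr_ge0 ?mulr_ge0 ?dot_ge0//.
apply: le_trans (ler_normD _ _) _; rewrite normrM ger0_norm// lerD2l normrM (ger0_norm (dot_ge0 _)).
by rewrite ler_piMl// dot_ge0.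
Qed.

Lemma bump2_expansion x v : exists C : R, forall h : R, `|h| <= 1 ->
  `|p (x + h *: v) ^+ 2 - p x ^+ 2 - - 4 * p x * dot x v * h| <= C * h ^+ 2.
Proof.
exists ((2 * `|dot x v| + dot v v) ^+ 2 + 2 * dot v v) => h h1.
have := max2_expansion (1 - dot (x + h *: v) (x + h *: v)) (1 - dot x x).
rewrite -/(p (x + h *: v)) -/(p x); set a := 1 - dot (x + h *: v) (x + h *: v).
have aE : a - (1 - dot x x) = - h * (2 * dot x v + h * dot v v).
  by rewrite /a !(dotDl, dotDr, dotZl, dotZr) (dotC v x); ring.
move=> H.
have -> : p (x + h *: v) ^+ 2 - p x ^+ 2 - - 4 * p x * dot x v * h =
  (p (x + h *: v) ^+ 2 - p x ^+ 2 - 2 * p x * (a - (1 - dot x x))) + - (2 * p x * h ^+ 2 * dot v v).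
  by rewrite aE; ring.
apply: le_trans (ler_normD _ _) _; rewrite [X in _ <= X]mulrDl; apply: lerD.
  by apply: le_trans H _; exact: dot_step.
have e0 : 0 <= dot v v * h ^+ 2 by apply: mulr_ge0; [exact: dot_ge0|exact: sqr_ge0].
rewrite normrN (_ : 2 * p x * h ^+ 2 * dot v v = p x * (2 * (dot v v * h ^+ 2))); last by ring.
rewrite -mulrA ger0_norm; last by rewrite mulr_ge0 ?bump_ge0// mulr_ge0.
by rewrite ler_piMl ?bump_le1// mulr_ge0.
Qed.

Lemma is_derive_bump2 x v : is_derive x v (fun y => p y ^+ 2) (- 4 * p x * dot x v).
Proof. by have [C] := bump2_expansion x v; exact: is_derive_quadratic_error. Qed.

Lemma is_derive_bump2_out x v g : p x = 0 -> continuous g -> is_derive x v (fun y => p y ^+ 2 * g y) 0.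
Proof.
move=> px cg; have [C HC] := bump2_expansion x v.
have [D D0 hD] := continuous_bounded (`|x| + `|v|) cg.
apply: (@is_derive_quadratic_error _ _ _ _ (C * D)) => h h1.
have := HC h h1; rewrite px expr0n/= !mulr0 !mul0r !subr0 => H.
rewrite [X in _ <= X]mulrAC normrM; apply: ler_pM => //; apply: (hD (x + h *: v)).
apply: le_trans (ler_normD _ _) _; rewrite lerD2l normrZ ler_piMl//.
Qed.

(** As p^2 vanishes to second order on the unit sphere, p^2 g is continuously
    differentiable although g is assumed differentiable only inside. *)
Lemma test_bump2 g (G : E -> E) : continuous g -> (forall i, continuous (fun x => G x 0 i)) ->
  (forall x i, dot x x < 1 -> is_derive x (e_ i) g (G x 0 i)) ->
  test 1 (fun x => p x ^+ 2 * g x) (fun x => (p x ^+ 2) *: G x - (4 * p x * g x) *: x).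
Proof.
move=> cg cG dg.
have cp2 : continuous (fun x => p x ^+ 2) by apply: contM; exact: cont_bump.
split.
- exact: contM.
- move=> i; under eq_fun do rewrite !mxE.
  apply: contB; first exact: contM.
  apply: contM; last exact: cont_coord.
  by apply: contM => //; apply: contM; [exact: cont_cst|exact: cont_bump].
- move=> x i; rewrite !mxE; have [h|h] := ltP (dot x x) 1; last first.
    by rewrite bump_out// expr0n/= mul0r mulr0 !mul0r subr0; apply: is_derive_bump2_out => //; exact: bump_out.
  have := dg x i h => h1; have h2 := is_derive_bump2 x (e_ i).
  have h3 := is_deriveM h2 h1.
  apply: (@is_derive_eq _ _ _ _ _ _ _ _ h3).
  by rewrite dot_delta /GRing.scale/=; ring.
- by move=> x h; rewrite bump_out_norm// expr0n/= mul0r.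
- by move=> x h; rewrite bump_out_norm// expr0n/= scale0r mulr0 mul0r scale0r subr0.
Qed.
End Weight.

(** * Weighted identities for weak solutions *)

Section Weighted.
Variables (R : realType) (n : nat).
Local Notation E := 'rV[R]_n.
Implicit Types (f g h u : E -> R) (x y v : E) (V : E -> E).
Local Notation e_ i := (delta_mx 0 i : E).
Local Notation p := (@bump R n).

(** A sufficient condition for p g to be integrable, stable under products. *)
Definition loc g := meas g /\ exists C, forall x, `|x| <= 1 -> `|g x| <= C.

Lemma loc_cont g : continuous g -> loc g.
Proof.
move=> cg; split; first exact: meas_continuous.
by have [D _ hD] := continuous_bounded 1 cg; exists D.
Qed.
Lemma loc_cst c : loc (fun=> c).
Proof. by apply: loc_cont; exact: cont_cst. Qed.
Lemma locM f g : loc f -> loc g -> loc (fun x => f x * g x).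
Proof.
move=> [mf [C hC]] [mg [D hD]]; split; first exact: measM.
by exists (C * D) => x hx; rewrite normrM ler_pM// ?hC ?hD.
Qed.
Lemma locD f g : loc f -> loc g -> loc (fun x => f x + g x).
Proof.
move=> [mf [C hC]] [mg [D hD]]; split; first exact: measD.
by exists (C + D) => x hx; apply: le_trans (ler_normD _ _) _; rewrite lerD ?hC ?hD.
Qed.
Lemma locN f : loc f -> loc (fun x => - f x).
Proof.
move=> lf; have := locM (loc_cst (-1)) lf.
by under eq_fun do rewrite mulN1r.
Qed.
Lemma locB f g : loc f -> loc g -> loc (fun x => f x - g x).
Proof. by move=> lf lg; apply: locD => //; exact: locN. Qed.
Lemma locX f k : loc f -> loc (fun x => f x ^+ k).
Proof.
move=> lf; elim: k => [|k IH]; first exact: loc_cst.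
by under eq_fun do rewrite exprS; exact: locM.
Qed.
Lemma loc_sum (T : finType) (F : T -> E -> R) : (forall j, loc (F j)) -> loc (fun x => \sum_j F j x).
Proof.
move=> lF; rewrite /index_enum; elim: (Finite.enum T) => [|j s IH].
  by under eq_fun do rewrite big_nil; exact: loc_cst.
by under eq_fun do rewrite big_cons; exact: locD.
Qed.
Lemma loc_dot (F G : E -> E) : (forall i, loc (fun x => F x 0 i)) ->
  (forall i, loc (fun x => G x 0 i)) -> loc (fun x => dot (F x) (G x)).
Proof. by move=> lF lG; apply: loc_sum => i; apply: locM. Qed.
Lemma loc_coord i : loc (fun x => x 0 i).
Proof. by apply: loc_cont; exact: cont_coord. Qed.
Lemma loc_bump : loc p.
Proof. by apply: loc_cont; exact: cont_bump. Qed.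

Lemma adm_bump g : loc g -> adm (fun x => p x * g x).
Proof.
move=> [mg [C hC]]; split; first by apply: measM => //; apply: meas_continuous; exact: cont_bump.
have C0 : 0 <= C by apply: le_trans (hC 0 _); rewrite ?normr0.
exists (1 + C) => x; split.
  have [hx|hx] := leP `|x| 1; last by rewrite bump_out_norm// mul0r normr0 addr_ge0.
  rewrite normrM (ger0_norm (bump_ge0 _)) (@le_trans _ _ (1 * C))//.
    by rewrite ler_pM ?bump_ge0 ?bump_le1 ?hC.
  by rewrite mul1r lerDr.
move=> hx; rewrite bump_out_norm ?mul0r//; apply: le_lt_trans hx; by rewrite lerDl.
Qed.

Definition wInt g : R := Int (fun x => p x * g x).

Lemma eq_wInt f g : (forall x, dot x x < 1 -> f x = g x) -> wInt f = wInt g.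
Proof.
move=> fg; apply: eq_Int => x; have [h|h] := ltP (dot x x) 1; first by rewrite fg.
by rewrite bump_out// !mul0r.
Qed.

Lemma wIntD f g : loc f -> loc g -> wInt (fun x => f x + g x) = wInt f + wInt g.
Proof.
move=> lf lg; rewrite /wInt -IntD; [|exact: adm_bump|exact: adm_bump].
by apply: eq_Int => x; rewrite mulrDr.
Qed.
Lemma wIntB f g : loc f -> loc g -> wInt (fun x => f x - g x) = wInt f - wInt g.
Proof.
move=> lf lg; rewrite /wInt -IntB; [|exact: adm_bump|exact: adm_bump].
by apply: eq_Int => x; rewrite mulrBr.
Qed.
Lemma wIntZ (c : R) f : loc f -> wInt (fun x => c * f x) = c * wInt f.
Proof.
move=> lf; rewrite /wInt -IntZ; last exact: adm_bump.
by apply: eq_Int => x; rewrite mulrCA.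
Qed.
Lemma wInt_le f g : loc f -> loc g -> (forall x, dot x x < 1 -> f x <= g x) -> wInt f <= wInt g.
Proof.
move=> lf lg fg; apply: Int_le; [exact: adm_bump|exact: adm_bump|move=> x].
have [h|h] := ltP (dot x x) 1; first by rewrite ler_wpM2l ?bump_ge0 ?fg.
by rewrite bump_out// !mul0r.
Qed.
Lemma wInt_ge0 f : (forall x, dot x x < 1 -> 0 <= f x) -> 0 <= wInt f.
Proof.
move=> f0; apply: Int_ge0 => x; have [h|h] := ltP (dot x x) 1.
  by rewrite mulr_ge0 ?bump_ge0 ?f0.
by rewrite bump_out// mul0r.
Qed.
Lemma wInt1_ge0 : 0 <= wInt (fun=> 1). Proof. exact: wInt_ge0. Qed.
Lemma wInt_bound f (C : R) : loc f -> (forall x, dot x x < 1 -> `|f x| <= C) -> `|wInt f| <= C * wInt (fun=> 1).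
Proof.
move=> lf fC.
have E1 : C * wInt (fun=> 1) = wInt (fun=> C) by rewrite -wIntZ; [apply: eq_wInt => x _; rewrite mulr1|exact: loc_cst].
have E2 : - C * wInt (fun=> 1) = wInt (fun=> - C) by rewrite -wIntZ; [apply: eq_wInt => x _; rewrite mulr1|exact: loc_cst].
rewrite ler_norml -mulNr E2 E1; apply/andP; split; apply: wInt_le => //; try exact: loc_cst.
all: by move=> x /fC; rewrite ler_norml => /andP[].
Qed.

(** Weak solutions of Delta u = f in the unit ball with gradient V. The field [ls_fV]
    says that V vanishes where f does not equal 1; it holds for f = 1_(V <> 0) and for
    f = 1, the two cases that occur. *)
Record weak_solution u V f : Prop := {
  ls_u : continuous u ;
  ls_V : forall i, continuous (fun x => V x 0 i) ;
  ls_f : meas f ;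
  ls_f0 : forall x, 0 <= f x <= 1 ;
  ls_fV : forall x, f x *: V x = V x ;
  ls_grad : forall x i, dot x x < 1 -> is_derive x (e_ i) u (V x 0 i) ;
  ls_weak : forall eta deta, test 1 eta deta ->
    Int (fun x => \sum_i deta x 0 i * V x 0 i) = - Int (fun x => eta x * f x) }.

Lemma loc_f u V f : weak_solution u V f -> loc f.
Proof.
move=> S; split; first exact: ls_f S.
by exists 1 => x _; have /andP[h1 h2] := ls_f0 S x; rewrite ger0_norm.
Qed.
Lemma loc_u u V f : weak_solution u V f -> loc u.
Proof. by move=> S; apply: loc_cont; exact: ls_u S. Qed.
Lemma loc_V u V f : weak_solution u V f -> forall i, loc (fun x => V x 0 i).
Proof. by move=> S i; apply: loc_cont; exact: ls_V S i. Qed.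

Definition radial V x := dot x (V x).

Lemma loc_radial u V f : weak_solution u V f -> loc (radial V).
Proof. by move=> S; apply: loc_dot => i; [exact: loc_coord|exact: loc_V S i]. Qed.

(** The weak equation tested with p^2 g: the gradient of p^2 is - 4 p x. *)
Lemma green u V f g (G : E -> E) : weak_solution u V f -> continuous g ->
  (forall i, continuous (fun x => G x 0 i)) ->
  (forall x i, dot x x < 1 -> is_derive x (e_ i) g (G x 0 i)) ->
  wInt (fun x => p x * dot (G x) (V x)) = 4 * wInt (fun x => g x * radial V x) - wInt (fun x => p x * (g x * f x)).
Proof.
move=> S cg cG dg; have := ls_weak S (test_bump2 cg cG dg).
have lG : loc (fun x => dot (G x) (V x)).
  by apply: loc_dot => i; [exact: loc_cont|exact: loc_V S i].
have lr : loc (fun x => g x * radial V x) by apply: locM; [exact: loc_cont|exact: loc_radial S].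
have l1 : loc (fun x => p x * dot (G x) (V x)) by apply: locM => //; exact: loc_bump.
have l2 : loc (fun x => 4 * (g x * radial V x)) by apply: locM => //; exact: loc_cst.
have -> : Int (fun x => \sum_i (p x ^+ 2 *: G x - (4 * p x * g x) *: x) 0 i * V x 0 i) =
   wInt (fun x => p x * dot (G x) (V x) - 4 * (g x * radial V x)).
  apply: eq_Int => x; rewrite -/(dot _ _) dotBl !dotZl /radial; ring.
rewrite wIntB// wIntZ// => h; rewrite -[LHS](subrK (4 * wInt (fun x => g x * radial V x))) h addrC.
by congr (_ - _); apply: eq_Int => x; ring.
Qed.

Definition pair V1 V2 : R := wInt (fun x => p x * dot (V1 x) (V2 x)).
(** Since f is 1 off the contact set, this is the mass of the contact set for the
    weight p^3/6. *)
Definition contact f : R := wInt (fun x => p x ^+ 2 / 6 * (1 - f x)).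
Definition full_moment : R := wInt (fun x => p x ^+ 2 / 6).

Lemma pairC V1 V2 : pair V1 V2 = pair V2 V1.
Proof. by apply: eq_wInt => x _; rewrite dotC. Qed.

Lemma contact_ge0 u V f : weak_solution u V f -> 0 <= contact f.
Proof.
move=> S; apply: wInt_ge0 => x _; rewrite mulr_ge0 ?divr_ge0 ?sqr_ge0// subr_ge0.
by have /andP[] := ls_f0 S x.
Qed.

(** Green's formula for g = (1 - |x|^2)/6, whose product with p^2 is p^3/6. *)
Lemma radial_moment u V f : weak_solution u V f -> wInt (fun x => p x * radial V x) = full_moment - contact f.
Proof.
move=> S.
have lp2 : loc (fun x => p x ^+ 2 / 6) by apply: locM; [apply: locX; exact: loc_bump|exact: loc_cst].
have lpf : loc (fun x => p x ^+ 2 / 6 * f x) by apply: locM => //; exact: loc_f S.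
have lr := loc_radial S.
have lpr : loc (fun x => p x * radial V x) by apply: locM => //; exact: loc_bump.
have -> : full_moment - contact f = wInt (fun x => p x ^+ 2 / 6 * f x).
  rewrite -wIntB//; last by apply: locM => //; apply: locB; [exact: loc_cst|exact: loc_f S].
  by apply: eq_wInt => x _; ring.
have c1 : continuous (fun x : E => 6^-1 * (1 - dot x x)).
  apply: contM; first exact: cont_cst.
  by apply: contB; [exact: cont_cst|exact: cont_sq].
have c2 i : continuous (fun x : E => ((- 3^-1) *: x) 0 i).
  by under eq_fun do rewrite mxE; apply: contM; [exact: cont_cst|exact: cont_coord].
have := green S c1 c2.
have c3 x i : dot x x < 1 -> is_derive x (e_ i) (fun x : E => 6^-1 * (1 - dot x x)) ((- 3^-1 *: x) 0 i).
  move=> _; rewrite mxE.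
  have := is_derive_sq x (e_ i); rewrite dot_delta => h.
  by apply: is_derive_eq; rewrite /GRing.scale/=; field.
move=> /(_ c3).
have -> : wInt (fun x => p x * dot (- 3^-1 *: x) (V x)) = - 3^-1 * wInt (fun x => p x * radial V x).
  by rewrite -wIntZ//; apply: eq_wInt => x _; rewrite dotZl /radial; ring.
have -> : wInt (fun x => 6^-1 * (1 - dot x x) * radial V x) = 6^-1 * wInt (fun x => p x * radial V x).
  by rewrite -wIntZ//; apply: eq_wInt => x h; rewrite bump_in//; ring.
have -> : wInt (fun x => p x * (6^-1 * (1 - dot x x) * f x)) = wInt (fun x => p x ^+ 2 / 6 * f x).
  by apply: eq_wInt => x h; rewrite bump_in//; ring.
by lra.
Qed.

(** By Green's formula this is - int p^2 grad g . V. Unlike that integral it makes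
    sense for any bounded g, in particular for the time derivative of a family of
    solutions, which is merely Lipschitz. *)
Definition vari g V f : R := wInt (fun x => p x * (g x * f x)) - 4 * wInt (fun x => g x * radial V x).

Lemma loc_vari1 g u V f : weak_solution u V f -> loc g -> loc (fun x => p x * (g x * f x)).
Proof. by move=> S lg; apply: locM; [exact: loc_bump|apply: locM => //; exact: loc_f S]. Qed.
Lemma loc_vari2 g u V f : weak_solution u V f -> loc g -> loc (fun x => g x * radial V x).
Proof. by move=> S lg; apply: locM => //; exact: loc_radial S. Qed.

Lemma variD g h u V f : weak_solution u V f -> loc g -> loc h -> vari (fun x => g x + h x) V f = vari g V f + vari h V f.
Proof.
move=> S lg lh; have g1 := loc_vari1 S lg; have g2 := loc_vari2 S lg.
have h1 := loc_vari1 S lh; have h2 := loc_vari2 S lh.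
rewrite /vari.
rewrite (@eq_wInt _ (fun x => p x * (g x * f x) + p x * (h x * f x))); last by move=> x _; ring.
rewrite (@eq_wInt (fun x => (g x + h x) * radial V x) (fun x => g x * radial V x + h x * radial V x)); last by move=> x _; ring.
by rewrite !wIntD//; ring.
Qed.
Lemma variZ (c : R) h u V f : weak_solution u V f -> loc h -> vari (fun x => c * h x) V f = c * vari h V f.
Proof.
move=> S lh; have h1 := loc_vari1 S lh; have h2 := loc_vari2 S lh.
rewrite /vari.
rewrite (@eq_wInt _ (fun x => c * (p x * (h x * f x)))); last by move=> x _; ring.
rewrite (@eq_wInt (fun x => c * h x * radial V x) (fun x => c * (h x * radial V x))); last by move=> x _; ring.
by rewrite !wIntZ//; ring.
Qed.

Lemma pair_vari u1 V1 f1 u2 V2 f2 : weak_solution u1 V1 f1 -> weak_solution u2 V2 f2 -> pair V1 V2 = - vari u1 V2 f2.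
Proof.
move=> S1 S2; rewrite /vari opprB; apply: (green S2).
- exact: ls_u S1.
- exact: ls_V S1.
- by move=> x i; exact: (ls_grad S1).
Qed.

Lemma vari_bound (M C : R) g u V f : weak_solution u V f -> loc g -> 0 <= M -> 0 <= C ->
  (forall x, dot x x < 1 -> forall i, `|V x 0 i| <= C) ->
  (forall x, dot x x < 1 -> `|g x| <= M) -> `|vari g V f| <= (1 + 4 * (C *+ n)) * wInt (fun=> 1) * M.
Proof.
move=> S lg M0 C0 VC gM; apply: le_trans (ler_normB _ _) _.
have -> : (1 + 4 * (C *+ n)) * wInt (fun=> 1) * M = M * wInt (fun=> 1) + 4 * (M * (C *+ n) * wInt (fun=> 1)) by ring.
apply: lerD.
  apply: wInt_bound => [|x hx]; first exact: loc_vari1 S lg.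
  have /andP[f0 f1] := ls_f0 S x; rewrite !normrM (ger0_norm (bump_ge0 _)) (ger0_norm f0).
  apply: le_trans (gM x hx).
  rewrite -[X in _ <= X]mul1r; apply: ler_pM; rewrite ?bump_ge0 ?bump_le1 ?mulr_ge0//.
  by rewrite ler_piMr.
rewrite normrM ger0_norm// ler_wpM2l//.
apply: wInt_bound => [|x hx]; first exact: loc_vari2 S lg.
rewrite normrM; apply: ler_pM => //; first exact: gM.
have := @dot_le _ _ x (V x) 1 C; rewrite mul1r; apply; last exact: VC.
by move=> i; apply: le_trans (coord_le_norm _ _) _; exact: norm_lt1_of_dot.
Qed.

(** The derivative at r = 1 of u(r x)/r^2. *)
Definition generator u V x : R := radial V x - 2 * u x.

Lemma loc_generator u V f : weak_solution u V f -> loc (generator u V).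
Proof.
move=> S; apply: locB; first exact: loc_radial S.
by apply: locM; [exact: loc_cst|exact: loc_u S].
Qed.

(** The term - 2 u1 of the generator is converted back into a pairing; only radial
    derivatives remain, symmetrically except for the factor f2. *)
Lemma vari_generator u1 V1 f1 u2 V2 f2 : weak_solution u1 V1 f1 -> weak_solution u2 V2 f2 ->
  vari (generator u1 V1) V2 f2 =
  wInt (fun x => p x * (radial V1 x * f2 x)) - 4 * wInt (fun x => radial V1 x * radial V2 x) + 2 * pair V1 V2.
Proof.
move=> S1 S2.
have lr := loc_radial S1; have lu := loc_u S1.
have l2 : loc (fun x => - 2 * u1 x) by apply: locM => //; exact: loc_cst.
have -> : generator u1 V1 = fun x => radial V1 x + - 2 * u1 x by apply/funext => x; rewrite /generator mulNr.
rewrite (variD S2)// (variZ _ S2)// (pair_vari S1 S2) /vari; ring.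
Qed.
End Weighted.

(** * Functions of a real variable *)

Section RealLemmas.
Variable R : realType.
Implicit Types (F g N : R -> R).

Lemma near_lip_continuous g (K : R) : (forall s t, `|s - t| <= 1 -> `|g s - g t| <= K * `|s - t|) ->
  continuous g.
Proof.
move=> gK x; apply/cvgrPdist_le => e e0; near=> y.
have h1 : `|x - y| <= 1 by near: y; apply: cvgr_dist_le => //; exact: cvg_id.
have K0 : 0 < `|K| + 1 by rewrite ltr_pwDr.
have h2 : `|x - y| <= e / (`|K| + 1).
  by near: y; apply: cvgr_dist_le; [exact: cvg_id|rewrite divr_gt0].
apply: le_trans (gK _ _ h1) _; apply: (@le_trans _ _ ((`|K| + 1) * `|x - y|)).
  by rewrite ler_wpM2r// (le_trans (ler_norm K))// lerDl.
by rewrite mulrC -ler_pdivlMr.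
Unshelve. all: by end_near.
Qed.

(** A primitive of g, with the derivative expressed by a quadratic error. The half-line
    extends to -oo, hence the reflection x to c + 1 - x, which places the base point
    of the integral to the right of c. *)
Lemma lip_primitive g (K c : R) : (forall s t, `|s - t| <= 1 -> `|g s - g t| <= K * `|s - t|) ->
  exists G : R -> R, forall s t, s <= c -> t <= c -> `|t - s| <= 1 ->
    `|G t - G s - (t - s) * g s| <= K * (t - s) ^+ 2.
Proof.
move=> gK; pose h x := g (c + 1 - x).
have ch : continuous h.
  apply: (@near_lip_continuous _ K) => s t st.
  have -> : `|s - t| = `|(c + 1 - s) - (c + 1 - t)| by rewrite distrC; congr (`| _ |); ring.
  by apply: gK; rewrite (_ : _ - _ = - (s - t)) ?normrN//; ring.
pose F x := (\int[lebesgue_measure]_(t in `[0%R, x]) h t)%R.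
have dF (x : R) : 0 < x -> is_derive x 1 F (h x).
  move=> x0.
  have [] := @continuous_FTC1_closed R h 0 x (x + 1).
  - by rewrite ltrDl.
  - apply: continuous_compact_integrable; first exact: segment_compact.
    exact: continuous_subspaceT.
  - exact: x0.
  - exact: ch.
  by move=> d1 d2; split; [exact: d1|rewrite -d2 derive1E].
exists (fun t => - F (c + 1 - t)).
have key a b : 0 < a -> a <= b -> exists2 z, a <= z <= b & F b - F a = h z * (b - a).
  move=> a0 ab; have [||z] := @MVT_segment R F h a b ab.
  - by move=> x; rewrite in_itv/= => /andP[h1 _]; apply: dF; exact: lt_trans h1.
  - apply: derivable_within_continuous => x; rewrite in_itv/= => /andP[h1 _].
    by have [] := dF x (lt_le_trans a0 h1).
  by rewrite in_itv/=; exists z.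
move=> s t sc tc st1.
have fin z : (c + 1 - s) - `|t - s| <= z <= (c + 1 - s) + `|t - s| -> `|(t - s) * h z - (t - s) * g s| <= K * (t - s) ^+ 2.
  move=> /andP[z1 z2].
  have hz : `|(c + 1 - z) - s| <= `|t - s| by rewrite ler_norml; apply/andP; split; lra.
  rewrite -mulrBr normrM.
  have H := gK (c + 1 - z) s (le_trans hz st1).
  rewrite -[X in _ <= K * X]real_normK ?num_real// mulrC expr2 mulrA ler_wpM2r//.
  apply: le_trans H _; rewrite ler_wpM2l//.
  have [K0|K0] := leP 0 K => //.
  have := gK (s + 1) s; rewrite addrAC subrr add0r normr1 mulr1 => /(_ (lexx _)) /(le_trans (normr_ge0 _)).
  by rewrite leNgt K0.
have [h1|h1] := leP s t.
  have [|//|z z12 E1] := key (c + 1 - t) (c + 1 - s); [lra|lra|].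
  have -> : - F (c + 1 - t) - - F (c + 1 - s) = (t - s) * h z.
    by rewrite opprK addrC E1; ring.
  apply: fin; rewrite ger0_norm ?subr_ge0//; move/andP: z12 => [? ?]; apply/andP; split; lra.
have [|//|z z12 E1] := key (c + 1 - s) (c + 1 - t); [lra|lra|].
have -> : - F (c + 1 - t) - - F (c + 1 - s) = (t - s) * h z.
  by rewrite opprK addrC -opprB E1; ring.
apply: fin; rewrite ltr0_norm ?subr_lt0//; move/andP: z12 => [? ?]; apply/andP; split; lra.
Qed.

(** Cut [a, b] into k equal steps: the quadratic errors add up to O(1/k). *)
Lemma quad_incr F (a b e C : R) : a <= b ->
  (forall s t, a <= s -> s <= t -> t <= b -> t - s <= 1 -> F t - F s <= e * (t - s) + C * (t - s) ^+ 2) ->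
  F b - F a <= e * (b - a).
Proof.
move=> ab H.
apply/ler_addgt0Pr => d d0.
have [D DE] : exists D : R, D = b - a by exists (b - a).
have D0 : 0 <= D by rewrite DE subr_ge0.
have [k kp kb] : exists2 k : nat, 0 < k%:R :> R & D + `|C| * D ^+ 2 / d < k%:R.
  by exists (Num.truncn (D + `|C| * D ^+ 2 / d)).+1; [rewrite ltr0n|exact: truncnS_gt].
pose s j := a + j%:R * (D / k%:R).
have sS j : s j.+1 - s j = D / k%:R by rewrite /s -natr1; ring.
have CD0 : 0 <= `|C| * D ^+ 2 / d by rewrite divr_ge0 ?mulr_ge0 ?sqr_ge0// ltW.
have step (j : 'I_k) : F (s j.+1) - F (s j) <= e * (D / k%:R) + `|C| * (D / k%:R) ^+ 2.
  have Dk0 : 0 <= D / k%:R by rewrite divr_ge0// ltW.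
  rewrite -(sS j); apply: le_trans (H _ _ _ _ _ _) _.
  - by rewrite lerDl mulr_ge0.
  - by rewrite -subr_ge0 sS.
  - rewrite /s -lerBrDl -DE mulrA ler_pdivrMr// mulrC ler_wpM2l// ler_nat; exact: ltn_ord.
  - rewrite sS ler_pdivrMr// mul1r ltW//; apply: le_lt_trans kb; by rewrite lerDl.
  - by rewrite lerD2l ler_wpM2r ?sqr_ge0// ler_norm.
have -> : F b - F a = \sum_(j < k) (F (s j.+1) - F (s j)).
  rewrite -(big_mkord xpredT (fun j => F (s j.+1) - F (s j))) telescope_sumr//.
  congr (F _ - F _); rewrite /s ?mul0r ?addr0//.
  by rewrite mulrCA divff ?gt_eqF// mulr1 DE addrC subrK.
apply: le_trans (ler_sum _ (fun j _ => step j)) _.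
rewrite sumr_const card_ord -[_ *+ k]mulr_natr mulrDl.
have -> : e * (D / k%:R) * k%:R = e * D by rewrite -mulrA divfK// gt_eqF.
rewrite -DE lerD2l.
have -> : `|C| * (D / k%:R) ^+ 2 * k%:R = `|C| * D ^+ 2 / k%:R by field; rewrite gt_eqF.
rewrite ler_pdivrMr// (mulrC d) -ler_pdivrMr//.
by apply/ltW; apply: le_lt_trans kb; rewrite lerDr.
Qed.

(** Cut [x - l, x + l] into 2k steps of length H = l/k. The second difference at scale
    l is a sum of k^2 second differences at scale H, each at least - (e/l^2) H^2, so
    it is at least - e. *)
Lemma midpoint_convex N (t0 : R) :
  (forall a e : R, 0 < e -> exists2 h0 : R, 0 < h0 & forall H t, 0 < H -> H <= h0 -> a <= t - H -> t + H <= t0 ->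
     - (e * H ^+ 2) <= N (t + H) + N (t - H) - 2 * N t) ->
  forall x l, 0 < l -> x + l <= t0 -> 0 <= N (x + l) + N (x - l) - 2 * N x.
Proof.
move=> HN x l l0 xl; apply/ler_addgt0Pr => e e0.
have [h0 h00 Hh] := HN (x - l) (e / l ^+ 2) (divr_gt0 e0 (exprn_gt0 _ l0)).
have [k kp kb] : exists2 k : nat, 0 < k%:R :> R & l / h0 < k%:R.
  by exists (Num.truncn (l / h0)).+1; [rewrite ltr0n|exact: truncnS_gt].
have [H HE] : exists H : R, H = l / k%:R by exists (l / k%:R).
have H0 : 0 < H by rewrite HE divr_gt0.
have Hle : H <= h0 by rewrite HE ler_pdivrMr// mulrC -ler_pdivrMr// ltW.
have kH : k%:R * H = l by rewrite HE mulrC divfK// gt_eqF.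
pose y j := x - l + j%:R * H.
pose d j := N (y j.+1) - N (y j).
pose q := e / l ^+ 2 * H ^+ 2.
(* consecutive increments decrease by at most q, so increments k steps apart by k q *)
have dS j : (j.+2 <= k + k)%N -> d j - q <= d j.+1.
  move=> jk.
  have E1 : y j.+2 = y j.+1 + H by rewrite /y -[j.+2%:R]natr1; ring.
  have E2 : y j = y j.+1 - H by rewrite /y -[j.+1%:R]natr1; ring.
  have := Hh H (y j.+1) H0 Hle.
  rewrite -E1 -E2 => /(_ _ _) hh.
  have : - (e / l ^+ 2 * H ^+ 2) <= N (y j.+2) + N (y j) - 2 * N (y j.+1).
    apply: hh; first by rewrite /y lerDl mulr_ge0// ltW.
    rewrite /y; apply: le_trans xl.
    have : j.+2%:R * H <= (k + k)%:R * H by rewrite ler_pM2r// ler_nat.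
    rewrite (natrD _ k k) (mulrDl k%:R) kH; lra.
  rewrite -/q /d; lra.
have dk i j : (i + j < k + k)%N -> d i - j%:R * q <= d (i + j)%N.
  elim: j => [|j IH] ij; first by rewrite addn0 mul0r subr0.
  rewrite addnS; apply: le_trans (dS (i + j)%N _); last by rewrite -addnS.
  have ij' : (i + j < k + k)%N by apply: ltn_trans ij; rewrite addnS.
  have := IH ij'.
  rewrite -natr1 mulrDl mul1r; lra.
have e1 : N x - N (x - l) = \sum_(j < k) d j.
  rewrite -(big_mkord xpredT d) telescope_sumr//; congr (N _ - N _); rewrite /y ?kH ?mul0r; ring.
have e2 : N (x + l) - N x = \sum_(j < k) d (j + k)%N.
  rewrite -(big_mkord xpredT (fun j => d (j + k)%N)).
  rewrite (telescope_sumr (fun j => N (y (j + k)%N)))//; congr (N _ - N _); rewrite /y ?natrD ?mulrDl ?kH ?mul0r ?add0n ?kH; ring.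
have : \sum_(j < k) (d j - k%:R * q) <= \sum_(j < k) d (j + k)%N.
  by apply: ler_sum => j _; apply: dk; rewrite ltn_add2r.
rewrite sumrB -e1 -e2 sumr_const card_ord -[_ *+ k]mulr_natr.
have -> : k%:R * q * k%:R = e.
  by rewrite /q HE; field; rewrite !gt_eqF.
lra.
Qed.
End RealLemmas.

(** * The symmetric derivative of the pairing along dilations *)

Section Family.
Variables (R : realType) (n : nat).
Local Notation E := 'rV[R]_n.
Implicit Types (x y : E).
Local Notation p := (@bump R n).
Local Notation mass := (@wInt R n (fun=> 1)).

Definition norm1 x : R := \sum_i `|x 0 i|.

Lemma norm1_ge0 x : 0 <= norm1 x. Proof. exact: sumr_ge0. Qed.

Lemma norm1_eq0 x : norm1 x = 0 -> x = 0.
Proof.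
move=> h; apply/rowP => i; rewrite mxE; apply/eqP; rewrite -normr_le0 -h.
by rewrite /norm1 (bigD1 i)//= lerDl; exact: sumr_ge0.
Qed.

Lemma cont_norm1 (W : E -> E) : (forall i, continuous (fun x => W x 0 i)) -> continuous (fun x => norm1 (W x)).
Proof.
move=> cW; apply: cont_sum => i x.
by apply: (@continuous_comp _ _ _ (fun x => W x 0 i) (fun y : R => `|y|)); [exact: cW|exact: norm_continuous].
Qed.

Lemma cont_ramp (W : E -> E) (D : R) : (forall i, continuous (fun x => W x 0 i)) ->
  continuous (fun x => Num.max 0 (2 - norm1 (W x) / D)).
Proof.
move=> cW; have c2 : continuous (fun x => 2 - norm1 (W x) / D).
  apply: contB; first exact: cont_cst.
  by apply: contM; [exact: cont_norm1|exact: cont_cst].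
rewrite (_ : (fun x => _) = fun x => 2^-1 * ((2 - norm1 (W x) / D) + `|2 - norm1 (W x) / D|)).
  apply: contM; first exact: cont_cst.
  apply: contD => // x.
  by apply: (@continuous_comp _ _ _ (fun x => 2 - norm1 (W x) / D) (fun y : R => `|y|)); [exact: c2|exact: norm_continuous].
apply/funext => x; move: (2 - _) => y; have [h|h] := leP 0 y.
  by rewrite ger0_norm//; lra.
by rewrite ltr0_norm//; lra.
Qed.

(** What the argument uses of the dilations of a solution, for times t <= t0.
    [fam_gen] says that the time derivative of u is the generator. [fam_small] says
    that the part of the unit ball where V is non-zero but small has little mass,
    uniformly on compact time intervals. [fam_dil] compares the weight p, which is
    what the estimate of B needs, with the smaller weight of [contact], at the price
    of passing to a larger ball, that is to time t + d. *)
Record dilation_family (t0 C d : R) (u : R -> E -> R) (V : R -> E -> E) (f : R -> E -> R) : Prop := {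
  fam_C : 0 <= C ;
  fam_d : 0 < d ;
  fam_sol : forall t, t <= t0 -> weak_solution (u t) (V t) (f t) ;
  fam_V : forall t x i, t <= t0 -> dot x x < 1 -> `|V t x 0 i| <= C ;
  fam_Vlip : forall s t x i, s <= t0 -> t <= t0 -> `|s - t| <= 1 -> dot x x < 1 ->
    `|V s x 0 i - V t x 0 i| <= C * `|s - t| ;
  fam_gen : forall s t x, s <= t0 -> t <= t0 -> `|s - t| <= 1 -> dot x x < 1 ->
    `|u s x - u t x - (s - t) * generator (u t) (V t) x| <= C * (s - t) ^+ 2 ;
  fam_f : forall t x, t <= t0 -> f t x = (V t x != 0)%:R ;
  fam_small : forall a e, 0 < e -> exists2 D, 0 < D & forall s, a <= s -> s <= t0 ->
    wInt (fun x => f s x * Num.max 0 (2 - norm1 (V s x) / D)) <= e ;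
  fam_dil : forall t, t + d <= t0 ->
    wInt (fun x => p x * (1 - f t x)) <= C * contact (f (t + d)) }.

Lemma pair_diff_le (C D : R) (V1 V2 W : E -> E) : 0 <= C -> 0 <= D ->
  (forall i, loc (fun x => V1 x 0 i)) -> (forall i, loc (fun x => V2 x 0 i)) -> (forall i, loc (fun x => W x 0 i)) ->
  (forall x i, dot x x < 1 -> `|V1 x 0 i - V2 x 0 i| <= D) ->
  (forall x i, dot x x < 1 -> `|W x 0 i| <= C) ->
  `|pair V1 W - pair V2 W| <= C *+ n * mass * D.
Proof.
move=> C0 D0 l1 l2 lW hD hW.
have ld (V : E -> E) : (forall i, loc (fun x => V x 0 i)) -> loc (fun x => p x * dot (V x) (W x)).
  by move=> lV; apply: locM; [exact: loc_bump|exact: loc_dot].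
rewrite /pair -wIntB; [|exact: ld|exact: ld].
have -> : C *+ n * mass * D = (D * C *+ n) * mass by rewrite -mulrnAr; ring.
apply: wInt_bound => [|x hx]; first by apply: locB; exact: ld.
rewrite -mulrBr -dotBl normrM ger0_norm ?bump_ge0//.
apply: (@le_trans _ _ `|dot (V1 x - V2 x) (W x)|); first by rewrite ler_piMl ?bump_le1.
by apply: dot_le => i; [rewrite !mxE; exact: hD|exact: hW].
Qed.

Section Monotonicity.
Variables (t0 C d : R) (u : R -> E -> R) (V : R -> E -> E) (f : R -> E -> R).
Hypothesis F : dilation_family t0 C d u V f.
Local Notation S := (fam_sol F).
Let C0 : 0 <= C := fam_C F.

Definition pair_at (s t : R) : R := pair (V s) (V t).
Definition contact_at (t : R) : R := contact (f t).

Let mass_ge0 : 0 <= mass := @wInt1_ge0 R n.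

Lemma coord_in x i : dot x x < 1 -> `|x 0 i| <= 1.
Proof. by move=> h; apply: le_trans (coord_le_norm _ _) _; exact: norm_lt1_of_dot. Qed.

Lemma radial_le (D : R) (W : E -> E) x : dot x x < 1 -> (forall i, `|W x 0 i| <= D) -> `|radial W x| <= D *+ n.
Proof.
by move=> hx hW; have := @dot_le _ _ x (W x) 1 D (fun i => coord_in i hx) hW; rewrite mul1r.
Qed.

Lemma radial_lip s t x : s <= t0 -> t <= t0 -> `|s - t| <= 1 -> dot x x < 1 ->
  `|radial (V s) x - radial (V t) x| <= C *+ n * `|s - t|.
Proof.
move=> st tt st1 hx; rewrite /radial -dotBr mulrnAl.
apply: (@radial_le (C * `|s - t|) (fun y => V s y - V t y) x hx) => i.
by rewrite !mxE; exact: (fam_Vlip F).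
Qed.

(** The mass of the contact set is an integral of the gradient, hence inherits its
    Lipschitz bound in time. *)
Lemma contact_at_radial t : t <= t0 -> contact_at t = full_moment R n - wInt (fun x => p x * radial (V t) x).
Proof. by move=> tt; rewrite (radial_moment (S tt)) /contact_at; ring. Qed.

Lemma loc_pradial t : t <= t0 -> loc (fun x => p x * radial (V t) x).
Proof. by move=> tt; apply: locM; [exact: loc_bump|exact: loc_radial (S tt)]. Qed.

Lemma contact_at_lip s t : s <= t0 -> t <= t0 -> `|s - t| <= 1 ->
  `|contact_at s - contact_at t| <= C *+ n * mass * `|s - t|.
Proof.
move=> st tt st1; rewrite !contact_at_radial//.
have -> : full_moment R n - wInt (fun x => p x * radial (V s) x) - (full_moment R n - wInt (fun x => p x * radial (V t) x))
  = wInt (fun x => p x * radial (V t) x) - wInt (fun x => p x * radial (V s) x) by ring.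
rewrite -wIntB; [|exact: loc_pradial|exact: loc_pradial].
rewrite mulrAC; apply: wInt_bound => [|x hx]; first by apply: locB; exact: loc_pradial.
rewrite -mulrBr normrM ger0_norm ?bump_ge0// distrC.
apply: (@le_trans _ _ `|radial (V s) x - radial (V t) x|); last exact: radial_lip.
by rewrite ler_piMl ?bump_le1// distrC.
Qed.

(** The error term E(s,r) of the symmetric derivative of the pairing. *)
Definition err (s r : R) : R :=
  wInt (fun x => p x * ((1 - f r x) * radial (V s) x)).

Lemma loc_err s r : s <= t0 -> r <= t0 -> loc (fun x => p x * ((1 - f r x) * radial (V s) x)).
Proof.
move=> ss rr; apply: locM; first exact: loc_bump.
apply: locM; last exact: loc_radial (S ss).
by apply: locB; [exact: loc_cst|exact: loc_f (S rr)].
Qed.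

Lemma wInt_radial_noncontact s r : s <= t0 -> r <= t0 ->
  wInt (fun x => p x * (radial (V s) x * f r x)) = full_moment R n - contact_at s - err s r.
Proof.
move=> ss rr; rewrite /contact_at -(radial_moment (S ss)) /err -wIntB; [|exact: loc_pradial|exact: loc_err].
by apply: eq_wInt => x _; ring.
Qed.

Let K1 : R := (1 + 4 * (C *+ n)) * mass.
Let K10 : 0 <= K1.
Proof. by rewrite mulr_ge0// addr_ge0// mulr_ge0// mulrn_wge0. Qed.

(** The time derivative of the pairing with a fixed solution: the increment of u is
    (s' - s) times the generator up to a quadratic error, and [vari] is bounded in
    the uniform norm of its first argument. *)
Lemma vari_step s s' (uW : E -> R) (W : E -> E) (fW : E -> R) : s <= t0 -> s' <= t0 -> `|s' - s| <= 1 ->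
  weak_solution uW W fW -> (forall x, dot x x < 1 -> forall i, `|W x 0 i| <= C) ->
  `|pair (V s') W - pair (V s) W + (s' - s) * vari (generator (u s) (V s)) W fW| <= K1 * (C * (s' - s) ^+ 2).
Proof.
move=> ss ss' s1 SW hW.
have lu := loc_u (S ss); have lu' := loc_u (S ss'); have lg := loc_generator (S ss).
rewrite (pair_vari (S ss') SW) (pair_vari (S ss) SW).
pose e x := u s' x + (- 1 * u s x + - (s' - s) * generator (u s) (V s) x).
have lm : loc (fun x => -1 * u s x) by apply: locM => //; exact: loc_cst.
have lmg : loc (fun x => - (s' - s) * generator (u s) (V s) x) by apply: locM => //; exact: loc_cst.
have lmm := locD lm lmg.
have E1 : vari e W fW = vari (u s') W fW - vari (u s) W fW - (s' - s) * vari (generator (u s) (V s)) W fW.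
  by rewrite /e (variD SW lu' lmm) (variD SW lm lmg) (variZ _ SW lu) (variZ _ SW lg); ring.
rewrite -normrN.
rewrite (_ : - (_ + _) = vari e W fW); last by rewrite E1; ring.
apply: vari_bound SW _ _ C0 hW _ => //.
- exact: locD.
- by rewrite mulr_ge0 ?sqr_ge0.
- move=> x hx; have := fam_gen F ss' ss s1 hx.
  by congr (`| _ | <= _); rewrite /e; ring.
Qed.

Lemma pair_at_lip s t r : s <= t0 -> t <= t0 -> r <= t0 -> `|s - t| <= 1 ->
  `|pair_at s r - pair_at t r| <= C *+ n * mass * (C * `|s - t|).
Proof.
move=> ss tt rr st1; apply: pair_diff_le => //; first by rewrite mulr_ge0.
- exact: loc_V (S ss).
- exact: loc_V (S tt).
- exact: loc_V (S rr).
- by move=> x i hx; exact: (fam_Vlip F).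
- by move=> x i hx; exact: (fam_V F).
Qed.

Let rr s t := wInt (fun x => radial (V s) x * radial (V t) x).

Lemma rr_lip s t r : s <= t0 -> t <= t0 -> r <= t0 -> `|s - t| <= 1 ->
  `|rr s r - rr t r| <= C *+ n * (C *+ n) * mass * `|s - t|.
Proof.
move=> ss tt rr0 st1; have ls := loc_radial (S ss); have lt := loc_radial (S tt); have lr := loc_radial (S rr0).
rewrite /rr -wIntB; [|exact: locM|exact: locM].
rewrite mulrAC; apply: wInt_bound => [|x hx]; first by apply: locB; exact: locM.
rewrite -mulrBl normrM mulrAC ler_pM//; first exact: radial_lip.
by apply: radial_le => // i; exact: (fam_V F).
Qed.

Let rrC s t : rr s t = rr t s.
Proof. by apply: eq_wInt => x _; rewrite mulrC. Qed.
Let pair_atC s t : pair_at s t = pair_at t s. Proof. exact: pairC. Qed.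

Let vari_generator_at s t : s <= t0 -> t <= t0 ->
  vari (generator (u s) (V s)) (V t) (f t) = full_moment R n - contact_at s - err s t - 4 * rr s t + 2 * pair_at s t.
Proof. by move=> ss tt; rewrite (vari_generator (S ss) (S tt)) wInt_radial_noncontact. Qed.

(** The first argument is moved while the second one is at its new value, then the
    second while the first is at its old value. The contributions 4 rr and 2 pair_at
    of [vari_generator_at] are symmetric, so they cancel up to O(e^2) and leave the
    contact masses and the error terms. *)
Lemma symmetric_step : exists2 K, 0 <= K & forall s s' r r' e, s' <= t0 -> r <= t0 -> 0 <= e -> e <= 1 ->
  s' = s + e -> r' = r - e ->
  `|pair_at s' r' - pair_at s r - e * (contact_at s' - contact_at r + (err s' r' - err r s))| <= K * e ^+ 2.
Proof.
pose Kr := C *+ n * (C *+ n) * mass; pose Kc := C *+ n * mass * C.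
have Kr0 : 0 <= Kr by rewrite !mulr_ge0// mulrn_wge0.
have Kc0 : 0 <= Kc by rewrite !mulr_ge0// mulrn_wge0.
exists (2 * (K1 * C) + 4 * (2 * Kr) + 2 * (2 * Kc)).
  have := mulr_ge0 K10 C0; move: Kr0 Kc0; move: (K1 * C) Kr Kc => k1 k2 k3; lra.
move=> s s' r r' e s't rt e0 e1 sE rE.
have st : s <= t0 by lra.
have r't : r' <= t0 by lra.
have a1 : `|s - s'| <= 1 by rewrite sE (_ : s - _ = - e) ?normrN ?ger0_norm//; ring.
have a2 : `|r' - r| <= 1 by rewrite rE (_ : _ - r = - e) ?normrN ?ger0_norm//; ring.
have V_ t (tt : t <= t0) x : dot x x < 1 -> forall i, `|V t x 0 i| <= C by move=> hx i; exact: (fam_V F).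
have h1 := vari_step s't st a1 (S r't) (V_ r' r't).
have h2 := vari_step rt r't a2 (S st) (V_ s st).
rewrite -!/(pair_at _ _) vari_generator_at// in h1; rewrite -!/(pair_at _ _) vari_generator_at// in h2.
have a1' : `|s' - s| <= 1 by rewrite distrC.
have h3 := rr_lip s't st r't a1'; have h4 := rr_lip r't rt st a2.
have h5 := pair_at_lip s't st r't a1'; have h6 := pair_at_lip r't rt st a2.
have n1 : `|s' - s| = e by rewrite sE addrAC subrr add0r ger0_norm.
have n2 : `|r' - r| = e by rewrite rE addrAC subrr add0r normrN ger0_norm.
have m1 : s - s' = - e by rewrite sE; ring.
have m2 : r' - r = - e by rewrite rE; ring.
rewrite n1 in h3; rewrite n2 in h4; rewrite n1 in h5; rewrite n2 in h6.
rewrite m1 in h1; rewrite m2 in h2.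
rewrite (rrC r' s) (rrC r s) in h4; rewrite (pair_atC r' s) (pair_atC r s) in h6.
rewrite (rrC r s) in h2; rewrite (pair_atC r' s) (pair_atC r s) in h2.
rewrite sqrrN in h1 h2.
have h3' : e * `|rr s' r' - rr s r'| <= Kr * e ^+ 2.
  by rewrite expr2 mulrA mulrC ler_wpM2r.
have h4' : e * `|rr s r' - rr s r| <= Kr * e ^+ 2.
  by rewrite expr2 mulrA mulrC ler_wpM2r.
have h5' : e * `|pair_at s' r' - pair_at s r'| <= Kc * e ^+ 2.
  by rewrite expr2 mulrA mulrC ler_wpM2r// /Kc -mulrA.
have h6' : e * `|pair_at s r' - pair_at s r| <= Kc * e ^+ 2.
  by rewrite expr2 mulrA mulrC ler_wpM2r// /Kc -mulrA.
rewrite -{1}(ger0_norm e0) -normrM in h3'; rewrite -{1}(ger0_norm e0) -normrM in h4'.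
rewrite -{1}(ger0_norm e0) -normrM in h5'; rewrite -{1}(ger0_norm e0) -normrM in h6'.
move: h1 h2 h3' h4' h5' h6'; rewrite mulrA.
move: (Kr) (Kc) (K1 * C) => k1 k2 k3.
move: (pair_at s' r') (pair_at s r) (pair_at s r') (rr s' r') (rr s r) (rr s r') (contact_at s') (contact_at r) (err s' r') (err r s) (full_moment R n) => c1 c2 c3 q1 q2 q3 l1 l2 g1 g2 fu.
rewrite !ler_norml => /andP[? ?] /andP[? ?] /andP[? ?] /andP[? ?] /andP[? ?] /andP[? ?].
by apply/andP; split; lra.
Qed.

(** Where V_r = 0 and V_s <> 0, the Lipschitz bound in time gives |V_s| = O(|s - r|),
    and for s close to r the set of such points is contained in the layer of
    [fam_small]. *)
Lemma err_small a e : 0 < e -> exists2 D, 0 < D & forall s r, a <= s -> s <= t0 -> r <= t0 ->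
  `|s - r| <= D -> `|err s r| <= e * `|s - r|.
Proof.
move=> e0; have [Cn CnE] : exists Cn, Cn = C *+ n + 1 by exists (C *+ n + 1).
have Cn0 : 0 < Cn by rewrite CnE ltr_pwDr// mulrn_wge0.
have [D D0 HD] := fam_small F a (divr_gt0 e0 Cn0).
exists (Num.min 1 (D / Cn)); first by rewrite lt_min ltr01 divr_gt0.
move=> s r as_ ss rr0; rewrite le_min => /andP[sr1 srD].
have [->|nsr] := eqVneq s r.
  rewrite subrr normr0 mulr0 (_ : err r r = 0) ?normr0//.
  rewrite -[RHS](@Int0 R n); apply: eq_Int => x.
  rewrite (_ : (1 - f r x) * _ = 0) ?mulr0// /radial -dotZr scalerBl scale1r (ls_fV (S rr0)) subrr dotC.
  exact: dot0l.
have del0 : 0 < `|s - r| by rewrite normr_gt0 subr_eq0.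
set dl := `|s - r| in del0 sr1 srD *.
pose g x := f s x * Num.max 0 (2 - norm1 (V s x) / D).
have lg : loc g.
  apply: locM; first exact: loc_f (S ss).
  by apply: loc_cont; apply: cont_ramp; exact: ls_V (S ss).
have g0 x : 0 <= g x by rewrite mulr_ge0 ?le_max ?lexx//; have /andP[] := ls_f0 (S ss) x.
have -> : e * dl = (Cn * dl) * (e / Cn) by field; rewrite gt_eqF.
apply: (@le_trans _ _ (Cn * dl * wInt g)); last first.
  by rewrite ler_wpM2l ?HD// mulr_ge0// ltW.
have lh := loc_err ss rr0.
have lG : loc (fun x => (Cn * dl) * g x) by apply: locM => //; exact: loc_cst.
have ptw x : dot x x < 1 -> `|p x * ((1 - f r x) * radial (V s) x)| <= Cn * dl * g x.
  move=> hx; rewrite normrM ger0_norm ?bump_ge0//.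
  apply: (@le_trans _ _ `|(1 - f r x) * radial (V s) x|); first by rewrite ler_piMl ?bump_le1.
  have R0 : 0 <= Cn * dl * g x by rewrite mulr_ge0// mulr_ge0// ltW.
  rewrite (fam_f F x rr0); have [Vr|Vr] := eqVneq (V r x) 0; last by rewrite subrr mul0r normr0.
  rewrite subr0 mul1r.
  have [Vs|Vs] := eqVneq (V s x) 0; first by rewrite /radial Vs dotC dot0l normr0.
  have Vsi i : `|V s x 0 i| <= C * dl.
    by have := fam_Vlip F i ss rr0 sr1 hx; rewrite Vr mxE subr0.
  (* the cut-off is at least 1 on the layer norm1 (V s) <= D *)
  have gE : 1 <= g x.
    rewrite /g (fam_f F x ss) Vs mul1r le_max; apply/orP; right.
    have nV : norm1 (V s x) <= Cn * dl.
      apply: (@le_trans _ _ (\sum_(i < n) (C * dl))); first by apply: ler_sum.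
      by rewrite sumr_const card_ord -mulrnAl ler_wpM2r ?(ltW del0)// CnE lerDl.
    suff : norm1 (V s x) / D <= 1 by lra.
    rewrite ler_pdivrMr// mul1r; apply: le_trans nV _.
    by rewrite mulrC -ler_pdivlMr.
  apply: (@le_trans _ _ (Cn * dl)); last by rewrite ler_peMr// mulr_ge0// ltW.
  apply: le_trans (radial_le hx Vsi) _.
  by rewrite -mulrnAl ler_wpM2r ?(ltW del0)// CnE lerDl.
rewrite ler_norml; apply/andP; split.
  rewrite -mulNr -wIntZ//; apply: wInt_le => //; first by apply: locM => //; exact: loc_cst.
  by move=> x /ptw; rewrite ler_norml mulNr => /andP[].
rewrite -wIntZ//; apply: wInt_le => // x /ptw; by rewrite ler_norml => /andP[].
Qed.
End Monotonicity.
End Family.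

(** * Convexity, monotonicity and convergence in mean square *)

Section Blowup.
Variables (R : realType) (n : nat).
Local Notation E := 'rV[R]_n.
Implicit Types (x y : E).
Local Notation p := (@bump R n).
Local Notation mass := (@wInt R n (fun=> 1)).

Definition mean_square (V W : E -> E) : R := wInt (fun x => p x * dot (V x - W x) (V x - W x)).

Lemma mean_square_ge0 V W : 0 <= mean_square V W.
Proof. by apply: wInt_ge0 => x _; rewrite mulr_ge0 ?bump_ge0 ?dot_ge0. Qed.

Lemma mean_squareE (V W : E -> E) : (forall i, loc (fun x => V x 0 i)) -> (forall i, loc (fun x => W x 0 i)) ->
  mean_square V W = pair V V - 2 * pair V W + pair W W.
Proof.
move=> lV lW.
have l (A B : E -> E) : (forall i, loc (fun x => A x 0 i)) -> (forall i, loc (fun x => B x 0 i)) ->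
    loc (fun x => p x * dot (A x) (B x)).
  by move=> lA lB; apply: locM; [exact: loc_bump|exact: loc_dot].
have l1 := l _ _ lV lV; have l2 := l _ _ lV lW; have l3 := l _ _ lW lW.
have l2' : loc (fun x => 2 * (p x * dot (V x) (W x))) by apply: locM => //; exact: loc_cst.
have l12 := locB l1 l2'.
rewrite /pair -wIntZ// -wIntB// -wIntD//; apply: eq_wInt => x _.
by rewrite !(dotBl, dotBr) (dotC (W x)); ring.
Qed.

Variables (t0 C d : R) (u : R -> E -> R) (V : R -> E -> E) (f : R -> E -> R).
Hypothesis F : dilation_family t0 C d u V f.
Local Notation S := (fam_sol F).
Local Notation pair_at := (pair_at V).
Local Notation contact_at := (contact_at f).
Local Notation err := (err V f).
Let C0 : 0 <= C := fam_C F.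
Let mass_ge0 : 0 <= mass := @wInt1_ge0 R n.

(** [lip_primitive] needs a function on the whole line, hence the truncation at t0. *)
Lemma primitive_exists : exists2 K, 0 <= K & exists L : R -> R, forall s t, s <= t0 -> t <= t0 -> `|t - s| <= 1 ->
  `|L t - L s - (t - s) * contact_at s| <= K * (t - s) ^+ 2.
Proof.
pose K := C *+ n * mass; have K0 : 0 <= K by rewrite mulr_ge0// mulrn_wge0.
exists K => //.
have minlip (s t : R) : `|Num.min s t0 - Num.min t t0| <= `|s - t|.
  have [h1|h1] := leP s t0; have [h2|h2] := leP t t0; rewrite ?subrr ?normr0//.
    by rewrite !ler0_norm; lra.
  by rewrite !ger0_norm; lra.
have [|L HL] := @lip_primitive R (fun t => contact_at (Num.min t t0)) K t0.
  move=> s t st1; apply: le_trans (contact_at_lip F _ _ _) _.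
  - by rewrite ge_min lexx orbT.
  - by rewrite ge_min lexx orbT.
  - exact: le_trans (minlip s t) st1.
  - by rewrite ler_wpM2l.
exists L => s t ss tt st1; have := HL s t ss tt st1.
by rewrite /= min_l.
Qed.

Lemma pair_at_amgm s r : s <= t0 -> r <= t0 -> pair_at s r <= (pair_at s s + pair_at r r) / 2.
Proof.
move=> ss rr; have := mean_square_ge0 (V s) (V r); rewrite mean_squareE; last 2 first.
- exact: loc_V (S ss).
- exact: loc_V (S rr).
rewrite -!/(pair_at _ _); lra.
Qed.

Lemma contact_at_ge0 t : t <= t0 -> 0 <= contact_at t.
Proof. by move=> tt; exact: contact_ge0 (S tt). Qed.

Variables (K : R) (L : R -> R).
Hypothesis K0 : 0 <= K.
Hypothesis HL : forall s t, s <= t0 -> t <= t0 -> `|t - s| <= 1 ->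
  `|L t - L s - (t - s) * contact_at s| <= K * (t - s) ^+ 2.

Let N t := pair_at t t / 2 - L t.

(** Integrate [symmetric_step] in h from 0 to H, with the primitive L absorbing the
    contact masses, and bound c(t+H, t-H) by the mean of c(t+H, t+H) and c(t-H, t-H). *)
Lemma second_difference a e : 0 < e -> exists2 h0 : R, 0 < h0 & forall H t, 0 < H -> H <= h0 ->
  a <= t - H -> t + H <= t0 -> - (e * H ^+ 2) <= N (t + H) + N (t - H) - 2 * N t.
Proof.
move=> e0; have e4 : 0 < e / 4 by rewrite divr_gt0.
have [D D0 HD] := err_small F a e4.
have [Ks Ks0 HKs] := symmetric_step F.
exists (Num.min 2^-1 (D / 2)); first by rewrite lt_min invr_gt0 ltr0n divr_gt0.
move=> H t H0; rewrite le_min => /andP[H1 HD2] at0 tt0.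
pose G h := - pair_at (t + h) (t - h) + L (t + h) + L (t - h).
have key : G H - G 0 <= (e * H) * (H - 0).
  apply: (@quad_incr _ G 0 H (e * H) (Ks + K + K) (ltW H0)) => h h' h0 hh' h'H hh1.
  pose ep := h' - h.
  have ep0 : 0 <= ep by rewrite subr_ge0.
  have T1 : t + h <= t0 by lra.
  have T2 : t + h' <= t0 by lra.
  have T3 : t - h <= t0 by lra.
  have T4 : t - h' <= t0 by lra.
  have s1 := @HKs (t + h) (t + h') (t - h) (t - h') ep T2 T3 ep0 hh1.
  have n1 : `|t + h' - (t - h')| = 2 * h' by rewrite ger0_norm; lra.
  have n2 : `|t - h - (t + h)| = 2 * h by rewrite ler0_norm; lra.
  have b1 := @HD (t + h') (t - h').
  have b2 := @HD (t - h) (t + h).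
  rewrite n1 in b1; rewrite n2 in b2.
  have {}b1 : `|err (t + h') (t - h')| <= e / 4 * (2 * h') by apply: b1 => //; lra.
  have {}b2 : `|err (t - h) (t + h)| <= e / 4 * (2 * h) by apply: b2 => //; lra.
  have {}s1 := s1 _ _.
  have {}s1 : `|pair_at (t + h') (t - h') - pair_at (t + h) (t - h) - ep * (contact_at (t + h') - contact_at (t - h) + (err (t + h') (t - h') - err (t - h) (t + h)))| <= Ks * ep ^+ 2.
    by apply: s1; rewrite /ep; ring.
  have m1 : t + h - (t + h') = - ep by rewrite /ep; ring.
  have m2 : t - h' - (t - h) = - ep by rewrite /ep; ring.
  have p1 := @HL (t + h') (t + h) T2 T1; rewrite m1 normrN (ger0_norm ep0) sqrrN in p1.
  have p2 := @HL (t - h) (t - h') T3 T4; rewrite m2 normrN (ger0_norm ep0) sqrrN in p2.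
  have {}p1 := p1 hh1; have {}p2 := p2 hh1.
  have q1 : ep * `|err (t + h') (t - h') - err (t - h) (t + h)| <= e * H * ep.
    rewrite mulrC ler_wpM2r//; apply: le_trans (ler_normB _ _) _.
    have : e / 4 * (2 * h') <= e / 4 * (2 * H) by rewrite ler_wpM2l ?(ltW e4)// ler_wpM2l.
    have : e / 4 * (2 * h) <= e / 4 * (2 * H) by rewrite ler_wpM2l ?(ltW e4)// ler_wpM2l// (le_trans hh').
    lra.
  rewrite -{1}(ger0_norm ep0) -normrM in q1.
  rewrite /G -/ep.
  move: s1 p1 p2 q1; rewrite !ler_norml.
  move: (pair_at (t + h') (t - h')) (pair_at (t + h) (t - h)) (contact_at (t + h')) (contact_at (t - h)) (err (t + h') (t - h')) (err (t - h) (t + h)) (L _) (L _) (L _) (L _) => x1 x2 x3 x4 x5 x6 x7 x8 x9 x10.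
  move=> /andP[a1 a2] /andP[a3 a4] /andP[a5 a6] /andP[a7 a8].
  lra.
have am := @pair_at_amgm (t + H) (t - H) tt0 _.
have {}am : pair_at (t + H) (t - H) <= (pair_at (t + H) (t + H) + pair_at (t - H) (t - H)) / 2 by apply: am; lra.
move: key am; rewrite /G /N !addr0 !subr0 expr2 -mulrA; lra.
Qed.

Lemma N_convex (x l : R) : 0 < l -> x + l <= t0 -> 0 <= N (x + l) + N (x - l) - 2 * N x.
Proof. by apply: midpoint_convex; exact: second_difference. Qed.

Lemma L_incr_le a b M : a <= b -> b <= t0 -> (forall t, a <= t -> t <= b -> contact_at t <= M) -> L b - L a <= M * (b - a).
Proof.
move=> ab bt HM; apply: (@quad_incr _ L a b M K ab) => s t as_ st tb ts1.
have := HL (le_trans st (le_trans tb bt)) (le_trans tb bt); rewrite ger0_norm ?subr_ge0// => /(_ ts1).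
have : (t - s) * contact_at s <= (t - s) * M by rewrite ler_wpM2l ?subr_ge0// HM// (le_trans st).
rewrite (mulrC M) ler_norml => h /andP[h1 h2]; lra.
Qed.

Lemma L_nondec a b : a <= b -> b <= t0 -> L a <= L b.
Proof.
move=> ab bt.
have : - L b - - L a <= 0 * (b - a).
  apply: (@quad_incr _ (fun t => - L t) a b 0 K ab) => s t as_ st tb ts1.
  have st0 : s <= t0 by apply: le_trans st (le_trans tb bt).
  have := HL st0 (le_trans tb bt); rewrite ger0_norm ?subr_ge0// => /(_ ts1).
  have : 0 <= (t - s) * contact_at s by rewrite mulr_ge0 ?contact_at_ge0 ?subr_ge0.
  rewrite mul0r add0r ler_norml => h /andP[h1 h2]; lra.
by rewrite mul0r; lra.
Qed.

Variables (q : E -> R) (W : E -> E).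
Hypothesis SW : weak_solution q W (fun=> 1).
Hypothesis qW : forall x, dot x x < 1 -> generator q W x = 0.
Hypothesis WC : forall x, dot x x < 1 -> forall i, `|W x 0 i| <= C.
Hypothesis blow : forall s e b : R, 0 < e -> exists2 T : R, T <= b & forall t, `|t - T| <= s -> t <= t0 ->
  forall x i, dot x x < 1 -> `|V t x 0 i - W x 0 i| <= e.

Lemma full_W : full_moment R n = wInt (fun x => p x * radial W x).
Proof.
rewrite (radial_moment SW) (_ : contact _ = 0) ?subr0//.
by rewrite -[RHS](@Int0 R n); apply: eq_Int => x; rewrite subrr !mulr0.
Qed.

(** The limit has no contact set, so by [radial_moment] the contact mass is a
    difference of radial moments. *)
Lemma contact_at_close t e : t <= t0 -> (forall x i, dot x x < 1 -> `|V t x 0 i - W x 0 i| <= e) ->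
  contact_at t <= e *+ n * mass.
Proof.
move=> tt Ve; rewrite (contact_at_radial F)// full_W.
have l1 := loc_pradial F tt.
have l2 : loc (fun x => p x * radial W x) by apply: locM; [exact: loc_bump|exact: loc_radial SW].
rewrite -wIntB//; apply: le_trans (ler_norm _) _.
apply: wInt_bound => [|x hx]; first exact: locB.
rewrite -mulrBr normrM (ger0_norm (bump_ge0 _)).
apply: (@le_trans _ _ `|radial W x - radial (V t) x|); first by rewrite ler_piMl ?bump_le1.
rewrite distrC /radial -dotBr.
have := @radial_le _ _ e (fun y => V t y - W y) x hx; rewrite /radial; apply => i.
by rewrite !mxE Ve.
Qed.

Lemma pair_at_close t e : t <= t0 -> 0 <= e -> (forall x i, dot x x < 1 -> `|V t x 0 i - W x 0 i| <= e) ->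
  `|pair_at t t - pair W W| <= 2 * (C *+ n * mass * e).
Proof.
move=> tt e0 Ve.
have lV := loc_V (S tt); have lW := loc_V SW.
have h1 : `|pair (V t) (V t) - pair W (V t)| <= C *+ n * mass * e.
  by apply: pair_diff_le => // x i hx; exact: (fam_V F).
have h2 : `|pair (V t) W - pair W W| <= C *+ n * mass * e.
  by apply: pair_diff_le => // x i hx; exact: WC.
rewrite (pairC W) in h1; move: h1 h2; rewrite -/(pair_at t t) !ler_norml => /andP[? ?] /andP[? ?].
by apply/andP; split; lra.
Qed.

(** If N decreased somewhere, by convexity its increments over steps of length l
    would stay below a negative constant at all earlier times. Close to the times of
    the blow-up sequence these increments are arbitrarily small. *)
Lemma N_nondec a b : a <= b -> b <= t0 -> N a <= N b.
Proof.
rewrite le_eqVlt => /predU1P[->//|ab] bt.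
have [l lE] : exists l, l = b - a by exists (b - a).
have l0 : 0 < l by rewrite lE subr_gt0.
pose Dj (j : nat) := N (a - j%:R * l + l) - N (a - j%:R * l).
have D0 : Dj 0%N = N b - N a by rewrite /Dj mul0r subr0 lE (_ : a + (b - a) = b)//; ring.
have mono j : Dj j <= Dj 0%N.
  elim: j => // j; apply: le_trans.
  have := @N_convex (a - j%:R * l) l l0.
  have jl : 0 <= j%:R * l by rewrite mulr_ge0// ltW.
  have -> : a - j%:R * l + l <= t0 by lra.
  rewrite /Dj.
  have -> : a - j.+1%:R * l + l = a - j%:R * l by rewrite -natr1; ring.
  have -> : a - j.+1%:R * l = a - j%:R * l - l by rewrite -natr1; ring.
  move=> /(_ isT); lra.
rewrite -subr_ge0 -D0.
pose Kt := C *+ n * mass * 2 + n%:R * mass * l + 1.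
have Kt0 : 0 < Kt by rewrite ltr_pwDr// addr_ge0// !mulr_ge0 ?mulrn_wge0 ?(ltW l0)//.
apply/ler_addgt0Pr => e e0.
have [T Ta HT] := blow l a (divr_gt0 e0 Kt0).
(* the step that starts within distance l of the good time T *)
pose j := (Num.truncn ((a - T) / l)).+1.
have j1 : (a - T) / l < j%:R by exact: truncnS_gt.
have j2 : j%:R <= (a - T) / l + 1.
  rewrite -natr1 lerD2r truncn_le//.
  by rewrite divr_ge0 ?subr_ge0// ltW.
have jj1 : a - T < j%:R * l by rewrite -ltr_pdivrMr.
have jj2 : j%:R * l <= (a - T) + l.
  have : j%:R * l <= ((a - T) / l + 1) * l by rewrite ler_pM2r.
  by rewrite mulrDl mul1r divfK// gt_eqF.
apply: le_trans (_ : 0 <= Dj j + e) _; last by rewrite lerD2r.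
rewrite /Dj; move: (j%:R * l) jj1 jj2 => z z1 z2.
have y1 : a - z <= t0 by lra.
have y2 : a - z + l <= t0 by lra.
have ne : 0 <= e / Kt by rewrite divr_ge0// ltW.
have c1 t : a - z <= t -> t <= a - z + l -> forall x i, dot x x < 1 -> `|V t x 0 i - W x 0 i| <= e / Kt.
  move=> h1 h2; apply: HT; last by lra.
  by rewrite ler_norml; apply/andP; split; lra.
have k1 := pair_at_close y1 ne (c1 _ (lexx _) _).
have {}k1 := k1 (ltW _); have k2 := pair_at_close y2 ne (c1 _ _ (lexx _)).
have {}k1 : `|pair_at (a - z) (a - z) - pair W W| <= 2 * (C *+ n * mass * (e / Kt)) by apply: k1; rewrite ltrDl.
have {}k2 : `|pair_at (a - z + l) (a - z + l) - pair W W| <= 2 * (C *+ n * mass * (e / Kt)) by apply: k2; rewrite lerDl ltW.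
have k3 : L (a - z + l) - L (a - z) <= (e / Kt) *+ n * mass * (a - z + l - (a - z)).
  apply: L_incr_le => //; first by rewrite lerDl ltW.
  by move=> t h1 h2; apply: contact_at_close; [lra|exact: c1].
have eE : e = (C *+ n * mass * (e / Kt)) * 2 + (e / Kt) *+ n * mass * (a - z + l - (a - z)) + e / Kt.
  rewrite -[(e / Kt) *+ n]mulr_natr.
  have -> : (C *+ n * mass * (e / Kt)) * 2 + e / Kt * n%:R * mass * (a - z + l - (a - z)) + e / Kt = (e / Kt) * Kt.
    by rewrite /Kt; ring.
  by rewrite divfK// gt_eqF.
rewrite eE; move: k1 k2 k3 ne; rewrite /N !ler_norml.
move: (C *+ n * mass * (e / Kt)) ((e / Kt) *+ n * mass * (a - z + l - (a - z))) (e / Kt)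
  (pair_at (a - z) (a - z)) (pair_at (a - z + l) (a - z + l)) (pair W W) (L _) (L _) => x1 x2 x3 x4 x5 x6 x7 x8.
by move=> /andP[h1 h2] /andP[h3 h4] h5 h6; lra.
Qed.

Let B t := pair (V t) W.
Let Kd := 1 + C *+ n * C.

Let Kd0 : 0 <= Kd.
Proof. by rewrite addr_ge0// mulr_ge0// mulrn_wge0. Qed.

(** The limit is homogeneous of degree two, x . W = 2 q. This turns the radial terms
    into multiples of int q x . V_s, which cancel. *)
Lemma vari_generator_limit s : s <= t0 ->
  vari (generator (u s) (V s)) W (fun=> 1) = wInt (fun x => p x * ((1 - f s x) * radial W x)) - contact_at s.
Proof.
move=> ss; have Ss := S ss.
have lf := loc_f Ss; have lrs := loc_radial Ss; have lrW := loc_radial SW; have lq := loc_u SW; have lp := @loc_bump R n.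
rewrite (vari_generator Ss SW).
have e1 : wInt (fun x => p x * (radial (V s) x * 1)) = full_moment R n - contact_at s.
  by rewrite -(radial_moment Ss); apply: eq_wInt => x _; rewrite mulr1.
have e2 : wInt (fun x => radial (V s) x * radial W x) = 2 * wInt (fun x => q x * radial (V s) x).
  rewrite -wIntZ; last exact: locM.
  apply: eq_wInt => x hx; have := qW hx; rewrite /generator => /eqP; rewrite subr_eq0 => /eqP ->; ring.
have e3 : pair (V s) W = 4 * wInt (fun x => q x * radial (V s) x) - wInt (fun x => p x * (q x * f s x)).
  by rewrite pairC (pair_vari SW Ss) /vari opprB.
have e4 : wInt (fun x => p x * ((1 - f s x) * radial W x)) = full_moment R n - 2 * wInt (fun x => p x * (q x * f s x)).
  have l1 : loc (fun x => p x * radial W x) by apply: locM.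
  have l2 : loc (fun x => p x * (q x * f s x)) by do 2! apply: locM => //.
  have l3 : loc (fun x => 2 * (p x * (q x * f s x))) by apply: locM => //; exact: loc_cst.
  rewrite full_W -wIntZ// -wIntB//; apply: eq_wInt => x hx.
  have := qW hx; rewrite /generator => /eqP; rewrite subr_eq0 => /eqP ->; ring.
rewrite e1 e2 e3 e4; ring.
Qed.

Lemma vari_generator_limit_le s : s + d <= t0 ->
  `|vari (generator (u s) (V s)) W (fun=> 1)| <= contact_at s + C *+ n * C * contact_at (s + d).
Proof.
move=> sd; have ss : s <= t0 by apply: le_trans sd; rewrite lerDl ltW// (fam_d F).
have Ss := S ss; have lf := loc_f Ss; have lrW := loc_radial SW; have lp := @loc_bump R n.
rewrite vari_generator_limit//; apply: le_trans (ler_normB _ _) _.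
rewrite addrC (ger0_norm (contact_at_ge0 ss)) lerD2l.
have l1 : loc (fun x => p x * (1 - f s x)) by apply: locM => //; apply: locB => //; exact: loc_cst.
have l2 : loc (fun x => p x * ((1 - f s x) * radial W x)).
  by apply: locM => //; apply: locM => //; apply: locB => //; exact: loc_cst.
have l3 : loc (fun x => C *+ n * (p x * (1 - f s x))) by apply: locM => //; exact: loc_cst.
apply: (@le_trans _ _ (C *+ n * wInt (fun x => p x * (1 - f s x)))); last first.
  by rewrite -mulrA ler_wpM2l ?mulrn_wge0// (fam_dil F).
have ptw x : dot x x < 1 -> `|p x * ((1 - f s x) * radial W x)| <= C *+ n * (p x * (1 - f s x)).
  move=> hx; have /andP[f0 f1] := ls_f0 Ss x.
  have pf0 : 0 <= p x * (1 - f s x) by rewrite mulr_ge0 ?bump_ge0 ?subr_ge0.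
  have -> : p x * ((1 - f s x) * radial W x) = p x * (1 - f s x) * radial W x by ring.
  rewrite normrM (ger0_norm pf0) mulrC; apply: ler_wpM2r => //.
  by apply: radial_le => // i; exact: WC.
rewrite -wIntZ// ler_norml; apply/andP; split.
  rewrite lerNl -mulN1r -wIntZ//; apply: wInt_le => //; first by apply: locM => //; exact: loc_cst.
  by move=> x /ptw; rewrite ler_norml mulN1r => /andP[h _]; rewrite lerNl.
by apply: wInt_le => // x /ptw; rewrite ler_norml => /andP[].
Qed.

Let L2 t := L t + C *+ n * C * L (t + d).

Lemma B_incr a b : a <= b -> b + d <= t0 -> B b - B a <= L2 b - L2 a.
Proof.
move=> ab bd; have Cn0 : 0 <= C *+ n * C by rewrite mulr_ge0// mulrn_wge0.
pose K1 := (1 + 4 * (C *+ n)) * mass.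
suff : (B b - L2 b) - (B a - L2 a) <= 0 * (b - a) by rewrite mul0r; lra.
apply: (@quad_incr _ (fun t => B t - L2 t) a b 0 (K1 * C + K + C *+ n * C * K) ab) => s t as_ st tb ts1.
have d0 := fam_d F.
have td : t + d <= t0 by lra.
have sd : s + d <= t0 by lra.
have ss : s <= t0 by lra.
have tt : t <= t0 by lra.
have n1 : `|t - s| <= 1 by rewrite ger0_norm ?subr_ge0.
have h1 := vari_step F ss tt n1 SW WC.
have h2 := vari_generator_limit_le sd.
have h3 := HL ss tt n1.
have m1 : t + d - (s + d) = t - s by ring.
have h4 := HL sd td; rewrite m1 in h4; have {}h4 := h4 n1.
have h4' : C *+ n * C * `|L (t + d) - L (s + d) - (t - s) * contact_at (s + d)| <= C *+ n * C * K * (t - s) ^+ 2.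
  by rewrite -[X in _ <= X]mulrA; apply: ler_wpM2l.
have h2' : (t - s) * `|vari (generator (u s) (V s)) W (fun=> 1)| <= (t - s) * (contact_at s + C *+ n * C * contact_at (s + d)).
  by rewrite ler_wpM2l ?subr_ge0.
have ts0 : 0 <= t - s by rewrite subr_ge0.
rewrite -{1}(ger0_norm ts0) -normrM in h2'; rewrite -{1}(ger0_norm Cn0) -normrM in h4'.
move: h1 h2' h3 h4'; rewrite /L2 /B -/K1 !ler_norml.
move: (pair (V t) W) (pair (V s) W) (vari (generator (u s) (V s)) W (fun=> 1)) (contact_at s) (contact_at (s + d)) (L t) (L s)
  (L (t + d)) (L (s + d)) (t - s) (K1) (C *+ n * C).
move=> x1 x2 x3 x4 x5 x6 x7 x8 x9 e k1 k2 /andP[g1 g2] /andP[g3 g4] /andP[g5 g6] /andP[g7 g8].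
lra.
Qed.

(** Start from a time T of the blow-up sequence at which V_T is close to W. Before T,
    c(t,t) cannot exceed c(T,T) because N and L are nondecreasing, and B varies
    little because L does. *)
Theorem mean_square_cvg0 : forall e, 0 < e -> exists2 T, T <= t0 & forall t, t <= T -> mean_square (V t) W <= e.
Proof.
have Mdef t : t <= t0 -> mean_square (V t) W = pair_at t t - 2 * B t + pair W W.
  by move=> tt; apply: mean_squareE; [exact: loc_V (S tt)|exact: loc_V SW].
have M0 t : 0 <= pair_at t t by apply: wInt_ge0 => x _; rewrite mulr_ge0 ?bump_ge0 ?dot_ge0.
have d0 := fam_d F.
(* T0 nearly minimises c(t,t), so that c and L hardly vary before T0 *)
pose A := [set y | exists2 t, t <= t0 & y = pair_at t t].
have Ai : has_inf A.
  split; first by exists (pair_at t0 t0); exists t0.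
  by exists 0 => _ [t _ ->].
move=> e e0.
pose Kf := Kd * 2 + 1.
have Kf0 : 0 < Kf by rewrite ltr_pwDr// mulr_ge0.
pose eta := e / (2 * Kf).
have eta0 : 0 < eta by rewrite divr_gt0// mulr_gt0.
have [_ [T0 T0t ->] HT0] := inf_adherent eta0 Ai.
have low t : t <= t0 -> inf A <= pair_at t t by move=> tt; apply: inf_lbound => //; [case: Ai|exists t].
have Ninc a b : a <= b -> b <= t0 -> L b - L a <= (pair_at b b - pair_at a a) / 2.
  by move=> ab bt; have := N_nondec ab bt; rewrite /N; lra.
have Lsmall a b : a <= b -> b <= T0 -> L b - L a <= eta / 2.
  move=> ab bT; have bt := le_trans bT T0t.
  have h1 := Ninc a b ab bt; have h2 := Ninc b T0 bT T0t; have h3 := L_nondec bT T0t.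
  have := low a (le_trans ab bt); lra.
pose massn := 1 *+ n * mass + 1.
have massn0 : 0 < massn by rewrite ltr_pwDr// mulr_ge0// mulrn_wge0.
pose ee := Num.min 1 (e / (2 * massn)).
have ee0 : 0 < ee by rewrite lt_min ltr01 divr_gt0// mulr_gt0.
have [T TT HT] := blow 0 (T0 - d) ee0.
have Tt : T <= t0 by lra.
exists T => // a aT.
have mT : mean_square (V T) W <= e / 2.
  have Vc x i : dot x x < 1 -> `|V T x 0 i - W x 0 i| <= ee by apply: HT => //; rewrite subrr normr0.
  have ee1 : ee <= 1 by rewrite ge_min lexx.
  have eee : ee <= e / (2 * massn) by rewrite ge_min lexx orbT.
  apply: (@le_trans _ _ (ee * (1 *+ n * mass))); last first.
    apply: (@le_trans _ _ (ee * massn)); first by rewrite ler_wpM2l ?(ltW ee0)// lerDl.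
    apply: (@le_trans _ _ (e / (2 * massn) * massn)); first by rewrite ler_wpM2r ?(ltW massn0).
    by rewrite invfM mulrA divfK// gt_eqF.
  apply: le_trans (ler_norm _) _; rewrite mulrA; apply: wInt_bound => [|x hx].
    have lD i : loc (fun x => (V T x - W x) 0 i).
      by under eq_fun do rewrite !mxE; apply: locB; [exact: loc_V (S Tt) i|exact: loc_V SW i].
    by apply: locM; [exact: loc_bump|exact: loc_dot].
  rewrite normrM ger0_norm ?bump_ge0//.
  apply: (@le_trans _ _ `|dot (V T x - W x) (V T x - W x)|); first by rewrite ler_piMl ?bump_le1.
  have := @dot_le _ _ (V T x - W x) (V T x - W x) ee 1.
  rewrite -mulrnAr; apply=> i; rewrite !mxE; first exact: Vc.
  exact: le_trans (Vc _ _ hx) ee1.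
have aT0 : a <= T0 by lra.
have at0 : a <= t0 by lra.
have h1 : L T - L a <= (pair_at T T - pair_at a a) / 2 by apply: Ninc.
have h2 := L_nondec aT Tt.
have h3 : B T - B a <= L2 T - L2 a by apply: B_incr => //; lra.
have h4 : L T - L a <= eta / 2 by apply: Lsmall => //; lra.
have h5 : L (T + d) - L (a + d) <= eta / 2 by apply: Lsmall; [rewrite lerD2r|lra].
have h6 : L2 T - L2 a <= Kd * (eta / 2).
  rewrite /L2 /Kd mulrDl mul1r.
  have := ler_wpM2l (_ : 0 <= C *+ n * C) h5; rewrite mulr_ge0 ?mulrn_wge0// => /(_ isT).
  rewrite mulrBr; lra.
have h7 : Kd * eta <= e / 2.
  have KdKf : Kd <= Kf by rewrite /Kf; move: Kd0; move: (Kd) => k; lra.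
  have : Kd * eta <= Kf * eta by rewrite ler_wpM2r ?(ltW eta0).
  suff -> : Kf * eta = e / 2 by [].
  by rewrite /eta; field; rewrite gt_eqF.
rewrite Mdef// in mT; rewrite Mdef//; lra.
Qed.
End Blowup.

(** * Quadratic polynomials as solutions *)

Section Quadratic.
Variables (R : realType) (n : nat).
Local Notation E := 'rV[R]_n.
Implicit Types (x y : E) (A : 'M[R]_n).
Local Notation e_ i := (delta_mx 0 i : E).

Lemma quadE A x : quad A x = 2^-1 * dot (x *m A) x.
Proof. by rewrite /quad mxE /dot; congr (_ * _); apply: eq_bigr => i _; rewrite !mxE. Qed.

Lemma dot_mulmx A x y : A^T = A -> dot (x *m A) y = dot (y *m A) x.
Proof.
move=> AT.
have E1 (a b : E) : dot a b = (a *m b^T) 0 0 by rewrite mxE; apply: eq_bigr => i _; rewrite mxE.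
rewrite !E1 (_ : x *m A *m y^T = (y *m A *m x^T)^T); first by rewrite mxE.
by rewrite !trmx_mul trmxK AT mulmxA.
Qed.

Lemma mulmx_lip A : exists2 K, 0 <= K & forall x, `|x *m A| <= K * `|x|.
Proof.
exists (\sum_j \sum_i `|A i j|); first by apply: sumr_ge0 => j _; exact: sumr_ge0.
move=> x; apply: norm_le_coord => [|j].
  by rewrite mulr_ge0//; apply: sumr_ge0 => j _; exact: sumr_ge0.
rewrite mxE; apply: le_trans (ler_norm_sum _ _ _) _.
apply: (@le_trans _ _ ((\sum_i `|A i j|) * `|x|)).
  rewrite mulr_suml; apply: ler_sum => i _; rewrite normrM mulrC ler_wpM2l//; exact: coord_le_norm.
rewrite ler_wpM2r// [leRHS](bigD1 j)//= lerDl; apply: sumr_ge0 => k _; exact: sumr_ge0.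
Qed.

Lemma cont_mulmx A i : continuous (fun x : E => (x *m A) 0 i).
Proof.
under eq_fun do rewrite mxE.
by apply: cont_sum => j; apply: contM; [exact: cont_coord|exact: cont_cst].
Qed.

Lemma cont_quad A : continuous (quad A).
Proof.
rewrite (_ : quad A = fun x => 2^-1 * dot (x *m A) x); last by apply/funext => x; exact: quadE.
apply: contM; first exact: cont_cst.
by apply: cont_dot => i; [exact: cont_mulmx|exact: cont_coord].
Qed.

Lemma is_derive_quad A x v : A^T = A -> is_derive x v (quad A) (dot v (x *m A)).
Proof.
move=> AT; apply: (@is_derive_quadratic_error _ _ _ _ _ _ `|2^-1 * dot (v *m A) v|) => h _.
rewrite !quadE.
have -> : 2^-1 * dot ((x + h *: v) *m A) (x + h *: v) - 2^-1 * dot (x *m A) x - dot v (x *m A) * h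
   = 2^-1 * dot (v *m A) v * h ^+ 2.
  by rewrite mulmxDl -scalemxAl !(dotDl, dotDr, dotZl, dotZr) (dot_mulmx v x AT) (dotC v); field.
by rewrite normrM (ger0_norm (sqr_ge0 _)).
Qed.

Lemma is_derive_mulmx A x i : is_derive x (e_ i) (fun y => (y *m A) 0 i) (A i i).
Proof.
apply: (@is_derive_quadratic_error _ _ _ _ _ _ 0) => h _.
rewrite mulmxDl -scalemxAl -rowE !mxE mul0r (_ : _ - _ = 0) ?normr0//; ring.
Qed.

Lemma weak_solution_quad A : A^T = A -> \tr A = 1 -> weak_solution (quad A) (fun x => x *m A) (fun=> 1).
Proof.
move=> AT A1; split.
- exact: cont_quad.
- by move=> i; exact: cont_mulmx.
- exact: meas_cst.
- by move=> _; rewrite ler01 lexx.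
- by move=> x; rewrite scale1r.
- move=> x i _; have := is_derive_quad x (e_ i) AT.
  by rewrite dotC dot_delta.
- move=> eta deta T; have [K K0 HK] := mulmx_lip A.
  apply: (@weak_divergence _ _ 1 2 K _ _ (fun x => x *m A) (fun=> 1) set0 T) => //.
  + by rewrite ltr1n.
  + by move=> x y; rewrite -mulmxBl.
  + exact: meas_cst.
  + by move=> x; rewrite normr1.
  + by rewrite preimage_set0; exact: negligible_set0.
  + by move=> x _ _; exists (fun i => A i i) => // i; exact: is_derive_mulmx.
Qed.

Lemma generator_quad A x : generator (quad A) (fun x => x *m A) x = 0.
Proof. by rewrite /generator /radial quadE mulrA divff// mul1r dotC subrr. Qed.

Lemma quad_inj A B : A^T = A -> B^T = B -> quad A = quad B -> A = B.
Proof.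
move=> AT BT AB.
have H (M : 'M[R]_n) i j : M^T = M -> quad M (e_ i + e_ j) - quad M (e_ i) - quad M (e_ j) = M i j.
  move=> MT; rewrite !quadE mulmxDl !(dotDl, dotDr) (dot_mulmx (e_ j) (e_ i) MT).
  by rewrite -!rowE !dot_delta !mxE; field.
by apply/matrixP => i j; rewrite -(H A)// -(H B)// AB.
Qed.
End Quadratic.

(** * The dilations of a solution *)

Section Dilation.
Variables (R : realType) (n : nat).
Local Notation E := 'rV[R]_n.
Implicit Types (x y v : E).
Local Notation e_ i := (delta_mx 0 i : E).
Local Notation p := (@bump R n).

Variables (K rho : R) (u : E -> R) (V : E -> E) (N : set E).
Hypothesis K0 : 0 <= K.
Hypothesis rho0 : 0 < rho.
Hypothesis cu : continuous u.
Hypothesis u0 : u 0 = 0.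
Hypothesis V0 : V 0 = 0.
Hypothesis VK : forall x y, `|V x - V y| <= K * `|x - y|.
Hypothesis dV : forall x v, `|x| < rho -> is_derive x v u (dot v (V x)).
Hypothesis nN : (lebn R n).-negligible (@row_of_tuple R n @^-1` N).
Hypothesis hN : forall x, `|x| < rho -> ~ N x -> exists2 l : 'I_n -> R,
     forall i, is_derive x (e_ i) (fun y => V y 0 i) (l i) & \sum_i l i = (V x != 0)%:R.

Let f x : R := (V x != 0)%:R.
Definition dil_u t x : R := expR (- 2 * t) * u (expR t *: x).
Definition dil_V t x : E := expR (- t) *: V (expR t *: x).
Definition dil_f t x : R := f (expR t *: x).

Let cV i : continuous (fun x => V x 0 i).
Proof.
apply: (@lip_continuous _ _ _ K) => x y.
by apply: le_trans (VK x y); have := coord_le_norm (V x - V y) i; rewrite !mxE.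
Qed.

(** The indicator of (V <> 0) is a pointwise limit of continuous functions of V. *)
Lemma meas_noncritical : meas f.
Proof.
apply: (@meas_lim _ _ (fun k x => 1 - 2^-1 * Num.max 0 (2 - norm1 (V x) / k.+1%:R^-1))).
  move=> k; apply: meas_continuous; apply: contB; first exact: cont_cst.
  by apply: contM; [exact: cont_cst|exact: cont_ramp].
move=> x; rewrite /f; have [->|Vx] := eqVneq (V x) 0.
  rewrite (_ : (fun k => _) = fun=> 0); first exact: cvg_cst.
  apply/funext => k; rewrite /norm1 big1 ?mul0r ?subr0 ?max_r//; last by move=> i _; rewrite mxE normr0.
  by rewrite mulVf// subrr.
have n0 : 0 < norm1 (V x).
  by rewrite lt_neqAle norm1_ge0 andbT eq_sym; apply: contraNneq Vx => /norm1_eq0 ->.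
apply: cvg_near_cst; near=> k.
rewrite max_l ?mulr0 ?subr0// invrK subr_le0 mulrC -ler_pdivrMr//.
apply: le_trans (ltW (truncnS_gt _)) _; rewrite ler_nat ltnS.
by near: k; exact: nbhs_infty_ge.
Unshelve. all: by end_near.
Qed.

Lemma is_derive_dil (c : R) g x v (l : R) : is_derive (c *: x) v g l ->
  is_derive x v (fun y => g (c *: y)) (c * l).
Proof.
move=> dg; apply: is_derive_of_line.
have h1 : is_derive (0 : R) 1 (fun s => g (c *: x + s *: v)) l.
  by apply: is_derive_line; rewrite scale0r addr0.
have h2 : is_derive (0 : R) 1 (fun s : R => c * s) c.
  by apply: is_derive_eq; rewrite /GRing.scale/= ?mulr1 ?mulr0 ?addr0 ?add0r.
have h1' : is_derive (c * 0) 1 (fun s => g (c *: x + s *: v)) l by rewrite mulr0.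
have := is_derive1_comp h1' h2.
rewrite (mulrC c); congr (is_derive _ _ _ _); apply/funext => s /=.
by rewrite -scalerA -scalerDr.
Qed.

Variable t0 : R.
Hypothesis t0rho : expR t0 < rho.
Hypothesis t0le : t0 <= 0.

Let erho t : t <= t0 -> expR t < rho.
Proof. by move=> tt; apply: le_lt_trans t0rho; rewrite ler_expR. Qed.
Let e1 t : t <= t0 -> expR t <= 1.
Proof. by move=> tt; rewrite -expR0 ler_expR (le_trans tt). Qed.
Let ein t x : t <= t0 -> `|x| <= 1 -> `|expR t *: x| < rho.
Proof.
move=> tt x1; apply: le_lt_trans (erho tt); rewrite normrZ ger0_norm ?expR_ge0//.
by rewrite ler_piMr ?expR_ge0.
Qed.

Lemma expRNM t : expR (- t) * expR t = 1 :> R. Proof. by rewrite -expRD addNr expR0. Qed.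

(** A test function for u_t, dilated, is a test function for u supported in the ball of
    radius e^t < rho, where the equation holds. *)
Lemma weak_solution_dil t : t <= t0 -> weak_solution (dil_u t) (dil_V t) (dil_f t).
Proof.
move=> tt; have et0 := expR_gt0 t; split.
- apply: contM; first exact: cont_cst.
  by have := @cont_aff _ _ u (expR t) 0 cu; under eq_fun do rewrite addr0.
- move=> i; under eq_fun do rewrite mxE; apply: contM; first exact: cont_cst.
  by have := @cont_aff _ _ _ (expR t) 0 (@cV i); under eq_fun do rewrite addr0.
- by have := meas_aff (expR t) 0 meas_noncritical; under eq_fun do rewrite addr0.
- by move=> x; rewrite /dil_f /f; case: (_ != _); rewrite ?ler01 ?lexx.
- move=> x; rewrite /dil_f /dil_V /f; case: (eqVneq (V (expR t *: x)) 0) => [->|_]; last by rewrite scale1r.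
  by rewrite !scaler0.
- move=> x i hx; have h := is_derive_dil (dV (e_ i) (ein tt (norm_lt1_of_dot hx))).
  rewrite /dil_u mxE.
  have := is_deriveZ (expR (-2 * t)) h.
  rewrite dotC dot_delta /GRing.scale/= mulrA -expRD (_ : -2 * t + t = - t)//; ring.
- move=> eta deta T; have [ce cd de se sd] := T.
  pose c := expR t; have c0 : 0 < c := et0.
  have cn0 : c != 0 by rewrite gt_eqF.
  pose eta' y := eta (c^-1 *: y); pose deta' y := c^-1 *: deta (c^-1 *: y).
  have T' : test c eta' deta'.
    have out y : c < `|y| -> 1 < `|c^-1 *: y|.
      by move=> h; rewrite normrZ gtr0_norm ?invr_gt0// mulrC ltr_pdivlMr// mul1r.
    split.
    + by have := @cont_aff _ _ eta c^-1 0 ce; under eq_fun do rewrite addr0.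
    + move=> i; rewrite /deta'; under eq_fun do rewrite mxE; apply: contM; first exact: cont_cst.
      by have := @cont_aff _ _ _ c^-1 0 (cd i); under eq_fun do rewrite addr0.
    + by move=> x i; rewrite mxE; exact: is_derive_dil.
    + by move=> x /out; exact: se.
    + by move=> x /out /sd h; rewrite /deta' h scaler0.
  have f1 x : `|f x| <= 1 by rewrite /f; case: (_ != _); rewrite ?normr1 ?normr0.
  have WD := weak_divergence T' (erho tt) VK meas_noncritical f1 nN hN.
  have vK (y : E) : c^-1 *: (c *: y) = y by rewrite scalerA mulVf// scale1r.
  have cE : c^-1 = expR (- t) by rewrite /c expRN.
  have cV' i : continuous (fun y : E => deta' y 0 i * V y 0 i).
    by apply: contM; [exact: test_dcont T' i|exact: cV].
  have a1 : adm (fun x => \sum_i deta' x 0 i * V x 0 i).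
    apply: (@adm_continuous _ _ _ c); first by apply: cont_sum.
    by move=> x hx; apply: big1 => i _; rewrite (test_dsupp T' hx) mxE mul0r.
  have a2 : adm (fun x => eta' x * f x).
    have [D D0 hD] := continuous_bounded c (test_cont T').
    split; first by apply: measM; [apply: meas_continuous; exact: test_cont T'|exact: meas_noncritical].
    exists (D + c) => x; split.
      rewrite normrM; have [h|h] := leP `|x| c; last by rewrite (test_supp T' h) normr0 mul0r addr_ge0// ltW.
      apply: (@le_trans _ _ (D * 1)); first by rewrite ler_pM ?hD.
      by rewrite mulr1 lerDl ltW.
    by move=> h; rewrite (test_supp T') ?mul0r//; apply: le_lt_trans h; rewrite lerDr.
  have k1 := Int_aff 0 c0 a1; have k2 := Int_aff 0 c0 a2.
  have -> : Int (fun x => \sum_i deta x 0 i * dil_V t x 0 i) = c ^- n * Int (fun x => \sum_i deta' x 0 i * V x 0 i).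
    rewrite -k1; apply: eq_Int => x; rewrite addr0; apply: eq_bigr => i _.
    by rewrite /deta' /dil_V vK !mxE -cE; ring.
  have -> : Int (fun x => eta x * dil_f t x) = c ^- n * Int (fun x => eta' x * f x).
    by rewrite -k2; apply: eq_Int => x; rewrite addr0 /eta' vK.
  by rewrite WD mulrN.
Qed.

Let V_le x : `|V x| <= K * `|x|.
Proof. by have := VK x 0; rewrite V0 !subr0. Qed.

Lemma dil_V_le t x : t <= t0 -> `|x| <= 1 -> `|dil_V t x| <= K.
Proof.
move=> tt x1; rewrite normrZ ger0_norm ?expR_ge0//.
apply: (@le_trans _ _ (expR (- t) * (K * (expR t * 1)))).
  rewrite ler_wpM2l ?expR_ge0//; apply: le_trans (V_le _) _; rewrite ler_wpM2l//.
  by rewrite normrZ ger0_norm ?expR_ge0// ler_wpM2l ?expR_ge0.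
by rewrite mulr1 mulrCA expRNM mulr1.
Qed.

Lemma expR_lip1 (y : R) : `|y| <= 1 -> `|expR y - 1| <= expR 1 * `|y|.
Proof.
have H (a b : R) : a <= b -> b <= 1 -> `|expR b - expR a| <= expR 1 * (b - a).
  move=> ab b1; have [|c] := @MVT_segment R expR expR a b ab.
  - by apply: continuous_subspaceT => z; exact: continuous_expR.
  rewrite in_itv/= => /andP[_ cb] ->.
  rewrite normrM (ger0_norm (expR_ge0 _)) ger0_norm ?subr_ge0// ler_wpM2r ?subr_ge0// ler_expR.
  exact: le_trans b1.
rewrite ler_norml => /andP[y1 y2]; have [y0|y0] := leP 0 y.
  by have := H 0 y y0 y2; rewrite expR0 subr0 (ger0_norm y0).
by have := H y 0 (ltW y0) ler01; rewrite expR0 sub0r distrC (ltr0_norm y0).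
Qed.

Lemma dil_V_lip s t x : s <= t0 -> t <= t0 -> `|s - t| <= 1 -> `|x| <= 1 ->
  `|dil_V s x - dil_V t x| <= 2 * K * expR 1 * `|s - t|.
Proof.
move=> ss tt st1 x1.
have ets : `|expR (t - s) - 1| <= expR 1 * `|s - t|.
  by rewrite distrC in st1; rewrite (distrC s); exact: expR_lip1.
have -> : dil_V s x - dil_V t x = expR (- s) *: (V (expR s *: x) - V (expR t *: x)) + (expR (- s) - expR (- t)) *: V (expR t *: x).
  by rewrite /dil_V scalerBr scalerBl addrA subrK.
apply: le_trans (ler_normD _ _) _; rewrite !normrZ (ger0_norm (expR_ge0 _)).
have a1 : expR (- s) * `|V (expR s *: x) - V (expR t *: x)| <= K * `|expR (t - s) - 1|.
  apply: (@le_trans _ _ (expR (- s) * (K * `|expR s - expR t|))).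
    rewrite ler_wpM2l ?expR_ge0//; apply: le_trans (VK _ _) _; rewrite ler_wpM2l//.
    by rewrite -scalerBl normrZ ler_piMr.
  rewrite mulrCA ler_wpM2l// -[X in X * _](ger0_norm (expR_ge0 _)) -normrM mulrBr expRNM -expRD.
  by rewrite (addrC (- s)) distrC.
have a2 : `|expR (- s) - expR (- t)| * `|V (expR t *: x)| <= K * `|expR (t - s) - 1|.
  apply: (@le_trans _ _ (`|expR (- s) - expR (- t)| * (K * expR t))).
    rewrite ler_wpM2l//; apply: le_trans (V_le _) _; rewrite ler_wpM2l//.
    by rewrite normrZ ger0_norm ?expR_ge0// ler_piMr ?expR_ge0.
  rewrite mulrCA ler_wpM2l// -[X in _ * X](ger0_norm (expR_ge0 _)) -normrM mulrBl expRNM -expRD.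
  by rewrite (addrC (- s)).
apply: le_trans (lerD a1 a2) _.
have := ler_wpM2l K0 ets; rewrite -[2 * K * _ * _]mulrA -[2 * K * _]mulrA; lra.
Qed.

Lemma is_derive_dil_u t x : t <= t0 -> `|x| <= 1 ->
  is_derive t 1 (fun s => dil_u s x) (generator (dil_u t) (dil_V t) x).
Proof.
move=> tt x1.
have h1 : is_derive (expR t) 1 (fun c : R => u (c *: x)) (dot x (V (expR t *: x))).
  have := @is_derive_line _ _ u 0 x (dot x (V (expR t *: x))) (expR t).
  rewrite add0r => /(_ (dV x (ein tt x1))).
  by under eq_fun do rewrite add0r.
have h2 := is_derive1_comp h1 (is_derive_expR t).
have h3 : is_derive t 1 (fun s : R => expR (- 2 * s)) (- 2 * expR (- 2 * t)).
  have g1 : is_derive (- 2 * t) 1 (@expR R) (expR (- 2 * t)) by exact: is_derive_expR.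
  have g2 : is_derive t 1 (fun s : R => - 2 * s) (- 2).
    by apply: is_derive_eq; rewrite /GRing.scale/= ?mulr1 ?mulr0 ?addr0 ?add0r.
  by have := is_derive1_comp g1 g2; rewrite mulrC.
have h4 := is_deriveM h3 h2.
apply: (@is_derive_eq _ _ _ _ _ _ _ _ h4).
rewrite /generator /radial /dil_V /dil_u dotZr /GRing.scale/=.
have -> : expR (- t) = expR (- 2 * t) * expR t by rewrite -expRD; congr expR; ring.
by ring.
Qed.

Lemma dil_mvt s t x : s <= t0 -> t <= t0 -> `|x| <= 1 ->
  exists2 c, `|c - t| <= `|s - t| /\ c <= t0 & dil_u s x - dil_u t x = (s - t) * generator (dil_u c) (dil_V c) x.
Proof.
move=> ss tt x1.
have H a b : a <= b -> b <= t0 -> exists2 c, a <= c <= b & dil_u b x - dil_u a x = (b - a) * generator (dil_u c) (dil_V c) x.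
  move=> ab bt; have [||c] := @MVT_segment R (fun s => dil_u s x) (fun c => generator (dil_u c) (dil_V c) x) a b ab.
  - move=> z; rewrite in_itv/= => /andP[_ zb]; apply: is_derive_dil_u => //.
    exact: le_trans (ltW zb) bt.
  - apply: derivable_within_continuous => z; rewrite in_itv/= => /andP[_ zb].
    by have [] := is_derive_dil_u (le_trans zb bt) x1.
  by rewrite in_itv/= => cab ->; exists c => //; rewrite mulrC.
have [st|st] := leP s t.
  have [c /andP[c1 c2] E1] := H s t st tt; exists c.
    by split; [rewrite !ler0_norm; lra|lra].
  by rewrite -opprB E1; ring.
have [c /andP[c1 c2] E1] := H t s (ltW st) ss; exists c => //.
by split; [rewrite !ger0_norm; lra|lra].
Qed.

Lemma dil_u_le t x : t <= t0 -> `|x| <= 1 -> `|dil_u t x| <= K *+ n.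
Proof.
move=> tt x1; rewrite normrM (ger0_norm (expR_ge0 _)).
have h : `|u (expR t *: x)| <= (expR t * (K * expR t)) *+ n.
  have [||c] := @MVT_segment R (fun c : R => u (c *: x)) (fun c => dot x (V (c *: x))) 0 (expR t) (expR_ge0 t).
  - move=> z; rewrite in_itv/= => /andP[z0 zt].
    have zin : `|z *: x| < rho.
      apply: le_lt_trans (erho tt); rewrite normrZ gtr0_norm//.
      by apply: (@le_trans _ _ (z * 1)); [rewrite ler_wpM2l// ltW|rewrite mulr1 ltW].
    have := @is_derive_line _ _ u 0 x (dot x (V (z *: x))) z.
    rewrite add0r => /(_ (dV x zin)).
    by under eq_fun do rewrite add0r.
  - apply: continuous_subspaceT => z.
    apply: (@continuous_comp _ _ _ (fun c : R => c *: x) u); last exact: cu.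
    exact: scalel_continuous.
  rewrite in_itv/= => /andP[c0 ct].
  rewrite scale0r u0 !subr0 => ->.
  rewrite normrM (ger0_norm (expR_ge0 _)) mulrC -mulrnAr ler_wpM2l ?expR_ge0//.
  have := @dot_le _ _ x (V (c *: x)) 1 (K * expR t); rewrite mul1r; apply=> i.
    exact: le_trans (coord_le_norm _ _) x1.
  apply: le_trans (coord_le_norm _ _) _; apply: le_trans (V_le _) _.
  rewrite ler_wpM2l// normrZ ger0_norm//.
  by apply: (@le_trans _ _ (c * 1)); [rewrite ler_wpM2l|rewrite mulr1].
apply: (@le_trans _ _ (expR (- 2 * t) * ((expR t * (K * expR t)) *+ n))).
  by rewrite ler_wpM2l ?expR_ge0.
have -> : expR (- 2 * t) = expR (- t) * expR (- t) by rewrite -expRD; congr expR; ring.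
rewrite mulrnAr.
have -> : expR (- t) * expR (- t) * (expR t * (K * expR t)) = K * ((expR (- t) * expR t) * (expR (- t) * expR t)) by ring.
by rewrite expRNM !mulr1.
Qed.

Lemma dil_generator_le s t x : s <= t0 -> t <= t0 -> `|s - t| <= 1 -> `|x| <= 1 ->
  `|dil_u s x - dil_u t x - (s - t) * generator (dil_u t) (dil_V t) x| <=
    ((2 * K * expR 1) *+ n + 6 * (K *+ n)) * (s - t) ^+ 2.
Proof.
move=> ss tt st1 x1; have Kn0 : 0 <= K *+ n by rewrite mulrn_wge0.
have rad (W : E -> E) (D : R) : `|W x| <= D -> `|radial W x| <= D *+ n.
  move=> WD; have := @dot_le _ _ x (W x) 1 D; rewrite mul1r; apply=> i.
    exact: le_trans (coord_le_norm _ _) x1.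
  exact: le_trans (coord_le_norm _ _) WD.
have gen3 c : c <= t0 -> `|generator (dil_u c) (dil_V c) x| <= 3 * (K *+ n).
  move=> ct; apply: le_trans (ler_normB _ _) _; rewrite normrM (ger0_norm (ler0n _ 2)).
  have := rad (dil_V c) K (dil_V_le ct x1); have := dil_u_le ct x1; lra.
have [c [ct c0] ->] := dil_mvt ss tt x1.
rewrite -mulrBr normrM -(real_normK (num_real (s - t))) expr2 mulrCA ler_wpM2l//.
have c1 : `|c - t| <= 1 by apply: le_trans st1.
have -> : generator (dil_u c) (dil_V c) x - generator (dil_u t) (dil_V t) x =
   radial (fun y => dil_V c y - dil_V t y) x - 2 * (dil_u c x - dil_u t x).
  by rewrite /generator /radial dotBr; ring.
apply: le_trans (ler_normB _ _) _; rewrite [X in _ <= X]mulrDl; apply: lerD.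
  rewrite (mulrnAl (2 * K * expR 1)); apply: le_trans (rad _ _ (dil_V_lip c0 tt c1 x1)) _.
  by rewrite ler_wMn2r// ler_wpM2l// !mulr_ge0// expR_ge0.
rewrite normrM (ger0_norm (ler0n _ 2)).
have [c' [c't c'0] ->] := dil_mvt c0 tt x1.
rewrite normrM mulrCA.
apply: (@le_trans _ _ (`|s - t| * (2 * (3 * (K *+ n))))); last by rewrite mulrC; apply: ler_wpM2r => //; lra.
by apply: ler_pM => //; rewrite ler_wpM2l// gen3.
Qed.

Let g D x : R := f x * Num.max 0 (2 - norm1 (V x) / D).

Let lf : loc f.
Proof.
by split; [exact: meas_noncritical|exists 1 => x _; rewrite /f; case: (_ != _); rewrite ?normr1 ?normr0].
Qed.

Let lg D : loc (g D).
Proof. by apply: locM => //; apply: loc_cont; exact: cont_ramp. Qed.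

(** The layers shrink to the empty set as D tends to 0. *)
Lemma layer_small e : 0 < e -> exists2 D, 0 < D & wInt (g D) <= e.
Proof.
move=> e0.
have cv : Int (fun x => p x * g (k.+1%:R^-1) x) @[k --> \oo] --> Int (fun x => p x * (0 : R)).
  apply: (@Int_cvg _ _ _ _ 2).
  - by move=> k; have [] := adm_bump (lg k.+1%:R^-1).
  - by have [] := adm_bump (@loc_cst R n 0).
  - move=> k x; split; last by move=> h; rewrite bump_out_norm ?mul0r//; apply: lt_trans h; rewrite ltr1n.
    have ram : 0 <= Num.max 0 (2 - norm1 (V x) / k.+1%:R^-1) <= 2.
      rewrite le_max lexx/= ge_max ler0n gerBl divr_ge0 ?norm1_ge0//.
    have /andP[r0 r2] := ram.
    rewrite /g normrM ger0_norm ?bump_ge0//.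
    apply: (@le_trans _ _ (1 * (1 * 2))); last by rewrite !mul1r.
    apply: ler_pM; rewrite ?bump_ge0 ?bump_le1//.
    rewrite normrM; apply: ler_pM => //; last by rewrite ger0_norm.
    by rewrite /f; case: (_ != _); rewrite ?normr1 ?normr0.
  - move=> x; apply: cvgM; first exact: cvg_cst.
    have [Vx|Vx] := eqVneq (V x) 0.
      rewrite (_ : (fun k => _) = fun=> 0); first exact: cvg_cst.
      by apply/funext => k; rewrite /g /f Vx eqxx mul0r.
    have n0 : 0 < norm1 (V x).
      by rewrite lt_neqAle norm1_ge0 andbT eq_sym; apply: contraNneq Vx => /norm1_eq0 ->.
    apply: cvg_near_cst; near=> k.
    rewrite /g max_l ?mulr0// invrK subr_le0 mulrC -ler_pdivrMr//.
    apply: le_trans (ltW (truncnS_gt _)) _; rewrite ler_nat ltnS.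
    by near: k; exact: nbhs_infty_ge.
have I00 : Int (fun x : E => p x * (0 : R)) = 0.
  by rewrite -[RHS](@Int0 R n); apply: eq_Int => x; rewrite mulr0.
rewrite I00 in cv.
have /cvgr0Pnorm_le /(_ e e0) [k _ /(_ k (leqnn _)) /= h] := cv.
exists k.+1%:R^-1; first by rewrite invr_gt0.
exact: le_trans (ler_norm _) h.
Unshelve. all: by end_near.
Qed.

Lemma bump_anti (c : R) x : 0 <= c -> c <= 1 -> p x <= p (c *: x).
Proof.
move=> c0 c1; rewrite /bump dotZl dotZr mulrA ge_max le_max lexx/= le_max lerB ?orbT//.
by rewrite ler_piMl ?dot_ge0// mulr_ile1.
Qed.

(** The layer at time s is contained in a dilate of the layer of V itself; the volume
    factor is bounded as long as s >= a. *)
Lemma dil_small a e : 0 < e -> exists2 D, 0 < D & forall s, a <= s -> s <= t0 ->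
  wInt (fun x => dil_f s x * Num.max 0 (2 - norm1 (dil_V s x) / D)) <= e.
Proof.
move=> e0; have en : 0 < e * expR a ^+ n by rewrite mulr_gt0// exprn_gt0// expR_gt0.
have [D D0 HD] := layer_small en; exists D => // s as_ st.
have c0 := expR_gt0 s; have c1 := e1 st.
have ag := adm_bump (lg D).
have g0 x : 0 <= g D x by rewrite mulr_ge0 ?le_max ?lexx// /f; case: (_ != _).
have aff := Int_aff 0 c0 ag.
have S := weak_solution_dil st.
apply: (@le_trans _ _ (Int (fun x => p (expR s *: x + 0) * g D (expR s *: x + 0)))).
  apply: Int_le.
  - apply: adm_bump; apply: locM; first exact: loc_f S.
    by apply: loc_cont; apply: cont_ramp => i; exact: ls_V S i.
  - have [mg [M hM]] := ag; split.
      exact: (@meas_aff _ _ (fun x => p x * g D x) (expR s) 0).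
    exists (M + (expR s)^-1 * M) => x; have M0 := bddsupp_ge0 hM; have [h1 h2] := hM (expR s *: x + 0); split.
      by apply: le_trans h1 _; rewrite lerDl mulr_ge0// invr_ge0 ltW.
    move=> h; apply: h2; rewrite addr0 normrZ (gtr0_norm c0) mulrC -ltr_pdivrMr// mulrC.
    by apply: le_lt_trans h; rewrite lerDr.
  - move=> x; rewrite addr0; apply: ler_pM; rewrite ?bump_ge0//.
    + by rewrite mulr_ge0 ?le_max ?lexx// /dil_f /f; case: (_ != _).
    + by apply: bump_anti => //; exact: ltW.
    + rewrite /g /dil_f; apply: ler_wpM2l; first by rewrite /f; case: (_ != _).
      rewrite ge_max le_max lexx/= le_max lerD2l lerN2 ler_wpM2r ?invr_ge0 ?(ltW D0) ?orbT//.
      apply: ler_sum => i _; rewrite mxE normrM ger0_norm ?expR_ge0//.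
      by rewrite ler_peMl// -expR0 ler_expR oppr_ge0 (le_trans st).
rewrite aff.
apply: (@le_trans _ _ (expR s ^- n * (e * expR a ^+ n))).
  by rewrite ler_wpM2l// invr_ge0 exprn_ge0// expR_ge0.
rewrite mulrC ler_pdivrMr ?exprn_gt0// ler_wpM2l ?(ltW e0)// lerXn2r ?nnegrE ?expR_ge0//.
by rewrite ler_expR.
Qed.

(** Passing from time t to t + ln 2 doubles the radius, and the weight (p^3/6)(x/2) is
    bounded below on the unit ball, where p(x/2) >= 3/4; 18 exceeds 6 (4/3)^3. *)
Lemma dil_doubling t : t + ln 2 <= t0 ->
  wInt (fun x => p x * (1 - dil_f t x)) <= 18 * 2 ^+ n * contact (dil_f (t + ln 2)).
Proof.
move=> tt2; have l2 : 0 < ln 2 :> R by rewrite ln_gt0// ltr1n.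
have tt : t <= t0 by lra.
pose h y := p (2^-1 *: y) * (p (2^-1 *: y) ^+ 2 / 6 * (1 - dil_f t y)).
have S := weak_solution_dil tt.
have f01 x : 0 <= 1 - dil_f t x by rewrite subr_ge0; have /andP[] := ls_f0 S x.
have l1 : loc (fun x => p x * (1 - dil_f t x)).
  by apply: locM; [exact: loc_bump|apply: locB; [exact: loc_cst|exact: loc_f S]].
have ah : adm h.
  have cp : continuous (fun y => p (2^-1 *: y)).
    by have := @cont_aff _ _ p 2^-1 0 (@cont_bump R n); under eq_fun do rewrite addr0.
  have mp := meas_continuous cp.
  split.
    apply: measM => //; apply: measM; last by apply: measB; [exact: meas_cst|exact: ls_f S].
    by apply: measM; [apply: measM|exact: meas_cst].
  exists 2 => x; split.
    have pb : 0 <= p (2^-1 *: x) <= 1 by rewrite bump_ge0 bump_le1.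
    have /andP[q0 q1] := pb.
    have /andP[f0 f1] := ls_f0 S x.
    rewrite ger0_norm; last by rewrite !mulr_ge0// ?divr_ge0 ?sqr_ge0.
    apply: (@le_trans _ _ (1 * (1 * 1))); last by rewrite !mulr1 ler1n.
    apply: ler_pM => //; first by rewrite !mulr_ge0.
    apply: ler_pM; rewrite ?mulr_ge0//; last by rewrite gerBl.
    rewrite ler_pdivrMr// mul1r (@le_trans _ _ 1) ?ler1n//.
    by rewrite expr2 mulr_ile1.
  move=> hx; rewrite /h bump_out_norm ?mul0r// normrZ ger0_norm ?invr_ge0//.
  by rewrite mulrC ltr_pdivlMr// mul1r.
have aff := Int_aff 0 (ltr0n R 2 : 0 < 2) ah.
have -> : contact (dil_f (t + ln 2)) = 2 ^- n * Int h.
  rewrite -aff; apply: eq_Int => x; rewrite addr0 /h scalerA mulVf// scale1r.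
  rewrite /dil_f expRD lnK ?posrE// -scalerA; ring.
rewrite -mulrA (mulrA (2 ^+ n)) divff ?mul1r ?expf_neq0//.
rewrite -IntZ//; apply: Int_le; first exact: adm_bump.
  exact: admZ.
move=> x; rewrite /h !mulrA; apply: ler_wpM2r => //.
have [hx|hx] := ltP (dot x x) 1; last first.
  by rewrite bump_out// mul0r !mulr_ge0// ?bump_ge0 ?sqr_ge0.
have pb : 3/4 <= p (2^-1 *: x).
  by rewrite /bump dotZl dotZr le_max; apply/orP; right; lra.
apply: (@le_trans _ _ 1); first by rewrite mulr_ile1 ?bump_ge0 ?bump_le1.
have p2 : (3/4) ^+ 2 <= p (2^-1 *: x) ^+ 2 by rewrite lerXn2r ?nnegrE ?bump_ge0// divr_ge0.
have p3 : (3/4) * (3/4) ^+ 2 <= p (2^-1 *: x) * p (2^-1 *: x) ^+ 2 by apply: ler_pM => //; rewrite ?divr_ge0 ?sqr_ge0.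
lra.
Qed.

Theorem dilation_family_exists (C' : R) : exists2 C, C' <= C & dilation_family t0 C (ln 2) dil_u dil_V dil_f.
Proof.
have k2 : 0 <= 2 * K * expR 1 by rewrite !mulr_ge0// expR_ge0.
have k3 : 0 <= (2 * K * expR 1) *+ n + 6 * (K *+ n) by rewrite addr_ge0 ?mulr_ge0 ?mulrn_wge0.
have k4 : 0 <= 18 * 2 ^+ n :> R by rewrite mulr_ge0// exprn_ge0.
have C'0 := normr_ge0 C'.
exists (`|C'| + K + 2 * K * expR 1 + ((2 * K * expR 1) *+ n + 6 * (K *+ n)) + 18 * 2 ^+ n).
  apply: le_trans (ler_norm C') _.
  by rewrite -!addrA lerDl !addr_ge0// ?mulrn_wge0// mulr_ge0// mulrn_wge0.
have [C CE] : exists C : R, C = `|C'| + K + 2 * K * expR 1 + ((2 * K * expR 1) *+ n + 6 * (K *+ n)) + 18 * 2 ^+ n by exists (`|C'| + K + 2 * K * expR 1 + ((2 * K * expR 1) *+ n + 6 * (K *+ n)) + 18 * 2 ^+ n).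
rewrite -CE.
have [c1 c2 c3 c4] : [/\ K <= C, 2 * K * expR 1 <= C, (2 * K * expR 1) *+ n + 6 * (K *+ n) <= C & 18 * 2 ^+ n <= C].
  rewrite CE; move: (2 * K * expR 1) (_ + 6 * _) (18 * _) k2 k3 k4 => a b c a0 b0 c0.
  by have K0' := K0; split; lra.
split.
- exact: le_trans c1.
- by rewrite ln_gt0// ltr1n.
- exact: weak_solution_dil.
- move=> t x i tt hx; apply: le_trans (coord_le_norm _ _) (le_trans _ c1).
  by apply: dil_V_le => //; exact: norm_lt1_of_dot.
- move=> s t x i ss tt st1 hx.
  have := coord_le_norm (dil_V s x - dil_V t x) i; rewrite !mxE => /le_trans; apply.
  apply: le_trans (dil_V_lip ss tt st1 (norm_lt1_of_dot hx)) _.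
  by rewrite ler_wpM2r.
- move=> s t x ss tt st1 hx; apply: le_trans (dil_generator_le ss tt st1 (norm_lt1_of_dot hx)) _.
  by rewrite ler_wpM2r ?sqr_ge0.
- move=> t x tt; rewrite /dil_f /f /dil_V; congr (_%:R : R); congr nat_of_bool.
  by rewrite scaler_eq0 gt_eqF ?expR_gt0.
- exact: dil_small.
- move=> t tt; apply: le_trans (dil_doubling tt) _; apply: ler_wpM2r => //.
  exact: contact_ge0 (weak_solution_dil tt).
Qed.

End Dilation.

(** * First-order expansion of the gradient at the origin *)

Section Differentiable.
Variables (R : realType) (n : nat).
Local Notation E := 'rV[R]_n.
Implicit Types (x y v : E).
Local Notation e_ i := (delta_mx 0 i : E).

Lemma dot_sq_le x : dot x x <= n%:R * `|x| ^+ 2.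
Proof.
have := dot_le (coord_le_norm x) (coord_le_norm x).
by rewrite ger0_norm ?dot_ge0// -mulr_natl.
Qed.

Lemma norm_sq_le_dot x : `|x| ^+ 2 <= dot x x.
Proof.
rewrite -[leRHS](sqr_sqrtr (dot_ge0 x)) lerXn2r ?nnegrE ?sqrtr_ge0//.
apply: norm_le_coord => // i; rewrite -sqrtr_sqr ler_wsqrtr//; exact: coord_sq_le.
Qed.

(** A Lipschitz function that exceeds e at a point exceeds e/2 on a ball whose radius c
    depends on K, e and n only. If the point has norm at most 1/(4 (n+1)), this ball
    lies where p >= 1/2, and it contributes a fixed amount to the mean square. *)
Lemma small_of_mean_square (K e : R) : 0 <= K -> 0 < e -> exists2 d : R, 0 < d & forall V W : E -> E,
  (forall i, loc (fun x => V x 0 i)) -> (forall i, loc (fun x => W x 0 i)) ->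
  (forall x y, `|(V x - W x) - (V y - W y)| <= K * `|x - y|) ->
  mean_square V W < d -> forall x, `|x| <= (4 * n.+1%:R)^-1 -> `|V x - W x| <= e.
Proof.
move=> K0 e0.
have n0 : (0 : R) < n.+1%:R by rewrite ltr0n.
have [c c0 [c1 c2]] : exists2 c : R, 0 < c & c <= (4 * n.+1%:R)^-1 /\ K * c <= e / 2.
  exists (Num.min (4 * n.+1%:R)^-1 (e / 2 / (K + 1))).
    by rewrite lt_min invr_gt0 mulr_gt0//= !divr_gt0// ltr_pwDr.
  rewrite ge_min lexx/=; split => //.
  apply: (@le_trans _ _ ((K + 1) * (e / 2 / (K + 1)))).
    by apply: ler_pM; rewrite ?ge_min ?lexx ?orbT ?lerDl// le_min invr_ge0 mulr_ge0 ?ltW// !divr_gt0// ltr_pwDr.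
  by rewrite mulrC divfK// gt_eqF// ltr_pwDr.
exists (e ^+ 2 / 16 * (2 * c) ^+ n); first by rewrite !mulr_gt0 ?exprn_gt0 ?mulr_gt0.
move=> V W lV lW DK hm x0 hx0; rewrite leNgt; apply/negP => eD; move: hm; apply/negP; rewrite -leNgt.
apply: (@Int_box_ge _ _ _ x0); first exact: ltW.
- by rewrite divr_ge0 ?sqr_ge0.
- by apply: adm_bump; apply: locM; [exact: loc_bump|apply: loc_dot => i; under eq_fun do rewrite !mxE; exact: locB].
- by move=> x; rewrite !mulr_ge0 ?bump_ge0 ?dot_ge0.
move=> x xx0.
have xn : `|x| <= (2 * n.+1%:R)^-1.
  rewrite -(subrK x0 x); apply: le_trans (ler_normD _ _) _; apply: le_trans (lerD (le_trans xx0 c1) hx0) _.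
  by rewrite !invfM; move: (n.+1%:R^-1 : R) => z; lra.
have b2 : 2^-1 <= bump x.
  rewrite /bump le_max; apply/orP; right.
  have xs : `|x| ^+ 2 <= (2 * n.+1%:R)^-1 ^+ 2 by rewrite lerXn2r// nnegrE// invr_ge0 mulr_ge0// ltW.
  have dx : dot x x <= 4^-1.
    apply: le_trans (dot_sq_le x) _; apply: (@le_trans _ _ (n.+1%:R * (2 * n.+1%:R)^-1 ^+ 2)).
      by apply: ler_pM => //; rewrite ?sqr_ge0// ler_nat.
    have -> : n.+1%:R * (2 * n.+1%:R)^-1 ^+ 2 = 4^-1 * n.+1%:R^-1 :> R by field; rewrite gt_eqF.
    by rewrite ler_piMr// invf_le1// ler1n.
  lra.
have D2 : (e / 2) ^+ 2 <= dot (V x - W x) (V x - W x).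
  apply: le_trans (norm_sq_le_dot _); rewrite lerXn2r ?nnegrE ?divr_ge0 ?(ltW e0)//.
  have := ler_normD (V x - W x) ((V x0 - W x0) - (V x - W x)).
  rewrite addrC subrK => h; have := DK x0 x; rewrite (distrC x0) => h2.
  have h3 : K * `|x - x0| <= K * c by rewrite ler_wpM2l.
  lra.
have -> : e ^+ 2 / 16 = 2^-1 * (2^-1 * (e / 2) ^+ 2) by field.
have D3 : 2^-1 * (e / 2) ^+ 2 <= bump x * dot (V x - W x) (V x - W x).
  by apply: ler_pM => //; rewrite ?invr_ge0 ?sqr_ge0.
by apply: ler_pM => //; rewrite ?invr_ge0// mulr_ge0 ?invr_ge0 ?sqr_ge0.
Qed.

Variables (K rho : R) (u : E -> R) (V : E -> E) (N : set E) (A : 'M[R]_n).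
Hypothesis K0 : 0 <= K.
Hypothesis rho0 : 0 < rho.
Hypothesis cu : continuous u.
Hypothesis u0 : u 0 = 0.
Hypothesis V0 : V 0 = 0.
Hypothesis VK : forall x y, `|V x - V y| <= K * `|x - y|.
Hypothesis dV : forall x v, `|x| < rho -> is_derive x v u (dot v (V x)).
Hypothesis nN : (lebn R n).-negligible (@row_of_tuple R n @^-1` N).
Hypothesis hN : forall x, `|x| < rho -> ~ N x -> exists2 l : 'I_n -> R,
     forall i, is_derive x (e_ i) (fun y => V y 0 i) (l i) & \sum_i l i = (V x != 0)%:R.
Hypothesis AT : A^T = A.
Hypothesis A1 : \tr A = 1.
Hypothesis blow : forall e M b : R, 0 < e -> 0 < b -> exists2 c, 0 < c <= b &
  forall y, `|y| <= M * c -> `|V y - y *m A| <= e * c.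

(** A point y is the dilate by e^t of a point of norm 1/(4 (n+1)), at which V_t is
    uniformly close to x A. The factor e^t is proportional to |y|. *)
Theorem gradient_expansion (e : R) : 0 < e ->
  exists2 d, 0 < d & forall y, `|y| <= d -> `|V y - y *m A| <= e * `|y|.
Proof.
move=> e0; have n0 : (0 : R) < 4 * n.+1%:R by rewrite mulr_gt0.
have [KA KA0 HA] := mulmx_lip A.
have [t0 t0le t0rho] : exists2 t0 : R, t0 <= 0 & expR t0 < rho.
  exists (Num.min 0 (ln (rho / 2))); first by rewrite ge_min lexx.
  apply: (@le_lt_trans _ _ (expR (ln (rho / 2)))); first by rewrite ler_expR ge_min lexx orbT.
  by rewrite lnK ?posrE ?divr_gt0// ltr_pdivrMr// ltr_pMr// ltr1n.
have [C CC F] := dilation_family_exists K0 cu u0 V0 VK dV nN hN t0rho t0le KA.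
have [K1 _ [L HL]] := primitive_exists F.
have e1 : 0 < e / (4 * n.+1%:R) by rewrite divr_gt0.
have WC x : dot x x < 1 -> forall i, `|(x *m A) 0 i| <= C.
  move=> /norm_lt1_of_dot x1 i; apply: le_trans (coord_le_norm _ _) _.
  by apply: le_trans (HA _) _; apply: le_trans CC; rewrite ler_piMr.
have bl (s e' b : R) : 0 < e' -> exists2 T : R, T <= b & forall t, `|t - T| <= s -> t <= t0 ->
    forall x i, dot x x < 1 -> `|dil_V V t x 0 i - (x *m A) 0 i| <= e'.
  move=> e'0; have [c /andP[c0 cb] Hc] := blow (expR s) (mulr_gt0 e'0 (expR_gt0 (- s))) (expR_gt0 b).
  exists (ln c); first by rewrite -ler_expR lnK.
  move=> t; rewrite ler_norml => /andP[ts1 ts2] _ x i /norm_lt1_of_dot x1.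
  have := coord_le_norm (dil_V V t x - x *m A) i; rewrite !mxE => /le_trans; apply.
  have ec : expR t <= expR s * c by rewrite -[X in _ * X](lnK c0) -expRD ler_expR; lra.
  have -> : dil_V V t x - x *m A = expR (- t) *: (V (expR t *: x) - (expR t *: x) *m A).
    by rewrite scalerBr -scalemxAl scalerA -expRD addNr expR0 scale1r.
  rewrite normrZ ger0_norm ?expR_ge0//.
  apply: (@le_trans _ _ (expR (- t) * (e' * expR (- s) * c))).
    rewrite ler_wpM2l ?expR_ge0//; apply: Hc; rewrite normrZ ger0_norm ?expR_ge0//.
    by apply: le_trans ec; rewrite ler_piMr ?expR_ge0.
  rewrite -[leRHS]mulr1 mulrC -!mulrA ler_wpM2l ?(ltW e'0)//.
  by rewrite -[X in _ * (X * _)](lnK c0) -!expRD -expR0 ler_expR; lra.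
have lV t : t <= t0 -> forall i, loc (fun x => dil_V V t x 0 i).
  by move=> tt i; apply: loc_cont; exact: ls_V (fam_sol F tt) i.
have lA i : loc (fun x : E => (x *m A) 0 i) by apply: loc_cont; exact: cont_mulmx.
have K20 : 0 <= K + KA by rewrite addr_ge0.
have DK t x y : `|(dil_V V t x - x *m A) - (dil_V V t y - y *m A)| <= (K + KA) * `|x - y|.
  have -> : (dil_V V t x - x *m A) - (dil_V V t y - y *m A) = (dil_V V t x - dil_V V t y) - (x - y) *m A.
    rewrite mulmxBl; move: (x *m A) (y *m A) (dil_V V t x) (dil_V V t y) => a b c d.
    by apply/rowP => i; rewrite !mxE; ring.
  apply: le_trans (ler_normB _ _) _; rewrite mulrDl; apply: lerD => //.
  rewrite /dil_V -scalerBr normrZ ger0_norm ?expR_ge0//.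
  apply: (@le_trans _ _ (expR (- t) * (K * `|expR t *: x - expR t *: y|))).
    by rewrite ler_wpM2l ?expR_ge0.
  rewrite -scalerBr normrZ ger0_norm ?expR_ge0// mulrCA (mulrA (expR _)) -expRD addNr expR0 mul1r//.
have [T TT HT] : exists2 T, T <= t0 & forall t, t <= T -> forall x, `|x| <= (4 * n.+1%:R)^-1 ->
    `|dil_V V t x - x *m A| <= e / (4 * n.+1%:R).
  have [d d0 Hd] := small_of_mean_square K20 e1.
  have d20 : 0 < d / 2 by rewrite divr_gt0.
  have [T TT HT] := mean_square_cvg0 F HL (weak_solution_quad AT A1) (fun x _ => generator_quad A x) WC bl d20.
  exists T => // t tT; apply: Hd => //; first exact/lV/(le_trans tT).
  apply: le_lt_trans (HT t tT) _; lra.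
exists (expR T / (4 * n.+1%:R)); first by rewrite divr_gt0 ?expR_gt0.
move=> y yd; have [->|y0] := eqVneq y 0; first by rewrite V0 mul0mx subrr normr0 mulr0.
have y1 : 0 < 4 * n.+1%:R * `|y| by rewrite mulr_gt0 ?normr_gt0.
pose t := ln (4 * n.+1%:R * `|y|).
have tT : t <= T by rewrite -ler_expR lnK// mulrC -ler_pdivlMr.
have := HT t tT (expR (- t) *: y).
rewrite /dil_V scalerA -expRD subrr expR0 scale1r -scalemxAl -scalerBr !normrZ ger0_norm ?expR_ge0//.
rewrite expRN lnK// invfM -mulrA mulVf ?normr_eq0// mulr1 => /(_ (lexx _)).
rewrite -invfM mulrC ler_pdivrMr// => h.
by apply: le_trans h _; rewrite mulrA divfK// gt_eqF.
Qed.
End Differentiable.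

(** * The norm of C^(1,alpha) *)

Section HolderNorm.
Variables (R : realType) (n : nat).
Local Notation E := 'rV[R]_n.
Implicit Types (x y v : E) (f : E -> R) (G : E -> E).
Local Notation e_ i := (delta_mx 0 i : E).

Lemma enormE x : enorm x = Num.sqrt (dot x x).
Proof. by []. Qed.

Lemma enorm_ge0 x : 0 <= enorm x.
Proof. exact: sqrtr_ge0. Qed.

Lemma norm_le_enorm x : `|x| <= enorm x.
Proof. by rewrite -[leLHS]ger0_norm// -sqrtr_sqr ler_wsqrtr// norm_sq_le_dot. Qed.

Lemma enorm_le x : enorm x <= n%:R * `|x|.
Proof.
rewrite -[leRHS]ger0_norm ?mulr_ge0// -sqrtr_sqr ler_wsqrtr//.
apply: le_trans (dot_sq_le x) _; rewrite exprMn ler_wpM2r ?sqr_ge0// -natrX ler_nat.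
by case: (n) => // m; rewrite -[X in (X <= _)%N]expn1 leq_pexp2l.
Qed.

Lemma enormZ (c : R) x : 0 <= c -> enorm (c *: x) = c * enorm x.
Proof.
by move=> c0; rewrite !enormE dotZl dotZr mulrA sqrtrM ?mulr_ge0// -expr2 sqrtr_sqr ger0_norm.
Qed.

Lemma enorm_gt0 x : x != 0 -> 0 < enorm x.
Proof. by move=> x0; apply: lt_le_trans (norm_le_enorm x); rewrite normr_gt0. Qed.

Lemma eball_segment (rho t : R) x : 0 <= t <= 1 -> eball rho x -> eball rho (t *: x).
Proof.
move=> /andP[t0 t1]; rewrite /eball/= enormZ// => h; apply: le_lt_trans h.
by rewrite ler_piMl ?enorm_ge0.
Qed.

Lemma eball_norm (rho : R) x : eball rho x -> `|x| < rho.
Proof. exact: le_lt_trans (norm_le_enorm x). Qed.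

Lemma grad_unique f G x : (forall v, is_derive x v f (dot v (G x))) -> grad f x = G x.
Proof.
move=> h; apply/rowP => i; rewrite mxE /partial; have d := h (e_ i).
by rewrite derive_val dotC dot_delta.
Qed.

Lemma is_derive_grad f x v : differentiable f x -> is_derive x v f (dot v (grad f x)).
Proof.
move=> df; apply: DeriveDef; first exact: diff_derivable.
rewrite deriveE// {1}(row_sum_delta v) linear_sum; apply: eq_bigr => i _.
by rewrite linearZ/= mxE /partial deriveE.
Qed.

Lemma powR_split (d a : R) : 0 < d -> d = d `^ (1 - a) * d `^ a.
Proof.
move=> d0; have := @powRD _ d (1 - a) a.
by rewrite subrK (gt_eqF d0) implybT powRr1 ?(ltW d0)// => /(_ isT).
Qed.

(** Interpolation: for points at distance at most e the Lipschitz bound of the gradient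
    is used, for the others its uniform bound e. In both cases the quotient is of
    order e^(1 - alpha). *)
Lemma C1a_norm_le (alpha rho e K : R) f G : 0 < alpha < 1 -> 0 < rho -> 0 <= K -> 0 < e ->
  f 0 = 0 -> (forall x v, eball rho x -> is_derive x v f (dot v (G x))) ->
  (forall x, eball rho x -> `|G x| <= e) ->
  (forall x y, eball rho x -> eball rho y -> `|G x - G y| <= K * `|x - y|) ->
  (C1a_norm alpha rho f <=
   (n%:R * (rho * e) + n%:R * e + n%:R * (K + 2) * e `^ (1 - alpha))%:E)%E.
Proof.
move=> /andP[a0 a1] r0 K0 e0 f0 dG Ge GK.
have gG x : eball rho x -> grad f x = G x by move=> hx; apply: grad_unique => v; exact: dG.
rewrite !EFinD; apply: leeD; first apply: leeD.
- apply/ereal_supP => _ [x hx <-]; rewrite lee_fin.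
  have := @mvt_le R n f 0 x (fun y => dot x (G y)) 0 1 (rho * e *+ n) ler01.
  rewrite scale1r scale0r !add0r f0 !subr0 mulr1 -mulr_natl; apply.
    by move=> t t01; rewrite add0r; apply: dG; exact: eball_segment.
  move=> t t01; rewrite add0r mulr_natl; apply: dot_le => i; apply: le_trans (coord_le_norm _ _) _.
    exact/ltW/eball_norm.
  exact/Ge/eball_segment.
- apply/ereal_supP => _ [x hx <-]; rewrite lee_fin gG//.
  by apply: le_trans (enorm_le _) _; rewrite ler_wpM2l// Ge.
apply/ereal_supP => _ [[x y] /= [hx hy xy] <-]; rewrite lee_fin !gG//.
have d0 : 0 < enorm (x - y) by rewrite enorm_gt0// subr_eq0.
rewrite ler_pdivrMr ?powR_gt0//; apply: le_trans (enorm_le _) _.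
rewrite -!mulrA ler_wpM2l//.
have e1 := powR_ge0 e (1 - alpha); have d1 := powR_ge0 (enorm (x - y)) alpha.
have [de|ed] := leP (enorm (x - y)) e.
  apply: le_trans (GK _ _ hx hy) _; apply: (@le_trans _ _ (K * enorm (x - y))).
    by rewrite ler_wpM2l// norm_le_enorm.
  rewrite {1}(powR_split alpha d0); apply: ler_pM => //; first by rewrite mulr_ge0 ?powR_ge0.
    by rewrite lerDl.
  by rewrite ler_wpM2r// ge0_ler_powR ?nnegrE ?subr_ge0 ?(ltW a1) ?(ltW d0) ?(ltW e0).
apply: (@le_trans _ _ (2 * e)).
  by apply: le_trans (ler_normB _ _) _; have := Ge _ hx; have := Ge _ hy; lra.
rewrite {1}(powR_split alpha e0); apply: ler_pM => //; first by rewrite mulr_ge0 ?powR_ge0.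
  by rewrite lerDr.
by rewrite ler_wpM2l// ge0_ler_powR ?nnegrE ?(ltW a0) ?(ltW d0) ?(ltW e0)// ltW.
Qed.

(** The supremum of an empty set is -oo. For n > 0 every ball contains two points, so
    that all three terms of the norm are nonnegative. *)
Section Nontrivial.
Hypothesis n0 : (0 < n)%N.
Variables (alpha rho : R) (f : E -> R).
Hypothesis rho0 : 0 < rho.

Let eball0 : eball rho (0 : E).
Proof. by rewrite /eball/= enormE dot0l sqrtr0. Qed.

Let sup1_ge0 : (0 <= ereal_sup [set `|f x|%:E | x in eball rho])%E.
Proof. by apply: le_ereal_sup_tmp; exists `|f 0|%:E; [exists 0|rewrite lee_fin]. Qed.

Let sup2_ge0 : (0 <= ereal_sup [set (enorm (grad f x))%:E | x in eball rho])%E.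
Proof.
by apply: le_ereal_sup_tmp; exists (enorm (grad f 0))%:E; [exists 0|rewrite lee_fin enorm_ge0].
Qed.

Let sup3_ge0 : (0 <= ereal_sup [set (enorm (grad f z.1 - grad f z.2) /
                   enorm (z.1 - z.2) `^ alpha)%:E
             | z in [set z : E * E | [/\ eball rho z.1, eball rho z.2 & z.1 != z.2]]])%E.
Proof.
pose x : E := rho / 2 *: e_ (Ordinal n0).
have x0 : x != 0.
  rewrite scaler_eq0 negb_or mulf_neq0 ?gt_eqF ?invr_gt0//=.
  by apply/eqP => /rowP/(_ (Ordinal n0)); rewrite !mxE !eqxx; exact/eqP/oner_neq0.
have hx : eball rho x.
  rewrite /eball/= enormZ ?divr_ge0 ?(ltW rho0)//.
  rewrite enormE dot_delta mxE !eqxx sqrtr1 mulr1; have := rho0; lra.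
apply: le_ereal_sup_tmp; eexists; first by exists (x, 0).
by rewrite lee_fin/= divr_ge0 ?enorm_ge0 ?powR_ge0.
Qed.

Lemma C1a_norm_ge0 : (0 <= C1a_norm alpha rho f)%E.
Proof. by rewrite /C1a_norm !adde_ge0. Qed.

Lemma val_le_C1a_norm x : eball rho x -> (`|f x|%:E <= C1a_norm alpha rho f)%E.
Proof.
move=> hx; rewrite /C1a_norm -addeA.
apply: le_trans (_ : ereal_sup [set `|f x|%:E | x in eball rho] <= _)%E.
  by apply: ereal_sup_ubound; exists x.
by rewrite leeDl// adde_ge0.
Qed.

Lemma grad_le_C1a_norm x : eball rho x -> ((enorm (grad f x))%:E <= C1a_norm alpha rho f)%E.
Proof.
move=> hx; rewrite /C1a_norm.
apply: le_trans (_ : ereal_sup [set (enorm (grad f x))%:E | x in eball rho] <= _)%E.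
  by apply: ereal_sup_ubound; exists x.
by rewrite -addeA addeCA leeDl// adde_ge0.
Qed.
End Nontrivial.
End HolderNorm.

(** * Convergence of the rescalings *)

Section Convergence.
Variables (R : realType) (n : nat).
Hypothesis n0 : (0 < n)%N.
Local Notation E := 'rV[R]_n.
Implicit Types (x y v : E).

Lemma C1a_norm_cvg0 (alpha rho : R) (T : Type) (F : set_system T) (g : T -> E -> R) : Filter F -> 0 < rho ->
  (forall e : R, 0 < e -> \forall t \near F, (C1a_norm alpha rho (g t) <= e%:E)%E) ->
  C1a_norm alpha rho (g t) @[t --> F] --> 0%E.
Proof.
move=> FF rho0 h; have ge0 t := C1a_norm_ge0 n0 alpha (g t) rho0.
have fin t (e : R) : (C1a_norm alpha rho (g t) <= e%:E)%E -> C1a_norm alpha rho (g t) \is a fin_num.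
  by move=> le; rewrite ge0_fin_numE//; apply: le_lt_trans le (ltry _).
apply/fine_cvgP; split.
  by apply: filterS (h 1 ltr01) => t; exact: fin.
apply/cvgr0Pnorm_le => e e0; near=> t.
have le : (C1a_norm alpha rho (g t) <= e%:E)%E by near: t; exact: h.
by rewrite ger0_norm/= ?fine_ge0// -lee_fin fineK// (fin t e).
Unshelve. all: by end_near.
Qed.

Lemma cvg_C1a_pointwise (alpha : R) (T : Type) (F : set_system T) (f : T -> E -> R) g x : Filter F ->
  cvg_C1a_loc alpha F f g -> f t x @[t --> F] --> g x.
Proof.
move=> FF h; have r0 : 0 < enorm x + 1 by rewrite ltr_wpDl ?enorm_ge0.
have [_ _ cv] := h _ r0; have hx : eball (enorm x + 1) x by rewrite /eball/= ltrDl.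
apply/cvgrPdist_le => e e0.
have /fine_cvgP[fin /cvgr0Pnorm_le /(_ e e0) le] := cv.
near=> t.
have ft : C1a_norm alpha (enorm x + 1) (fun y => f t y - g y) \is a fin_num by near: t.
have lt : `|(fine \o (fun t => C1a_norm alpha (enorm x + 1) (fun y => f t y - g y))) t| <= e by near: t.
rewrite distrC; apply: le_trans (le_trans (ler_norm _) lt).
by rewrite -lee_fin/= fineK//; exact: (@val_le_C1a_norm _ _ n0 alpha _ (fun y => f t y - g y)).
Unshelve. all: by end_near.
Qed.

Variables (K rho : R) (u : E -> R) (A : 'M[R]_n).
Hypothesis K0 : 0 <= K.
Hypothesis rho0 : 0 < rho.
Hypothesis du : forall x, `|x| < rho -> differentiable u x.
Hypothesis uK : forall x y, `|x| < rho -> `|y| < rho -> `|grad u x - grad u y| <= K * `|x - y|.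
Hypothesis AT : A^T = A.
Hypothesis gradu : forall e : R, 0 < e -> exists2 d, 0 < d &
  forall y, `|y| <= d -> `|grad u y - y *m A| <= e * `|y|.

Let f (r : R) x : R := (u (r *: x) - u 0) / r ^+ 2.

Lemma is_derive_rescale (r : R) x v : 0 < r -> `|r *: x| < rho ->
  is_derive x v (f r) (dot v (r^-1 *: grad u (r *: x))).
Proof.
move=> r0 rx; have h := is_derive_dil (is_derive_grad v (du rx)).
rewrite dotZr.
have h1 : is_derive x v (fun y => u (r *: y) - u 0) (r * dot v (grad u (r *: x))).
  rewrite -[X in is_derive _ _ _ X]subr0.
  by apply: (is_deriveB h); exact: is_derive_cst.
have h2 := is_deriveZ (r ^- 2) h1.
have -> : f r = r ^- 2 \*: (fun y => u (r *: y) - u 0) by apply/funext => y; rewrite /f mulrC.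
apply: is_derive_eq; rewrite /GRing.scale/= mulrA; congr (_ * _).
by field; rewrite gt_eqF.
Qed.

Lemma differentiable_rescale (r : R) x : 0 < r -> `|r *: x| < rho -> differentiable (f r) x.
Proof.
move=> r0 rx.
have -> : f r = (fun y => (r ^+ 2)^-1 *: (u (r *: y) - u 0)).
  by apply/funext => y; rewrite /f mulrC.
apply: differentiableZ; apply: differentiableB => //.
apply: (@differentiable_comp _ _ _ _ (fun y : E => r *: y) u) => //.
exact: du.
Qed.

Lemma differentiable_bigsum (T : Type) (s : seq T) (F : T -> E -> R) x :
  (forall j, differentiable (F j) x) -> differentiable (fun y => \sum_(j <- s) F j y) x.
Proof.
move=> dF; elim: s => [|j s IH].
  by under eq_fun do rewrite big_nil; exact: differentiable_cst.
by under eq_fun do rewrite big_cons; exact: differentiableD.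
Qed.

Lemma differentiable_quad x : differentiable (quad A) x.
Proof.
rewrite (_ : quad A = fun x => 2^-1 *: \sum_j (\sum_i x 0 i * A i j) * x 0 j); last first.
  by apply/funext => y; rewrite quadE; congr (_ * _); apply: eq_bigr => j _; rewrite mxE.
apply: differentiableZ; apply: differentiable_bigsum => j; apply: differentiableM; last exact: differentiable_coord.
by apply: differentiable_bigsum => i; apply: differentiableM => //; exact: differentiable_coord.
Qed.

Lemma small_modulus (s B e alpha : R) : 0 < alpha < 1 -> 0 <= s -> 0 <= B -> 0 < e ->
  exists2 d : R, 0 < d & n%:R * (s * d) + n%:R * d + n%:R * B * d `^ (1 - alpha) <= e.
Proof.
move=> /andP[a0 a1] s0 B0 e0; have b0 : 0 < 1 - alpha by rewrite subr_gt0.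
have [M ME] : exists M : R, M = n%:R * s + n%:R + n%:R * B + 1 by eexists.
have M0 : 0 < M by rewrite ME ltr_wpDl ?addr_ge0 ?mulr_ge0.
have eM : 0 < e / M by rewrite divr_gt0.
pose d := Num.min 1 ((e / M) `^ (1 - alpha)^-1).
have d0 : 0 < d by rewrite lt_min ltr01 powR_gt0.
have d1 : d <= 1 by rewrite ge_min lexx.
exists d => //; move: (powR_split alpha d0) d1 => dE d1.
have p0 := powR_ge0 d (1 - alpha).
have dd : d <= d `^ (1 - alpha).
  rewrite {1}dE ler_piMr//; have <- : (1 : R) `^ alpha = 1 by rewrite powR1.
  by rewrite ge0_ler_powR ?nnegrE ?(ltW a0) ?(ltW d0)// ler01.
have de : d `^ (1 - alpha) <= e / M.
  have -> : e / M = ((e / M) `^ (1 - alpha)^-1) `^ (1 - alpha).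
    by rewrite -powRrM mulVf ?gt_eqF// powRr1// ltW.
  by rewrite ge0_ler_powR ?nnegrE ?powR_ge0 ?(ltW b0) ?(ltW d0)// ge_min lexx orbT.
apply: (@le_trans _ _ (M * d `^ (1 - alpha))); last first.
  by rewrite mulrC -ler_pdivlMr.
have h1 : n%:R * (s * d) <= n%:R * s * d `^ (1 - alpha) by rewrite mulrA ler_wpM2l// mulr_ge0.
have h2 : n%:R * d <= n%:R * d `^ (1 - alpha) by rewrite ler_wpM2l.
rewrite ME !mulrDl mul1r; apply: ler_wpDr => //; apply: lerD => //; exact: lerD.
Qed.

Let grad0 : grad u 0 = 0.
Proof.
have [d d0 /(_ 0)] := gradu ltr01.
by rewrite normr0 mulr0 mul0mx subr0 normr_le0 => /(_ (ltW d0)) /eqP.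
Qed.

(** The gradient of the difference at x is r^(-1) (grad u(r x) - (r x) A), small by the
    expansion and uniformly Lipschitz, so [C1a_norm_le] applies. *)
Theorem cvg_rescale (alpha : R) : 0 < alpha < 1 -> cvg_C1a_loc alpha 0^'+ f (quad A).
Proof.
move=> a01 s s0; have [KA KA0 HA] := mulmx_lip A.
have f0 r : f r 0 = 0 by rewrite /f scaler0 subrr mul0r.
have q0 : quad A 0 = 0 by rewrite quadE mul0mx dot0l mulr0.
have rs (r : R) x : 0 < r -> r < rho / s -> eball s x -> `|r *: x| < rho.
  move=> r0 rr /eball_norm xs; rewrite normrZ gtr0_norm//.
  apply: (@lt_trans _ _ (r * s)); first by rewrite ltr_pM2l.
  by rewrite -ltr_pdivlMr.
have dq x v : is_derive x v (quad A) (dot v (x *m A)) by exact: is_derive_quad.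
have GK (r : R) x y : 0 < r -> r < rho / s -> eball s x -> eball s y ->
    `|r^-1 *: grad u (r *: x) - r^-1 *: grad u (r *: y)| <= K * `|x - y|.
  move=> r0 rr hx hy; rewrite -scalerBr normrZ gtr0_norm ?invr_gt0//.
  rewrite mulrC ler_pdivrMr//; apply: le_trans (uK (rs _ _ r0 rr hx) (rs _ _ r0 rr hy)) _.
  by rewrite -scalerBr normrZ gtr0_norm// mulrCA mulrC.
have eball0 : eball s (0 : E) by rewrite /eball/= enormE dot0l sqrtr0.
have rs0 : 0 < rho / s by rewrite divr_gt0.
split.
- near=> r.
  have r0 : 0 < r by near: r; exact: nbhs_right_gt.
  have rr : r < rho / s by near: r; exact: nbhs_right_lt.
  split; first by move=> x hx; apply: differentiable_rescale => //; exact: rs.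
  have e0 : 0 < K * s + 1 by rewrite ltr_wpDl// mulr_ge0// ltW.
  apply: le_lt_trans (ltry _); apply: (@C1a_norm_le R n alpha s (K * s + 1) K (f r) (fun x => r^-1 *: grad u (r *: x))) => //.
  + by move=> x v hx; apply: is_derive_rescale => //; exact: rs.
  + move=> x hx; have := GK r x 0 r0 rr hx eball0.
    rewrite scaler0 grad0 scaler0 !subr0 => /le_trans; apply.
    by apply: le_trans (_ : K * s <= _); rewrite ?lerDl// ler_wpM2l// ltW// eball_norm.
  + by move=> x y hx hy; exact: GK.
- split; first by move=> x _; exact: differentiable_quad.
  have e0 : 0 < KA * s + 1 by rewrite ltr_wpDl// mulr_ge0// ltW.
  apply: le_lt_trans (ltry _); apply: (@C1a_norm_le R n alpha s (KA * s + 1) KA (quad A) (fun x => x *m A)) => //.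
  + move=> x hx; apply: le_trans (HA _) _.
    by apply: le_trans (_ : KA * s <= _); rewrite ?lerDl// ler_wpM2l// ltW// eball_norm.
  + by move=> x y _ _; rewrite -mulmxBl.
apply: C1a_norm_cvg0 => // e e0.
have B0 : 0 <= K + KA + 2 by rewrite !addr_ge0.
have [d d0 Hd] := small_modulus a01 (ltW s0) B0 e0.
have ds : 0 < d / s by rewrite divr_gt0.
have [c c0 Hc] := gradu ds.
have cs : 0 < c / s by rewrite divr_gt0.
near=> r.
have r0 : 0 < r by near: r; exact: nbhs_right_gt.
have rr : r < rho / s by near: r; exact: nbhs_right_lt.
have rc : r < c / s by near: r; exact: nbhs_right_lt.
apply: le_trans (_ : (n%:R * (s * d) + n%:R * d + n%:R * (K + KA + 2) * d `^ (1 - alpha))%:E <= _)%E; last by rewrite lee_fin.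
apply: (@C1a_norm_le R n alpha s d (K + KA) _ (fun x => r^-1 *: grad u (r *: x) - x *m A)) => //.
- exact: addr_ge0.
- by rewrite f0 q0 subr0.
- move=> x v hx; rewrite dotBr; apply: (is_deriveB (is_derive_rescale v r0 (rs _ _ r0 rr hx))).
- move=> x hx.
  have -> : r^-1 *: grad u (r *: x) - x *m A = r^-1 *: (grad u (r *: x) - (r *: x) *m A).
    by rewrite scalerBr -scalemxAl scalerA mulVf ?gt_eqF// scale1r.
  have rx : `|r *: x| <= c.
    rewrite normrZ gtr0_norm//; apply: (@le_trans _ _ (r * s)); first by rewrite ler_pM2l// ltW// eball_norm.
    by rewrite -ler_pdivlMr// ltW.
  rewrite normrZ gtr0_norm ?invr_gt0// mulrC ler_pdivrMr//; apply: le_trans (Hc _ rx) _.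
  rewrite normrZ gtr0_norm// mulrCA mulrC ler_wpM2r ?(ltW r0)//.
  rewrite mulrAC ler_pdivrMr// ler_wpM2l ?(ltW d0)// ltW// eball_norm//.
- move=> x y hx hy.
  have -> : (r^-1 *: grad u (r *: x) - x *m A) - (r^-1 *: grad u (r *: y) - y *m A) =
      (r^-1 *: grad u (r *: x) - r^-1 *: grad u (r *: y)) - (x - y) *m A.
    rewrite mulmxBl; move: (x *m A) (y *m A) (r^-1 *: grad u (r *: x)) (r^-1 *: grad u (r *: y)) => a b c' d'.
    by apply/rowP => i; rewrite !mxE; ring.
  by apply: le_trans (ler_normB _ _) _; rewrite mulrDl; apply: lerD => //; exact: GK.
Unshelve. all: by end_near.
Qed.

End Convergence.

(** * From a solution in U to globally defined data *)

Section Localization.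
Variables (R : realType) (n : nat).
Local Notation E := 'rV[R]_n.
Implicit Types (x y v : E).
Local Notation e_ i := (delta_mx 0 i : E).

(** The nearest-point map onto a cube. It makes u and grad u global without
    changing them near the origin, and preserves Lipschitz constants. *)
Definition clamp (r : R) x : E := \row_i Num.max (- r) (Num.min r (x 0 i)).

Lemma clamp_lip (r : R) x y : `|clamp r x - clamp r y| <= `|x - y|.
Proof.
apply: norm_le_coord => // i; rewrite !mxE.
apply: (@le_trans _ _ `|x 0 i - y 0 i|); last by have := coord_le_norm (x - y) i; rewrite !mxE.
move: (x 0 i) (y 0 i) => a b.
have n1 (g h : R) : (g - h <= `|g - h|) * (h - g <= `|g - h|).
  by split; [|rewrite distrC]; exact: ler_norm.
have Hmin (g h : R) : `|Num.min r g - Num.min r h| <= `|g - h|.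
  have [h1 h2] := n1 g h; have h0 := normr_ge0 (g - h).
  by rewrite ler_norml; case: (leP r g) => ?; case: (leP r h) => ?; apply/andP; split; lra.
have Hmax (g h : R) : `|Num.max (- r) g - Num.max (- r) h| <= `|g - h|.
  have [h1 h2] := n1 g h; have h0 := normr_ge0 (g - h).
  by rewrite ler_norml; case: (leP (- r) g) => ?; case: (leP (- r) h) => ?; apply/andP; split; lra.
exact: le_trans (Hmax _ _) (Hmin _ _).
Qed.

Lemma clamp_id (r : R) x : `|x| <= r -> clamp r x = x.
Proof.
move=> xr; apply/rowP => i; rewrite mxE.
have := le_trans (coord_le_norm x i) xr; rewrite ler_norml => /andP[h1 h2].
by rewrite min_r// max_r.
Qed.

Lemma clamp_norm (r : R) x : 0 <= r -> `|clamp r x| <= r.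
Proof.
move=> r0; apply: norm_le_coord => // i; rewrite mxE ler_norml.
by rewrite le_max lexx/= ge_max ge_min lexx andbT; lra.
Qed.

Lemma cont_clamp (r : R) : continuous (clamp r).
Proof.
move=> x B /nbhs_ballP[e /= e0 eB]; apply/nbhs_ballP; exists e => // y.
rewrite -ball_normE/= => xy; apply: eB; rewrite -ball_normE/=.
exact: le_lt_trans (clamp_lip _ _ _) xy.
Qed.

Lemma C11_ball (U : set E) (u : E -> R) : U 0 -> C11_loc U u -> exists K rho : R,
  [/\ 0 <= K, 0 < rho, forall x, `|x| < rho -> U x &
      forall x y, `|x| < rho -> `|y| < rho -> `|grad u x - grad u y| <= K * `|x - y| ].
Proof.
move=> U0 [_ /(_ _ U0) [W [/nbhs_ballP[rho /= rho0 W1] W2] /= LW]].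
have WB x : `|x| < rho -> W x.
  by move=> xr; apply: W1; rewrite -ball_normE/= sub0r normrN.
have [K [_ HK]] := LW.
exists (`|K| + 1), rho; split => //; first by move=> x /WB /W2.
move=> x y xr yr; have := HK (`|K| + 1) _ (x, y); apply; last by split; exact: WB.
by rewrite (le_lt_trans (ler_norm K))// ltrDl.
Qed.

(** The origin is a critical point: otherwise grad u would be non-zero in a
    neighbourhood, and the origin would not be on the free boundary. The C^(1,alpha)
    convergence along the sequence, with alpha = 1/2, is used for gradients only. *)
Theorem singular_expansion (U : set E) (u : E -> R) : (0 < n)%N -> U 0 -> solution U u ->
  singular_point U u 0 -> exists2 A : 'M[R]_n, A^T = A /\ \tr A = 1 & exists K rho : R,
  [/\ 0 <= K, 0 < rho, forall x, `|x| < rho -> differentiable u x,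
      forall x y, `|x| < rho -> `|y| < rho -> `|grad u x - grad u y| <= K * `|x - y| &
      forall e : R, 0 < e -> exists2 d, 0 < d &
        forall y, `|y| <= d -> `|grad u y - y *m A| <= e * `|y| ].
Proof.
move=> n0 U0 [Cu eqn] [[_ [_ nint]] [r [_ [[r0 rcv] [A [AT A1] ->] cv]]]].
have [K [rho [K0 rho0 rhoU uK]]] := C11_ball U0 Cu.
have du x : `|x| < rho -> differentiable u x by move=> xr; have [+ _] := Cu; apply; exact: rhoU.
exists A => //; exists K, rho; split => //.
have g0 : grad u 0 = 0.
  apply: contra_notP nint => /eqP g0.
  have m0 : 0 < Num.min rho (`|grad u 0| / (K + 1)).
    by rewrite lt_min rho0 divr_gt0 ?normr_gt0// ltr_wpDl.
  apply/nbhs_ballP; exists (Num.min rho (`|grad u 0| / (K + 1))) => // y.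
  rewrite -ball_normE/= sub0r normrN lt_min => /andP[yr].
  rewrite ltr_pdivlMr ?ltr_wpDl// mulrDr mulr1 => yg; split; first exact: rhoU.
  apply: enorm_gt0; apply: contraTneq yg => gy.
  have := uK 0 y; rewrite normr0 gy subr0 sub0r normrN -leNgt => /(_ rho0 yr) h.
  by apply: le_trans h _; rewrite mulrC lerDl.
pose a := rho / 2; have a0 : 0 < a by rewrite divr_gt0.
have ar : a < rho by rewrite /a; lra.
have cr x : `|clamp a x| < rho by apply: le_lt_trans ar; apply: clamp_norm; exact: ltW.
have near_clamp x : `|x| < a -> \near x, clamp a x = x.
  move=> xa; apply/nbhs_ballP; exists (a - `|x|) => /=; first by rewrite subr_gt0.
  move=> y; rewrite -ball_normE/= => xy; apply: clamp_id.
  have := ler_normB x (x - y); rewrite subKr => h; apply: le_trans h _; move: xy; lra.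
have cu : continuous (fun x => u (clamp a x) - u 0).
  move=> x; apply: continuousB; last exact: cst_continuous.
  apply: (@continuous_comp _ _ _ (clamp a) u); first exact: cont_clamp.
  exact/differentiable_continuous/du/cr.
have c0 : clamp a 0 = 0 by apply: clamp_id; rewrite normr0 ltW.
have u0 : u (clamp a 0) - u 0 = 0 by rewrite c0 subrr.
have V0 : grad u (clamp a 0) = 0 by rewrite c0.
have VK x y : `|grad u (clamp a x) - grad u (clamp a y)| <= K * `|x - y|.
  apply: le_trans (uK _ _ (cr x) (cr y)) _; rewrite ler_wpM2l//; exact: clamp_lip.
have dV x v : `|x| < a -> is_derive x v (fun y => u (clamp a y) - u 0) (dot v (grad u (clamp a x))).
  move=> xa; rewrite clamp_id ?ltW//.
  have h1 : is_derive x v (fun y => u y - u 0) (dot v (grad u x)).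
    rewrite -[X in is_derive _ _ _ X]subr0.
    have dx := du x (lt_trans xa ar).
    exact: (is_deriveB (is_derive_grad v dx) (is_derive_cst _ _ _)).
  apply: near_eq_is_derive h1; near=> y; congr (u _ - _); apply/esym; near: y; exact: near_clamp.
have hN x : `|x| < a -> ~ (U `&` [set x | ~ ((forall i : 'I_n, derivable (partial i u) x (e_ i)) /\
    laplacian u x = \1_(noncritical U u) x)]) x -> exists2 l : 'I_n -> R,
    forall i, is_derive x (e_ i) (fun y => grad u (clamp a y) 0 i) (l i) &
    \sum_i l i = (grad u (clamp a x) != 0)%:R.
  move=> xa /not_andP[/(_ (rhoU x (lt_trans xa ar)))//|/contrapT[dp lap]].
  exists (fun i => partial i (partial i u) x) => [i|].
    have h1 : is_derive x (e_ i) (partial i u) (partial i (partial i u) x).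
      by apply: DeriveDef; [exact: dp|].
    by apply: near_eq_is_derive h1; near=> y; rewrite (_ : clamp a y = y) ?mxE//; near: y; exact: near_clamp.
  rewrite clamp_id ?ltW// -/(laplacian u x) lap indicE; congr (_%:R); congr nat_of_bool.
  have [g|g] := eqVneq (grad u x) 0.
    by apply/negbTE/negP => /set_mem[_]; rewrite g enormE dot0l sqrtr0 ltxx.
  by apply/mem_set; split; [exact: rhoU (lt_trans xa ar)|exact: enorm_gt0].
have blow (e M b : R) : 0 < e -> 0 < b -> exists2 c : R, 0 < c <= b &
    forall y, `|y| <= M * c -> `|grad u (clamp a y) - y *m A| <= e * c.
  (* this Euclidean ball contains the sup-norm ball of radius M *)
  move=> e0 b0; pose s := n%:R * `|M| + 1.
  have s0 : 0 < s by rewrite ltr_wpDl ?mulr_ge0.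
  have half : 0 < (2^-1 : R) < 1 by rewrite invr_gt0 ltr0n /= invf_lt1 // ltr1n.
  have [_ _ /fine_cvgP[fin /cvgr0Pnorm_le /(_ e e0) le]] := cv _ half s s0.
  have sm (d : R) : 0 < d -> \forall k \near \oo, r k <= d.
    move=> d0; move/cvgr0Pnorm_le : rcv => /(_ d d0); apply: filterS => k.
    by rewrite ger0_norm// ltW.
  near \oo => k.
  have rb : r k <= b by near: k; exact: sm.
  have ra : r k <= a / s by near: k; apply: sm; rewrite divr_gt0.
  have fk : C1a_norm 2^-1 s (fun y => rescale u 0 (r k) y - quad A y) \is a fin_num by near: k.
  have lk : `|(fine \o (fun k => C1a_norm 2^-1 s (fun y => rescale u 0 (r k) y - quad A y))) k| <= e by near: k.
  exists (r k); first by rewrite r0.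
  move=> y yM; have rk := r0 k; pose x := (r k)^-1 *: y.
  have yx : y = r k *: x by rewrite scalerA divff ?gt_eqF// scale1r.
  have xM : `|x| <= `|M|.
    rewrite normrZ gtr0_norm ?invr_gt0// mulrC ler_pdivrMr//; apply: le_trans yM _.
    by rewrite ler_wpM2r ?(ltW rk)// ler_norm.
  have hx : eball s x.
    apply: le_lt_trans (enorm_le x) _; rewrite /s.
    by apply: le_lt_trans (_ : n%:R * `|M| < _); rewrite ?ltrDl// ler_wpM2l.
  have ya : `|y| < a.
    rewrite yx normrZ gtr0_norm//; apply: (@lt_le_trans _ _ (r k * s)); first by rewrite ltr_pM2l// eball_norm.
    by rewrite -ler_pdivlMr.
  have gE : grad (fun y => rescale u 0 (r k) y - quad A y) x = (r k)^-1 *: grad u y - x *m A.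
    rewrite yx; apply: (@grad_unique _ _ _ (fun x => (r k)^-1 *: grad u (r k *: x) - x *m A)) => v.
    rewrite dotBr; apply: is_deriveB; last exact: is_derive_quad.
    have rx : `|r k *: x| < rho by rewrite -yx; exact: lt_trans ya ar.
    have := @is_derive_rescale _ _ rho u du (r k) x v rk rx.
    by congr (is_derive _ _ _ _); apply/funext => z; rewrite /rescale add0r.
  rewrite (clamp_id (ltW ya)).
  have -> : grad u y - y *m A = r k *: ((r k)^-1 *: grad u y - x *m A).
    by rewrite scalerBr scalerA divff ?gt_eqF// scale1r scalemxAl -yx.
  rewrite normrZ gtr0_norm// mulrC ler_wpM2r ?(ltW rk)// -gE.
  apply: le_trans (norm_le_enorm _) _; apply: le_trans (le_trans (ler_norm _) lk).
  by rewrite -lee_fin/= fineK//; exact: grad_le_C1a_norm.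
move=> e e0.
have [d d0 Hd] := gradient_expansion K0 a0 cu u0 V0 VK dV (lebesgue_null_negligible eqn) hN AT A1 blow e0.
exists (Num.min d a); first by rewrite lt_min d0.
move=> y; rewrite le_min => /andP[yd ya]; have := Hd y yd; by rewrite clamp_id.
Unshelve. all: by end_near.
Qed.

End Localization.

(** * Uniqueness of blow-ups *)

Section Uniqueness.
Variables (R : realType) (n : nat).
Hypothesis n0 : (0 < n)%N.
Local Notation E := 'rV[R]_n.
Implicit Types (g h : E -> R).

Lemma cvg_C1a_unique (alpha beta : R) (T : Type) (F : set_system T) (f : T -> E -> R) g h :
  ProperFilter F -> cvg_C1a_loc alpha F f g -> cvg_C1a_loc beta F f h -> g = h.
Proof.
move=> FF fg fh; apply/funext => x.
have cg : f t x @[t --> F] --> g x by exact: cvg_C1a_pointwise fg.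
have ch : f t x @[t --> F] --> h x by exact: cvg_C1a_pointwise fh.
by rewrite -(cvg_lim (@Rhausdorff R) cg) -(cvg_lim (@Rhausdorff R) ch).
Qed.

Lemma cvg_C1a_comp (alpha : R) (T S : Type) (F : set_system T) (G : set_system S) (r : S -> T)
  (f : T -> E -> R) g : r @ G --> F -> cvg_C1a_loc alpha F f g ->
  cvg_C1a_loc alpha G (fun k => f (r k)) g.
Proof.
move=> rF h s s0; have [h1 h2 h3] := h s s0; split => //; first exact: (rF _ h1).
exact: (@cvg_comp _ _ _ r (fun t => C1a_norm alpha s (fun x => f t x - g x)) G F _ rF h3).
Qed.

Lemma decreases_to_0_right (r : nat -> R) : decreases_to_0 r -> r @ \oo --> 0^'+.
Proof.
move=> [r0 rc] B /nbhs_ballP[e /= e0 eB].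
have /cvgr0Pnorm_lt /(_ e e0) := rc.
apply: filterS => k rk; apply: eB => //.
by rewrite -ball_normE/= sub0r normrN.
Qed.

End Uniqueness.

Theorem theorem1p1 (R : realType) (n : nat) (hn : (2 <= n)%N)
    (U : set 'rV[R]_n) (u : 'rV[R]_n -> R)
    (hU : open U) (hU0 : U 0)
    (hu : solution U u) (hsing : singular_point U u 0) :
  (exists! A0 : 'M[R]_n,
     [/\ A0^T = A0, \tr A0 = 1
       & forall alpha : R, 0 < alpha < 1 ->
         cvg_C1a_loc alpha 0^'+
           (fun r x => (u (r *: x) - u 0) / r ^+ 2) (quad A0)]) /\
  (forall alpha : R, 0 < alpha < 1 ->
     exists! p : 'rV[R]_n -> R, quadratic_blowup alpha u 0 p).
Proof.
have n0 : (0 < n)%N by exact: ltnW.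
have [A [AT A1] [K [rho [K0 rho0 du uK gu]]]] := singular_expansion n0 hU0 hu hsing.
have cv alpha : 0 < alpha < 1 -> cvg_C1a_loc alpha 0^'+ (fun r x => (u (r *: x) - u 0) / r ^+ 2) (quad A).
  by move=> a01; exact: (cvg_rescale n0 K0 rho0 du uK AT gu a01).
have cvr alpha r : 0 < alpha < 1 -> decreases_to_0 r ->
    cvg_C1a_loc alpha \oo (fun k => rescale u 0 (r k)) (quad A).
  move=> a01 /decreases_to_0_right rr; have h := cvg_C1a_comp rr (cv alpha a01).
  rewrite (_ : (fun k => rescale u 0 (r k)) = (fun k x => (u (r k *: x) - u 0) / r k ^+ 2)) //.
  by apply/funext => k; apply/funext => x; rewrite /rescale add0r.
split.
  exists A; split => // B [BT _ cB].
  have half : 0 < (2^-1 : R) < 1 by rewrite invr_gt0 ltr0n /= invf_lt1 // ltr1n.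
  apply: quad_inj => //; exact: (cvg_C1a_unique n0 _ (cv _ half) (cB _ half)).
move=> alpha a01; exists (quad A); split.
  exists (fun k => k.+1%:R^-1); last first.
    by apply: cvr => //; split; [move=> k; rewrite invr_gt0|exact: cvg_harmonic].
  by split; [move=> k; rewrite invr_gt0|exact: cvg_harmonic].
move=> p [r rd cp]; exact: (cvg_C1a_unique n0 _ (cvr alpha r a01 rd) cp).
Qed.
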